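(* Let $K$ and $\varkappa$ be real functions defined in a domain $\mathcal D\subset\mathbb R^2$, satisfying $K^2-\varkappa^2<0$, and let the pair $(K,\varkappa)$ be a solution in $\mathcal D$ of the system \[ \sqrt[4]{|K^2-\varkappa^2|}\;\Delta^h\ln|K^2-\varkappa^2|=-8K,\qquad \sqrt[4]{|K^2-\varkappa^2|}\;\Delta^h\ln\left|\frac{K+\varkappa}{K-\varkappa}\right|=-4\varkappa , \] where $\Delta^h=\frac{\partial^2}{\partial u^2}-\frac{\partial^2}{\partial v^2}$. Then in a neighborhood of any point $t_0\in\mathcal D$ there exists a minimal time-like surface $\mathcal M$ of the third type in $\mathbb R^4_2$, unique up to a proper motion in $\mathbb R^4_2$, given in canonical coordinates $(u,v)$, whose Gauss curvature and curvature of the normal connection are the given functions $K$ and $\varkappa$, respectively.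
   Context: All maps are smooth and domains are open and connected. $\mathbb R^4_2$ is $\mathbb R^4$ with scalar product $a\cdot b=-a_1b_1+a_2b_2-a_3b_3+a_4b_4$ and its standard orientation; $a^2=a\cdot a$. A proper motion is $x\mapsto Ax+b$ with $A\in\mathbf{SO}(2,2,\mathbb R)$ (linear, preserving the scalar product, $\det A=1$), $b\in\mathbb R^4_2$. Double numbers: $\mathbb D=\{t=u+\mathrm jv:u,v\in\mathbb R\}$, $\mathrm j^2=1$, $\bar t=u-\mathrm jv$, $|t|^2=t\bar t=u^2-v^2$; $\mathbb D_+=\{t:|t|^2>0,\ \mathrm{Re}\,t>0\}$; $\mathbb R^2$ is identified with $\mathbb D$; $\frac{\partial}{\partial t}=\frac12(\frac{\partial}{\partial u}+\mathrm j\frac{\partial}{\partial v})$. $\mathbb D^4_2$ is $\mathbb D^4$ with the $\mathbb D$-bilinear extension of the scalar product. A time-like surface $\mathcal M=(\mathcal D,x)$ in $\mathbb R^4_2$ is an immersion $x:\mathcal D\to\mathbb R^4_2$ whose induced scalar product on tangent planes is indefinite (signature $(1,1)$). Coordinates $(u,v)$ are isothermal if $x_u^2=-x_v^2$ and $x_u\cdot x_v=0$; always with $E=x_u^2<0$. Let $\sigma$ be the second fundamental form, $(X_1,X_2)$ an orthonormal tangent frame with $X_1^2=-1$, $X_2^2=1$, and $(n_1,n_2)$ an orthonormal normal frame with $n_1^2=-1$, $n_2^2=1$ such that $(X_1,X_2,n_1,n_2)$ is right (positively) oriented in $\mathbb R^4_2$. The surface is minimal if $H=\frac12(-\sigma(X_1,X_1)+\sigma(X_2,X_2))=0$.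 Gauss curvature: $K=-R(X_1,X_2)X_2\cdot X_1$; curvature of the normal connection: $\varkappa=R^N(X_1,X_2)n_2\cdot n_1$, where $R,R^N$ are the curvature tensors of the Levi-Civita and the normal connections, with $R(X,Y)=\nabla_X\nabla_Y-\nabla_Y\nabla_X-\nabla_{[X,Y]}$ (similarly $R^N$). For isothermal $t=u+\mathrm jv$ put $\Phi=x_u+\mathrm jx_v$ and $\Phi'=\partial\Phi/\partial t$; $\Phi'^\bot$ is the projection of $\Phi'$ to the complexified normal space (the $\mathbb D$-span of the normal space), along the complexified tangent space, and ${\Phi'^\bot}^2=\Phi'^\bot\cdot\Phi'^\bot\in\mathbb D$. A minimal time-like surface is of the third type if $\pm\mathrm j{\Phi'^\bot}^2\in\mathbb D_+$ for one of the signs, i.e. $\big|{\Phi'^\bot}^2\big|^2<0$, at all points (this does not depend on the isothermal coordinates). For such a surface, isothermal coordinates with $E<0$ are canonical if ${\Phi'^\bot}^2=\mathrm j$. *)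

(* Defs.v *)
From HB Require Import structures.
From mathcomp Require Import all_boot all_order all_algebra.
From mathcomp Require Import all_classical all_reals all_analysis.
From mathcomp Require Import ring.

Set Implicit Arguments.
Unset Strict Implicit.
Unset Printing Implicit Defensive.

Import Order.TTheory GRing.Theory Num.Theory.
Import numFieldNormedType.Exports.

Local Open Scope classical_set_scope.
Local Open Scope ring_scope.

(* [DNum u v] is the double number [u + j v], where [j ^ 2 = 1]. *)
Record dnum (R : Type) := DNum { dRe : R; dIm : R }.

Definition pair_of_dnum R (t : dnum R) := (dRe t, dIm t).
Definition dnum_of_pair R (a : R * R) := DNum a.1 a.2.
Lemma pair_of_dnumK R : cancel (@pair_of_dnum R) (@dnum_of_pair R).
Proof. by case. Qed.

HB.instance Definition _ (R : eqType) :=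
  Equality.copy (dnum R) (can_type (@pair_of_dnumK R)).
HB.instance Definition _ (R : choiceType) :=
  Choice.copy (dnum R) (can_type (@pair_of_dnumK R)).

Section DoubleNumbers.
Variable R : comNzRingType.
Implicit Types s t r : dnum R.

Definition dadd s t := DNum (dRe s + dRe t) (dIm s + dIm t).
Definition dopp t := DNum (- dRe t) (- dIm t).
Definition dmul s t :=
  DNum (dRe s * dRe t + dIm s * dIm t) (dRe s * dIm t + dIm s * dRe t).

Fact daddA : associative dadd.
Proof. by move=> [a b] [c d] [e f]; congr DNum; rewrite /= addrA. Qed.
Fact daddC : commutative dadd.
Proof. by move=> [a b] [c d]; congr DNum; rewrite /= addrC. Qed.
Fact dadd0 : left_id (DNum 0 0) dadd.
Proof. by move=> [a b]; congr DNum; rewrite /= add0r. Qed.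
Fact daddN : left_inverse (DNum 0 0) dopp dadd.
Proof. by move=> [a b]; congr DNum; rewrite /= addNr. Qed.

HB.instance Definition _ :=
  GRing.isZmodule.Build (dnum R) daddA daddC dadd0 daddN.

Fact dmulA : associative dmul.
Proof. by move=> [a b] [c d] [e f]; congr DNum => /=; ring. Qed.
Fact dmulC : commutative dmul.
Proof. by move=> [a b] [c d]; congr DNum => /=; ring. Qed.
Fact dmul1 : left_id (DNum 1 0) dmul.
Proof. by move=> [a b]; congr DNum; rewrite /= !mul1r !mul0r addr0. Qed.
Fact dmulDl : left_distributive dmul +%R.
Proof.
by move=> [a b] [c d] [e f]; congr DNum => /=; ring.
Qed.
Fact dnum1_neq0 : DNum 1 0 != 0 :> dnum R.
Proof. by apply/eqP => -[] /eqP; rewrite oner_eq0. Qed.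

HB.instance Definition _ :=
  GRing.Zmodule_isComNzRing.Build (dnum R)
    dmulA dmulC dmul1 dmulDl dnum1_neq0.

Definition dreal (a : R) : dnum R := DNum a 0.
Definition dj : dnum R := DNum 0 1.
Definition dconj t := DNum (dRe t) (- dIm t).
(* [t * dconj t] is real, equal to [dRe t ^+ 2 - dIm t ^+ 2]. *)
Definition dnorm2 t : R := dRe (t * dconj t).

End DoubleNumbers.

Definition dplus (R : numDomainType) (t : dnum R) : Prop :=
  0 < dnorm2 t /\ 0 < dRe t.

(* The scalar product of R^4_2: signs (-, +, -, +), on row vectors. *)
Definition eta (R : pzRingType) : 'M[R]_4 :=
  diag_mx (\row_(i < 4) (-1) ^+ i.+1).

(* Used both over [R] and, as its bilinear extension, over [dnum R]. *)
Definition sdot (R : pzRingType) (a b : 'rV[R]_4) : R :=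
  (a *m eta R *m b^T) 0 0.

Definition in_SO22 (R : comPzRingType) (A : 'M[R]_4) : Prop :=
  (forall a b : 'rV[R]_4, sdot (a *m A) (b *m A) = sdot a b) /\ \det A = 1.

Section Surfaces.
Variable R : realType.
Local Notation plane := 'rV[R]_2.
Local Notation space := 'rV[R]_4.

(* The coordinates of [p] are [u = p 0 0] and [v = p 0 1]. *)
Definition unitv (i : 'I_2) : plane := delta_mx 0 i.
Definition du (V : normedModType R) (f : plane -> V) : plane -> V :=
  fun p => 'D_(unitv 0) f p.
Definition dv (V : normedModType R) (f : plane -> V) : plane -> V :=
  fun p => 'D_(unitv 1) f p.

Definition hlaplacian (f : plane -> R) (p : plane) : R :=
  du (du f) p - dv (dv f) p.

Definition is_domain (D : set plane) : Prop := open D /\ connected D.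

Fixpoint times_differentiable (V : normedModType R) (n : nat) (D : set plane)
    (f : plane -> V) : Prop :=
  if n is m.+1 then
    (forall p, D p -> differentiable f p) /\
    (forall h : plane, times_differentiable m D (fun p => 'D_h f p))
  else True.

(* C^oo on the open set [D]; the values of [f] outside [D] are irrelevant. *)
Definition smooth (V : normedModType R) (D : set plane) (f : plane -> V) :=
  forall n, times_differentiable n D f.

Local Notation vfield := (plane -> plane).

Definition lie (X Y : vfield) : vfield :=
  fun p => 'D_(X p) Y p - 'D_(Y p) X p.

Definition curvature (W : zmodType)
    (nab : vfield -> (plane -> W) -> (plane -> W)) (X Y : vfield)
    (Z : plane -> W) : plane -> W :=
  fun p => nab X (nab Y Z) p - nab Y (nab X Z) p - nab (lie X Y) Z p.

Section Geometry.
Variable x : plane -> space.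

(* [X] is a vector field on the parameter domain, [push X] is [dx (X)]. *)
Definition push (X : vfield) : plane -> space := fun p => 'D_(X p) x p.

Definition tangent_mx (p : plane) : 'M[R]_(2, 4) :=
  \matrix_(i < 2) 'D_(unitv i) x p.

Definition gram (p : plane) : 'M[R]_2 :=
  \matrix_(i, j) sdot ('D_(unitv i) x p) ('D_(unitv j) x p).

Definition timelike_surface (D : set plane) : Prop :=
  [/\ is_domain D, smooth D x &
      forall p, D p -> \rank (tangent_mx p) = 2%N /\
        exists h k : plane,
          sdot ('D_h x p) ('D_h x p) < 0 < sdot ('D_k x p) ('D_k x p)].

(* Matrix (acting on rows) of the projection onto the normal space along the
   tangent space; the rows of the [kermx] span the normal space. *)
Definition normal_proj (p : plane) : 'M[R]_4 :=
  proj_mx (kermx (eta R *m (tangent_mx p)^T)) <<tangent_mx p>>%MS.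

Definition christoffel (k i j : 'I_2) (p : plane) : R :=
  2^-1 * \sum_(l < 2) invmx (gram p) k l *
    ('D_(unitv i) (fun q => gram q j l) p
     + 'D_(unitv j) (fun q => gram q i l) p
     - 'D_(unitv l) (fun q => gram q i j) p).

(* Levi-Civita connection of the induced metric, in the coordinates (u, v). *)
Definition nabla (X Y : vfield) : vfield :=
  fun p => 'D_(X p) Y p +
    \row_k \sum_(i < 2) \sum_(j < 2) christoffel k i j p * X p 0 i * Y p 0 j.

Definition nablaN (X : vfield) (n : plane -> space) : plane -> space :=
  fun p => 'D_(X p) n p *m normal_proj p.

Definition sigma (X Y : vfield) : plane -> space :=
  fun p => 'D_(X p) (push Y) p *m normal_proj p.

Definition tangent_frame (V : set plane) (X1 X2 : vfield) : Prop :=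
  [/\ smooth V X1, smooth V X2 & forall p, V p ->
    [/\ sdot (push X1 p) (push X1 p) = -1,
        sdot (push X2 p) (push X2 p) = 1 &
        sdot (push X1 p) (push X2 p) = 0]].

Definition normal_frame (V : set plane) (n1 n2 : plane -> space) : Prop :=
  [/\ smooth V n1, smooth V n2 & forall p, V p ->
    [/\ forall h : plane, sdot (n1 p) ('D_h x p) = 0 /\
                          sdot (n2 p) ('D_h x p) = 0,
        sdot (n1 p) (n1 p) = -1,
        sdot (n2 p) (n2 p) = 1 &
        sdot (n1 p) (n2 p) = 0]].

Definition right_oriented (a b c d : space) : Prop :=
  0 < \det (\matrix_(i < 4) nth 0 [:: a; b; c; d] i).

(* The quantities below do not depend on the frames, and frames of a time-like
   surface exist near every point; hence the quantification over all frames on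
   open subsets [V] of [D]. *)

Definition minimal (D : set plane) : Prop :=
  forall (V : set plane) (X1 X2 : vfield), open V -> V `<=` D ->
    tangent_frame V X1 X2 ->
    forall p, V p -> 2^-1 *: (- sigma X1 X1 p + sigma X2 X2 p) = 0.

Definition has_gauss_curvature (D : set plane) (K : plane -> R) : Prop :=
  forall (V : set plane) (X1 X2 : vfield), open V -> V `<=` D ->
    tangent_frame V X1 X2 ->
    forall p, V p ->
      K p = - sdot (push (curvature nabla X1 X2 X2) p) (push X1 p).

Definition has_normal_curvature (D : set plane) (kappa : plane -> R) : Prop :=
  forall (V : set plane) (X1 X2 : vfield) (n1 n2 : plane -> space),
    open V -> V `<=` D ->
    tangent_frame V X1 X2 -> normal_frame V n1 n2 ->
    (forall p, V p -> right_oriented (push X1 p) (push X2 p) (n1 p) (n2 p)) ->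
    forall p, V p -> kappa p = sdot (curvature nablaN X1 X2 n2 p) (n1 p).

Definition isothermal (D : set plane) : Prop :=
  forall p, D p ->
    [/\ sdot (du x p) (du x p) = - sdot (dv x p) (dv x p),
        sdot (du x p) (dv x p) = 0 &
        sdot (du x p) (du x p) < 0].

(* Componentwise directional derivative of a map into [D^4]. *)
Definition dderive (h : plane) (F : plane -> 'rV[dnum R]_4) (p : plane) :
    'rV[dnum R]_4 :=
  map2_mx (@DNum R) ('D_h (fun q => map_mx (@dRe R) (F q)) p)
                    ('D_h (fun q => map_mx (@dIm R) (F q)) p).

(* d/dt = (d/du + j d/dv) / 2 *)
Definition dt (F : plane -> 'rV[dnum R]_4) (p : plane) : 'rV[dnum R]_4 :=
  dreal (2^-1) *: (dderive (unitv 0) F p + dj R *: dderive (unitv 1) F p).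

Definition Phi (p : plane) : 'rV[dnum R]_4 :=
  map_mx (@dreal R) (du x p) + dj R *: map_mx (@dreal R) (dv x p).

Definition Phi'N (p : plane) : 'rV[dnum R]_4 :=
  dt Phi p *m map_mx (@dreal R) (normal_proj p).

Definition Phi'N2 (p : plane) : dnum R := sdot (Phi'N p) (Phi'N p).

(* For surfaces given in isothermal coordinates. *)
Definition third_type (D : set plane) : Prop :=
  forall p, D p -> dplus (dj R * Phi'N2 p) \/ dplus (- dj R * Phi'N2 p).

Definition canonical_coordinates (D : set plane) : Prop :=
  isothermal D /\ forall p, D p -> Phi'N2 p = dj R.

Definition canonical_third_type_minimal_surface (D : set plane) : Prop :=
  [/\ timelike_surface D, minimal D, canonical_coordinates D & third_type D].

End Geometry.

End Surfaces.

(* Main.v *)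
Require Import Defs.
From HB Require Import structures.
From mathcomp Require Import all_boot all_order all_algebra.
From mathcomp Require Import all_classical all_reals all_analysis.
From mathcomp Require Import perm ring lra.

Set Implicit Arguments.
Unset Strict Implicit.
Unset Printing Implicit Defensive.

Import Order.TTheory GRing.Theory Num.Theory.
Import numFieldNormedType.Exports.

Local Open Scope classical_set_scope.
Local Open Scope ring_scope.

(** Write [xi = u + v] and [eta = u - v]. A time-like surface is minimal in
isothermal coordinates exactly when [x_xieta = 0], so it is a sum
[x = a(xi) + b(eta)] of two curves, here with null tangents [a'] and [b'], and
the coordinates are canonical exactly when [a''.a'' = 1/4] and
[b''.b'' = -1/4]. This is [null_form]; the translation is
[canonical_null_form] and [null_form_canonical]. Put [e = a'.b' < 0] and
[m = e_xieta - e_xi e_eta / e], which is the scalar product of the normal parts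
of [a''] and [b'']. The equations of Gauss and Ricci become
[K = - m / e^2] and [kappa = - det(a', b', a'', b'') / e^3]
([gauss_curvatureE], [normal_curvatureE]), and the Gram determinant of the four
vectors gives [kappa^2 - K^2 = 1 / (16 e^4)].

Uniqueness. The two curvatures determine [e] and the determinant. The Gram
matrix of the frame [F = (a', b', a'', b'')], and the products of its
derivatives with its members, are expressions in [e] and its derivatives. If
two surfaces have the same curvatures, then [F_x^-1 F_y] has derivative zero on
the connected domain; it is a constant isometry, of determinant one because the
two determinants agree ([null_form_unique]).

Existence. Let [eps] be the sign of [kappa], [A = eps (K + kappa)] and
[B = eps (kappa - K)], both positive, and [psi = (A^3 / B)^(-1/8)],
[chi = (B^3 / A)^(-1/8)]. The system decouples into two Liouville equations,
[psi psi_xieta - psi_xi psi_eta = eps / 4] and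
[chi chi_xieta - chi_xi chi_eta = - eps / 4] ([liouville_psi],
[liouville_chi]). Such an equation makes [psi_xixi / psi] a function of [xi]
alone: the functions [psi(., eta)] solve one linear equation of order two, and
Wronskians yield [psi = p1(xi) r2(eta) - p2(xi) r1(eta)] with explicit
factors ([factorisation]). Similarly [chi = q1(xi) s2(eta) - q2(xi) s1(eta)].
Now [R^4_2] is the space of matrices of order two with the determinant as
quadratic form, in which the null vectors are the tensors of rank one, and
[a' = 2 p (x) q], [b' = - (1/2) r (x) s] have the required normalisation and the
metric [e = - psi chi / 2]. Integrating them gives the surface
([surface_from_factors]), and its curvatures are [K] and [kappa]
([curvatures_from_logs]). *)

(** * Functions along lines *)

Section Lines.
Variables (R : realType) (V : normedModType R).
Implicit Types (f : V -> R) (p h k : V).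

Lemma is_derive_line (W : normedModType R) (f : V -> W) p h (s : R) :
  differentiable f (p + s *: h) ->
  is_derive s 1 (fun s => f (p + s *: h)) ('D_h f (p + s *: h)).
Proof.
move=> df; have : derivable f (p + s *: h) h by exact: diff_derivable.
have e : (fun r : R => r^-1 *: (f (r *: h + (p + s *: h)) - f (p + s *: h))) =
   (fun r : R => r^-1 *: (f (p + (r *: 1 + s) *: h) - f (p + s *: h))).
  apply/funext => r /=; congr (_ *: (f _ - _)).
  by rewrite [_ *: 1]mulr1 scalerDl addrCA addrA.
split; first by rewrite /derivable -e.
by rewrite /derive -e.
Qed.

Lemma derive_dir_linear (W : normedModType R) (f : V -> W) p h k (a b : R) :
  differentiable f p -> 'D_(a *: h + b *: k) f p = a *: 'D_h f p + b *: 'D_k f p.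
Proof. by move=> df; rewrite !deriveE // linearD !linearZ. Qed.

Lemma line_mvt f p h (a b : R) : a < b ->
  (forall s, a <= s <= b -> differentiable f (p + s *: h)) ->
  exists2 c, a < c < b & f (p + b *: h) - f (p + a *: h) = 'D_h f (p + c *: h) * (b - a).
Proof.
move=> ab df.
have D s : a <= s <= b -> is_derive s 1 (fun s => f (p + s *: h)) ('D_h f (p + s *: h)).
  by move=> /df; exact: is_derive_line.
have [| |c] := @MVT R (fun s => f (p + s *: h)) (fun s => 'D_h f (p + s *: h)) a b ab.
- by move=> s; rewrite in_itv /= => /andP[as_ sb]; apply: D; rewrite !ltW.
- apply: continuous_in_subspaceT => s; rewrite inE /= in_itv /= => /D [ds _].
  exact/differentiable_continuous/derivable1_diffP.
by rewrite in_itv /= => cab; exists c.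
Qed.

Lemma line_const f p h :
  (forall s, 0 <= s <= 1 -> differentiable f (p + s *: h)) ->
  (forall s, 0 <= s <= 1 -> 'D_h f (p + s *: h) = 0) -> f (p + h) = f p.
Proof.
move=> df D0; have [c /andP[c0 c1]] := line_mvt ltr01 df.
rewrite scale1r scale0r addr0 D0 ?mul0r; first by move/eqP; rewrite subr_eq0 => /eqP.
by rewrite !ltW.
Qed.

Lemma ball_segment (c p q : V) (r s : R) : ball c r p -> ball c r q ->
  0 <= s <= 1 -> ball c r (p + s *: (q - p)).
Proof.
rewrite -ball_normE /ball_ /= => Bp Bq /andP[s0 s1].
have -> : c - (p + s *: (q - p)) = (1 - s) *: (c - p) + s *: (c - q).
  have -> : q - p = (c - p) - (c - q) by rewrite opprB [RHS]addrC addrA subrK.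
  by rewrite opprD addrA scalerBr scalerBl scale1r opprB addrA addrAC.
rewrite (le_lt_trans (ler_normD _ _))// !normrZ (ger0_norm s0) ger0_norm ?subr_ge0//.
have [->|s1'] := eqVneq s 1; first by rewrite subrr mul0r add0r mul1r.
have : (1 - s) * `|c - p| < (1 - s) * r by rewrite ltr_pM2l // subr_gt0 lt_neqAle s1'.
have : s * `|c - q| <= s * r by rewrite ler_wpM2l // ltW.
by lra.
Qed.

(** The function is locally constant by the mean value theorem on segments in
balls, so its level sets are relatively clopen. *)
Lemma connected_const (D : set V) (f : V -> R) :
  open D -> connected D -> (forall p, D p -> differentiable f p) ->
  (forall p h, D p -> 'D_h f p = 0) -> forall p q, D p -> D q -> f q = f p.
Proof.
move=> oD cD df D0.
have loc p : D p -> exists2 r, 0 < r & forall q, ball p r q -> D q /\ f q = f p.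
  move=> Dp; have /nbhs_ballP[r /= r0 rD] : nbhs p D by exact: open_nbhs_nbhs.
  exists r => // q Bq; split; first exact: rD.
  have S s : 0 <= s <= 1 -> D (p + s *: (q - p)).
    by move=> s01; apply: rD; apply: ball_segment => //; exact: ballxx.
  have <- : p + (q - p) = q by rewrite addrC subrK.
  by apply: line_const => s /S ?; [exact: df|exact: D0].
have oC (P : R -> Prop) : open [set q | D q /\ P (f q)].
  rewrite openE => q /= [Dq Pq]; have [r r0 rD] := loc _ Dq.
  by apply/nbhs_ballP; exists r => // q' /rD [? e]; split => //=; rewrite e.
move=> p q Dp Dq.
have E : [set q | D q /\ f q = f p] = D.
  apply: cD; first by exists p.
    exists [set q | D q /\ f q = f p]; first exact: oC (fun y => y = f p).
    by apply/seteqP; split=> z /=; tauto.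
  exists (~` [set q | D q /\ f q <> f p]).
    by apply: open_closedC; exact: oC (fun y => y <> f p).
  apply/seteqP; split=> z /=; first by tauto.
  by move=> [Dz /not_andP[//|/contrapT]].
by have : D q by []; rewrite -E => -[].
Qed.
End Lines.

(** * Smooth functions on plane domains *)

Section Calculus.
Variable R : realType.
Local Notation plane := 'rV[R]_2.
Implicit Types (p h k : plane) (D : set plane).

Lemma near_eq_on (T : Type) D (f g : plane -> T) p : open D ->
  (forall q, D q -> f q = g q) -> D p -> \near p, f p = g p.
Proof.
by move=> oD fg Dp; apply: filterS (open_nbhs_nbhs (conj oD Dp)).
Qed.

Lemma derive_on (W : normedModType R) D (f g : plane -> W) p h : open D ->
  (forall q, D q -> f q = g q) -> D p -> 'D_h f p = 'D_h g p.
Proof. by move=> oD fg Dp; apply: near_eq_derive; exact: near_eq_on Dp. Qed.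

(** The Taylor remainder at [p] vanishes identically near [p]. *)
Lemma differentiable_near0 (V W : normedModType R) (z : V -> W) (p : V) :
  (\near p, z p = 0) -> differentiable z p.
Proof.
move=> z0.
have e : z \o shift p = cst (z p) + (\0 : V -> W) +o_ 0 id.
  apply/eqaddoP => _/posnumP[eps].
  have : \forall y \near (0 : V), z (y + p) = 0.
    have := z0; rewrite (near_shift (0 : V)).
    by apply: filterS => y; rewrite /= subr0.
  apply: filterS => y /= zy.
  rewrite !fctE /= zy (nbhs_singleton z0) !addr0 subrr normr0.
  by rewrite mulr_ge0.
have c0 : continuous (\0 : V -> W) by exact: cst_continuous.
by apply/diff_locallyP; rewrite (diff_unique c0 e).
Qed.

Lemma differentiable_on (W : normedModType R) D (f g : plane -> W) p : open D ->
  (forall q, D q -> f q = g q) -> D p -> differentiable f p -> differentiable g p.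
Proof.
move=> oD fg Dp df.
have -> : g = f + (g - f) by rewrite addrC subrK.
apply: differentiableD => //; apply: differentiable_near0.
have := near_eq_on oD fg Dp; apply: filterS => q /= e.
by rewrite !fctE e subrr.
Qed.

Lemma derive_comp1 (F : R -> R) (dF : R) (f : plane -> R) p h :
  is_derive (f p) 1 F dF -> differentiable f p ->
  differentiable (fun q => F (f q)) p /\ 'D_h (fun q => F (f q)) p = dF * 'D_h f p.
Proof.
move=> [dF1 eF] df; have dF2 : differentiable F (f p) by apply/derivable1_diffP.
have dc : differentiable (F \o f) p by exact: differentiable_comp.
split; first exact: dc.
rewrite (deriveE h dc) diff_comp //= -(deriveE h df) deriv1E //=.
by rewrite derive1E eF mulrC.
Qed.

Lemma differentiable_mx m n (f : plane -> 'M[R]_(m, n)) p :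
  (forall i j, differentiable (fun q => f q i j) p) -> differentiable f p.
Proof.
move=> df.
have -> : f = \sum_(i < m) \sum_(j < n) (fun q => f q i j *: delta_mx i j).
  apply/funext => q; rewrite fct_sumE [LHS]matrix_sum_delta; apply: eq_bigr => i _.
  by rewrite fct_sumE.
by do 2!(apply: differentiable_sum => ?); exact: differentiableZl.
Qed.

Lemma differentiable_entry m n (f : plane -> 'M[R]_(m, n)) p i j :
  differentiable f p -> differentiable (fun q => f q i j) p.
Proof.
move=> df; apply: (differentiable_comp (g := fun N : 'M[R]_(m, n) => N i j : R)) => //.
exact: differentiable_coord.
Qed.

Lemma derive_entry m n (f : plane -> 'M[R]_(m, n)) p h i j :
  differentiable f p -> 'D_h f p i j = 'D_h (fun q => f q i j) p.
Proof. by move=> df; rewrite derive_mx ?mxE //; exact: diff_derivable. Qed.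

Lemma derive_affine (W : normedModType R) (f : plane -> W) (M : 'M[R]_2) (c : plane) p h :
  differentiable f (p *m M + c) ->
  differentiable (fun q => f (q *m M + c)) p /\
  'D_h (fun q => f (q *m M + c)) p = 'D_(h *m M) f (p *m M + c).
Proof.
move=> df.
have dg : is_diff p (fun q : plane => q *m M + c) (fun h => h *m M).
  have dM : is_diff p (fun q : plane => q *m M) (fun h => h *m M).
    have cM : continuous (mulmxr M : plane -> plane).
      move=> q; apply: differentiable_continuous; apply: differentiable_mx => i j.
      rewrite /=; under eq_fun do rewrite mxE.
      rewrite (_ : (fun _ => _) = \sum_(k < 2) (fun x : plane => x i k * M k j)); last first.
        by apply/funext => x; rewrite fct_sumE.
      apply: differentiable_sum => k; apply: differentiableM; last exact: differentiable_cst.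
      exact: differentiable_coord.
    apply: DiffDef; first exact: (linear_differentiable (f := mulmxr M)).
    by rewrite (diff_lin (f := mulmxr M)).
  have := is_diffD dM (is_diff_cst c p).
  move=> H; apply: (is_diff_eq H); apply/funext => q /=; exact: addr0.
have dc : differentiable (f \o (fun q => q *m M + c)) p.
  by apply: differentiable_comp.
split; first exact: dc.
by rewrite (deriveE h dc) diff_comp //= (deriveE _ df) diff_val.
Qed.

Lemma times_differentiable_on (W : normedModType R) n D (f g : plane -> W) : open D ->
  (forall q, D q -> f q = g q) -> times_differentiable n D f -> times_differentiable n D g.
Proof.
move=> oD; elim: n f g => // n IH f g fg /= [df tf]; split.
  by move=> p Dp; apply: (differentiable_on oD fg) => //; exact: df.
move=> h; apply: IH (tf h) => q Dq; exact: (derive_on _ oD fg).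
Qed.

Lemma times_differentiable_sub (W : normedModType R) n D D' (f : plane -> W) : D' `<=` D ->
  times_differentiable n D f -> times_differentiable n D' f.
Proof.
move=> sD; elim: n f => // n IH f /= [df tf]; split; last by move=> h; exact: IH.
by move=> p /sD; exact: df.
Qed.

Lemma times_differentiable_pred (W : normedModType R) n D (f : plane -> W) :
  times_differentiable n.+1 D f -> times_differentiable n D f.
Proof.
elim: n f => // n IH f [df tf]; split => // h; exact: IH.
Qed.

Lemma smooth_on (W : normedModType R) D (f g : plane -> W) : open D ->
  (forall q, D q -> f q = g q) -> smooth D f -> smooth D g.
Proof. by move=> oD fg sf n; exact: times_differentiable_on (sf n). Qed.

Lemma smooth_sub (W : normedModType R) D D' (f : plane -> W) : D' `<=` D ->
  smooth D f -> smooth D' f.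
Proof. by move=> sD sf n; exact: times_differentiable_sub (sf n). Qed.

Lemma smooth_diff (W : normedModType R) D (f : plane -> W) p : smooth D f -> D p ->
  differentiable f p.
Proof. by move=> sf; have [df _] := sf 1%N; exact: df. Qed.

Lemma smooth_derive (W : normedModType R) D (f : plane -> W) h : smooth D f ->
  smooth D (fun p => 'D_h f p).
Proof. by move=> sf n; have [_] := sf n.+1; exact. Qed.

Lemma times_differentiable_cst (W : normedModType R) n D (c : W) : times_differentiable n D (fun=> c).
Proof.
elim: n c => // n IH c; split; first by move=> p _; exact: differentiable_cst.
by move=> h; under eq_fun do rewrite derive_cst; exact: IH.
Qed.

Lemma smooth_cst (W : normedModType R) D (c : W) : smooth D (fun=> c).
Proof. by move=> n; exact: times_differentiable_cst. Qed.

Section Open.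
Variables (D : set plane) (oD : open D).

Lemma times_differentiable_add (W : normedModType R) n (f g : plane -> W) :
  times_differentiable n D f -> times_differentiable n D g ->
  times_differentiable n D (fun p => f p + g p).
Proof.
elim: n f g => // n IH f g [df tf] [dg tg]; split.
  by move=> p Dp; apply: differentiableD; [exact: df|exact: dg].
move=> h; apply: (times_differentiable_on oD) (IH _ _ (tf h) (tg h)) => p Dp.
by rewrite -deriveD //; apply: diff_derivable; [exact: df|exact: dg].
Qed.

Lemma times_differentiable_mul n (f g : plane -> R) :
  times_differentiable n D f -> times_differentiable n D g ->
  times_differentiable n D (fun p => f p * g p).
Proof.
elim: n f g => // n IH f g tf tg.
have [tf' tg'] := (times_differentiable_pred tf, times_differentiable_pred tg); move: tf tg => [df tf] [dg tg]; split.
  by move=> p Dp; apply: differentiableM; [exact: df|exact: dg].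
move=> h; apply: (times_differentiable_on oD) (times_differentiable_add (IH _ _ tf' (tg h)) (IH _ _ tg' (tf h))) => p Dp.
by rewrite -deriveM //; apply: diff_derivable; [exact: df|exact: dg].
Qed.

(** The derivatives of [F o f] are products of [F' o f] and derivatives of [f].
So one order of differentiability is gained as soon as [F' o f] has the order
of [F o f], which happens when [F'] is an expression in [F], as for the
exponential and the inverse. *)
Lemma smooth_comp_bootstrap (F : R -> R) (dF : plane -> R) (f : plane -> R) :
  smooth D f -> (forall p, D p -> is_derive (f p) 1 F (dF p)) ->
  (forall n, times_differentiable n D (fun p => F (f p)) ->
    times_differentiable n D dF) ->
  smooth D (fun p => F (f p)).
Proof.
move=> sf DF tdF; elim=> // n IH; split.
  move=> p Dp; exact: (derive_comp1 0 (DF p Dp) (smooth_diff sf Dp)).1.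
move=> h; apply: (times_differentiable_on oD) (times_differentiable_mul (tdF _ IH) (smooth_derive h sf n)) => p Dp.
exact/esym/(derive_comp1 _ (DF p Dp) (smooth_diff sf Dp)).2.
Qed.

Lemma smooth_add (W : normedModType R) (f g : plane -> W) :
  smooth D f -> smooth D g -> smooth D (fun p => f p + g p).
Proof. by move=> sf sg n; apply: times_differentiable_add. Qed.

Lemma smooth_mul (f g : plane -> R) :
  smooth D f -> smooth D g -> smooth D (fun p => f p * g p).
Proof. by move=> sf sg n; apply: times_differentiable_mul. Qed.

Lemma smooth_opp (f : plane -> R) : smooth D f -> smooth D (fun p => - f p).
Proof.
move=> sf; have := smooth_mul (smooth_cst D (-1 : R)) sf.
by apply: (smooth_on oD) => p _; rewrite mulN1r.
Qed.

Lemma smooth_inv (f : plane -> R) : smooth D f -> (forall p, D p -> f p != 0) ->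
  smooth D (fun p => (f p)^-1).
Proof.
move=> sf f0; apply: (@smooth_comp_bootstrap _ (fun p => - ((f p)^-1 * (f p)^-1))) => //.
  move=> p Dp; have := f0 p Dp => fp.
  have [dV eV] := @realfun.is_deriveV _ (@id R) (f p) 1 1 fp (is_derive_id _ _).
  split; first exact: dV.
  by rewrite [LHS]eV [LHS]mulr1 -invfM -expr2.
move=> n tn; have := times_differentiable_mul (times_differentiable_cst n D (-1 : R)) (times_differentiable_mul tn tn).
by apply: (times_differentiable_on oD) => p _; rewrite mulN1r.
Qed.

Lemma smooth_exp (f : plane -> R) : smooth D f -> smooth D (fun p => expR (f p)).
Proof.
move=> sf; apply: (@smooth_comp_bootstrap _ (fun p => expR (f p))) => // p Dp; exact: is_derive_expR.
Qed.

Lemma smooth_ln (f : plane -> R) : smooth D f -> (forall p, D p -> 0 < f p) ->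
  smooth D (fun p => ln (f p)).
Proof.
move=> sf f0; apply: (@smooth_comp_bootstrap _ (fun p => (f p)^-1)) => //.
  by move=> p Dp; exact: is_derive1_ln (f0 p Dp).
by move=> n _; apply: smooth_inv => // p /f0; rewrite lt0r => /andP[].
Qed.

End Open.

Lemma smooth_affine (W : normedModType R) D D' (f : plane -> W) (M : 'M[R]_2) c :
  open D -> smooth D' f -> (forall p, D p -> D' (p *m M + c)) ->
  smooth D (fun p => f (p *m M + c)).
Proof.
move=> oD sf DD' n; move: (sf n); elim: n f {sf} => // n IH f [df tf]; split.
  by move=> p /DD'/df d; exact: (derive_affine 0 d).1.
move=> h; apply: (times_differentiable_on oD) (IH _ (tf (h *m M))) => p /DD'/df d.
exact/esym/(derive_affine _ d).2.
Qed.

Lemma smooth_mx m n D (f : plane -> 'M[R]_(m, n)) : open D ->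
  (forall i j, smooth D (fun p => f p i j)) -> smooth D f.
Proof.
move=> oD sf k; have {}sf i j : times_differentiable k D (fun p => f p i j) by exact: sf.
elim: k f sf => // k IH f sf.
have df p : D p -> differentiable f p.
  by move=> Dp; apply: differentiable_mx => i j; have [df _] := sf i j; exact: df.
split=> // h; apply: IH => i j; have [_ tf] := sf i j.
apply: (times_differentiable_on oD) (tf h) => p Dp; by rewrite derive_entry //; exact: df.
Qed.

Lemma smooth_entry m n D (f : plane -> 'M[R]_(m, n)) i j : open D ->
  smooth D f -> smooth D (fun p => f p i j).
Proof.
move=> oD sf k; move: (sf k); elim: k f {sf} => // k IH f [df tf]; split.
  by move=> p Dp; apply: differentiable_entry; exact: df.
move=> h; apply: (times_differentiable_on oD) (IH _ (tf h)) => p Dp; by rewrite derive_entry //; exact: df.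
Qed.

End Calculus.

(** * Symmetry of second derivatives *)

Section Schwarz.
Variable R : realType.
Local Notation plane := 'rV[R]_2.
Implicit Types (p h k : plane) (D : set plane).

Lemma derive_shiftc (f : plane -> R) p h c : differentiable f (p + c) ->
  differentiable (fun q => f (q + c)) p /\ 'D_h (fun q => f (q + c)) p = 'D_h f (p + c).
Proof.
move=> df; have := @derive_affine R R f 1%:M c p h; rewrite !mulmx1 => /(_ df) [].
by under eq_fun do rewrite mulmx1.
Qed.

(** The mean value theorem along [h], then along [k]. *)
Lemma second_difference D (f : plane -> R) p h k (s : R) : smooth D f -> 0 < s ->
  (forall a b, 0 <= a <= s -> 0 <= b <= s -> D (p + a *: h + b *: k)) ->
  exists c d, [/\ 0 <= c <= s, 0 <= d <= s &
    f (p + s *: h + s *: k) - f (p + s *: h) - (f (p + s *: k) - f p) =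
    'D_k (fun q => 'D_h f q) (p + c *: h + d *: k) * s * s].
Proof.
move=> sf s0 Ds.
have ss : 0 <= s <= s by rewrite (ltW s0) /=.
have s00 : 0 <= (0:R) <= s by apply/andP; split; [exact: lexx|exact: ltW].
pose g q := f (q + s *: k) - f q.
have dg a : 0 <= a <= s -> differentiable g (p + a *: h) /\
    'D_h g (p + a *: h) = 'D_h f (p + a *: h + s *: k) - 'D_h f (p + a *: h).
  move=> a0.
  have d1 : differentiable f (p + a *: h + s *: k) by apply: (smooth_diff sf); exact: Ds.
  have d2 : differentiable f (p + a *: h).
    by apply: (smooth_diff sf); have := Ds _ _ a0 s00; rewrite scale0r addr0.
  have [d3 e3] := derive_shiftc h d1.
  split; first exact: differentiableB.
  by rewrite deriveB ?e3 //; exact: diff_derivable.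
have [|c /andP[c0 cs]] := @line_mvt R _ g p h 0 s s0; first by move=> a /dg[].
have {c0 cs}c01 : 0 <= c <= s by rewrite !ltW.
rewrite (dg _ c01).2 scale0r addr0 subr0 /g => ->.
have [|d /andP[d0 ds]] := @line_mvt R _ (fun q => 'D_h f q) (p + c *: h) k 0 s s0.
  by move=> b b0; apply: (smooth_diff (smooth_derive h sf)); exact: Ds.
rewrite scale0r addr0 subr0 => ->.
by exists c, d; split=> //; rewrite !ltW.
Qed.

Lemma eq_at_limit (F G : plane -> R) p : {for p, continuous F} ->
  {for p, continuous G} ->
  (forall r, 0 < r -> exists x y, [/\ ball p r x, ball p r y & F x = G y]) ->
  F p = G p.
Proof.
move=> cF cG FG.
apply/eqP; rewrite -subr_eq0 -normr_le0; apply/ler_addgt0Pl => e e0; rewrite addr0.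
have e20 : 0 < e / 2 by rewrite divr_gt0.
have /cvgrPdist_lt/(_ _ e20) nF := cF; have /cvgrPdist_lt/(_ _ e20) nG := cG.
have /nbhs_ballP[r /= r0 rP] :
    nbhs p [set q | `|F p - F q| < e / 2 /\ `|G p - G q| < e / 2].
  exact: filterI nF nG.
have [x [y [/rP[Fx _] /rP[_ Gy] E]]] := FG r r0.
rewrite -(subrK (F x) (F p)) -addrA (le_trans (ler_normD _ _)) //.
by rewrite [e]splitr lerD //; [exact: ltW|rewrite E distrC; exact: ltW].
Qed.

(** Both mixed derivatives agree with the same second difference quotient at
points arbitrarily close to [p]. *)
Lemma derive_swap D (f : plane -> R) p h k : open D -> smooth D f -> D p ->
  'D_h (fun q => 'D_k f q) p = 'D_k (fun q => 'D_h f q) p.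
Proof.
move=> oD sf Dp.
apply: (@eq_at_limit (fun p => 'D_h (fun q => 'D_k f q) p)
  (fun p => 'D_k (fun q => 'D_h f q) p)).
- by apply: differentiable_continuous; apply: (smooth_diff _ Dp); do 2!apply: smooth_derive.
- by apply: differentiable_continuous; apply: (smooth_diff _ Dp); do 2!apply: smooth_derive.
move=> r' r'0; have /nbhs_ballP[r0 /= r00 r0D] : nbhs p D by exact: open_nbhs_nbhs.
pose r := Num.min r' r0; have r_gt0 : 0 < r by rewrite lt_min r'0.
have rP q : ball p r q -> D q /\ ball p r' q.
  by move=> Bq; split; [apply: r0D|]; apply: le_ball Bq; rewrite ge_min lexx ?orbT.
pose s := r / (`|h| + `|k| + 1).
have N0 : 0 < `|h| + `|k| + 1 by rewrite ltr_wpDl // addr_ge0.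
have s0 : 0 < s by rewrite divr_gt0.
have B a b : 0 <= a <= s -> 0 <= b <= s -> ball p r (p + a *: h + b *: k).
  move=> /andP[a0 as_] /andP[b0 bs]; rewrite -ball_normE /ball_ /=.
  rewrite -addrA opprD addrA subrr sub0r normrN (le_lt_trans (ler_normD _ _))//.
  rewrite !normrZ !ger0_norm //.
  apply: (@le_lt_trans _ _ (s * (`|h| + `|k|))).
    by rewrite mulrDr lerD // ler_wpM2r.
  by rewrite /s mulrAC ltr_pdivrMr // ltr_pM2l // ltrDl.
have [|c [d [c0 d0 E1]]] := @second_difference D f p h k s sf s0.
  by move=> a b a0 b0; case: (rP _ (B _ _ a0 b0)).
have [|c' [d' [c0' d0' E2]]] := @second_difference D f p k h s sf s0.
  by move=> a b a0 b0; rewrite addrAC; case: (rP _ (B _ _ b0 a0)).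
exists (p + d' *: h + c' *: k), (p + c *: h + d *: k).
split; [exact: (rP _ (B _ _ d0' c0')).2|exact: (rP _ (B _ _ c0 d0)).2|].
have ss : s != 0 by rewrite gt_eqF.
apply: (mulIf ss); apply: (mulIf ss).
have aux (x y z w a b : R) : x - y - (z - w) = a -> x - z - (y - w) = b -> a = b.
  by move=> <- <-; ring.
move: E2; rewrite (addrAC p (s *: k)) (addrAC p (c' *: k)) => E2.
exact/esym/(aux _ _ _ _ _ _ E1).
Qed.

End Schwarz.

(** * The scalar product of signature (2, 2) *)

Notation i0 := (@Ordinal 4 0 isT).
Notation i1 := (@Ordinal 4 1 isT).
Notation i2 := (@Ordinal 4 2 isT).
Notation i3 := (@Ordinal 4 3 isT).

Lemma ord4P (P : 'I_4 -> Prop) : P i0 -> P i1 -> P i2 -> P i3 -> forall i, P i.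
Proof.
move=> P0 P1 P2 P3 [[|[|[|[|n]]]] lt] //.
- by rewrite (_ : Ordinal lt = i0) //; exact: val_inj.
- by rewrite (_ : Ordinal lt = i1) //; exact: val_inj.
- by rewrite (_ : Ordinal lt = i2) //; exact: val_inj.
- by rewrite (_ : Ordinal lt = i3) //; exact: val_inj.
Qed.

Lemma sum4 (V : nmodType) (F : 'I_4 -> V) : \sum_i F i = F i0 + F i1 + F i2 + F i3.
Proof.
rewrite !big_ord_recl big_ord0 addr0 !addrA.
by congr (_ + _ + _ + _); congr (F _); exact: val_inj.
Qed.

Lemma ord2P (P : 'I_2 -> Prop) : P 0 -> P 1 -> forall i, P i.
Proof.
move=> P0 P1 [[|[|n]] lt] //.
- by rewrite (_ : Ordinal lt = 0) //; exact: val_inj.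
- by rewrite (_ : Ordinal lt = 1) //; exact: val_inj.
Qed.

Lemma sum2 (V : nmodType) (F : 'I_2 -> V) : \sum_i F i = F 0 + F 1.
Proof.
rewrite !big_ord_recl big_ord0 addr0.
by congr (_ + _); congr (F _); exact: val_inj.
Qed.

Section ScalarProduct.
Variable R : comPzRingType.
Implicit Types a b c : 'rV[R]_4.

Lemma sdotE a b : sdot a b =
  - (a 0 i0 * b 0 i0) + a 0 i1 * b 0 i1 - a 0 i2 * b 0 i2 + a 0 i3 * b 0 i3.
Proof.
rewrite /sdot /Defs.eta mul_mx_diag mxE sum4 !mxE /=.
by rewrite !exprS !expr0 !mulr1 !mulN1r !opprK !mulrN !mulNr !mulr1.
Qed.

Lemma sdotC a b : sdot a b = sdot b a.
Proof. by rewrite !sdotE; ring. Qed.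

Lemma sdotDl a b c : sdot (a + b) c = sdot a c + sdot b c.
Proof. by rewrite !sdotE !mxE; ring. Qed.

Lemma sdotZl k a b : sdot (k *: a) b = k * sdot a b.
Proof. by rewrite !sdotE !mxE; ring. Qed.

Lemma sdotDr a b c : sdot a (b + c) = sdot a b + sdot a c.
Proof. by rewrite !(sdotC a) sdotDl. Qed.

Lemma sdotZr k a b : sdot a (k *: b) = k * sdot a b.
Proof. by rewrite !(sdotC a) sdotZl. Qed.

Lemma sdotNl a b : sdot (- a) b = - sdot a b.
Proof. by rewrite -scaleN1r sdotZl mulN1r. Qed.

Lemma sdotNr a b : sdot a (- b) = - sdot a b.
Proof. by rewrite sdotC sdotNl sdotC. Qed.

Lemma sdot0l a : sdot 0 a = 0.
Proof. by rewrite -(scale0r (0 : 'rV[R]_4)) sdotZl mul0r. Qed.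

Lemma sdot0r a : sdot a 0 = 0.
Proof. by rewrite sdotC sdot0l. Qed.

Definition sdotL := (sdotDl, sdotDr, sdotNl, sdotNr, sdotZl, sdotZr, sdot0l, sdot0r).

Definition frame a b c (d : 'rV[R]_4) : 'M[R]_4 := \matrix_(i < 4) nth 0 [:: a; b; c; d] i.

Lemma det_eta : \det (Defs.eta R) = 1.
Proof.
rewrite /Defs.eta det_diag !big_ord_recl big_ord0 !mxE /=.
by rewrite !exprS !expr0; ring.
Qed.

Lemma frame_gram a b c d a' b' c' d' (i j : 'I_4) :
  (frame a b c d *m Defs.eta R *m (frame a' b' c' d')^T) i j =
  sdot (nth 0 [:: a; b; c; d] i) (nth 0 [:: a'; b'; c'; d'] j).
Proof.
rewrite /sdot !mxE; apply: eq_bigr => k _; rewrite !mxE; congr (_ * _).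
by apply: eq_bigr => l _; rewrite !mxE.
Qed.

(** The polynomial in the entries, to which the identities between determinants
of frames below reduce. *)
Lemma det4 (M : 'M[R]_4) : \det M =
    M i0 i0 * (M i1 i1 * (M i2 i2 * M i3 i3 - M i2 i3 * M i3 i2)
             - M i1 i2 * (M i2 i1 * M i3 i3 - M i2 i3 * M i3 i1)
             + M i1 i3 * (M i2 i1 * M i3 i2 - M i2 i2 * M i3 i1))
  - M i0 i1 * (M i1 i0 * (M i2 i2 * M i3 i3 - M i2 i3 * M i3 i2)
             - M i1 i2 * (M i2 i0 * M i3 i3 - M i2 i3 * M i3 i0)
             + M i1 i3 * (M i2 i0 * M i3 i2 - M i2 i2 * M i3 i0))
  + M i0 i2 * (M i1 i0 * (M i2 i1 * M i3 i3 - M i2 i3 * M i3 i1)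
             - M i1 i1 * (M i2 i0 * M i3 i3 - M i2 i3 * M i3 i0)
             + M i1 i3 * (M i2 i0 * M i3 i1 - M i2 i1 * M i3 i0))
  - M i0 i3 * (M i1 i0 * (M i2 i1 * M i3 i2 - M i2 i2 * M i3 i1)
             - M i1 i1 * (M i2 i0 * M i3 i2 - M i2 i2 * M i3 i0)
             + M i1 i2 * (M i2 i0 * M i3 i1 - M i2 i1 * M i3 i0)).
Proof.
pose m (i j : nat) := nth 0 (nth [::] [:: [:: M i0 i0; M i0 i1; M i0 i2; M i0 i3];
 [:: M i1 i0; M i1 i1; M i1 i2; M i1 i3]; [:: M i2 i0; M i2 i1; M i2 i2; M i2 i3];
 [:: M i3 i0; M i3 i1; M i3 i2; M i3 i3]] i) j.
have -> : M = \matrix_(i, j) m i j.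
  by apply/matrixP => i j; rewrite mxE; elim/ord4P: i; elim/ord4P: j.
do 3!rewrite ?(expand_det_row _ ord0) ?big_ord_recl ?big_ord0 /cofactor.
rewrite !det_mx11 !mxE /=.
rewrite /bump /= !exprS !expr0 /m /=; ring.
Qed.

End ScalarProduct.

(** * Differentiation rules and null coordinates *)

Section VectorCalculus.
Variable R : realType.
Local Notation plane := 'rV[R]_2.
Local Notation space := 'rV[R]_4.
Implicit Types (p h k : plane) (D : set plane).

Section Rules.
Variables (p h : plane).

Lemma derive_add (W : normedModType R) (f g : plane -> W) :
  differentiable f p -> differentiable g p ->
  'D_h (fun q => f q + g q) p = 'D_h f p + 'D_h g p.
Proof. by move=> df dg; rewrite -deriveD //; exact: diff_derivable. Qed.

Lemma derive_opp (W : normedModType R) (f : plane -> W) :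
  differentiable f p -> 'D_h (fun q => - f q) p = - 'D_h f p.
Proof. by move=> df; rewrite -deriveN //; exact: diff_derivable. Qed.

Lemma derive_mul (f g : plane -> R) :
  differentiable f p -> differentiable g p ->
  'D_h (fun q => f q * g q) p = 'D_h f p * g p + f p * 'D_h g p.
Proof.
move=> df dg; have := @deriveM _ _ f g p h (diff_derivable (v := h) df) (diff_derivable (v := h) dg).
by move=> ->; rewrite addrC; congr (_ + _); exact: mulrC.
Qed.

Lemma derive_inv (f : plane -> R) :
  differentiable f p -> f p != 0 ->
  'D_h (fun q => (f q)^-1) p = - ('D_h f p / f p ^+ 2).
Proof.
move=> df f0; have := @deriveV _ _ f p h f0 (diff_derivable (v := h) df).
by move=> ->; rewrite scaleNr mulrC.
Qed.

Lemma differentiable_scale (c : plane -> R) (f : plane -> space) :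
  differentiable c p -> differentiable f p -> differentiable (fun q => c q *: f q) p.
Proof.
move=> dc df; apply: differentiable_mx => i j; under eq_fun do rewrite mxE.
exact: differentiableM dc (differentiable_entry i j df).
Qed.

Lemma derive_scale (c : plane -> R) (f : plane -> space) :
  differentiable c p -> differentiable f p ->
  'D_h (fun q => c q *: f q) p = 'D_h c p *: f p + c p *: 'D_h f p.
Proof.
move=> dc df; apply/rowP => j; rewrite derive_entry; last exact: differentiable_scale.
rewrite !mxE; under eq_fun do rewrite mxE.
by rewrite (derive_mul dc (differentiable_entry 0 j df)) !derive_entry.
Qed.

Lemma differentiable_sdot (f g : plane -> space) :
  differentiable f p -> differentiable g p -> differentiable (fun q => sdot (f q) (g q)) p.
Proof.
move=> df dg; under eq_fun do rewrite sdotE.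
have E i : differentiable (fun q => f q 0 i * g q 0 i) p.
  exact: differentiableM (differentiable_entry 0 i df) (differentiable_entry 0 i dg).
exact: (differentiableD (differentiableB (differentiableD (differentiableN (E i0)) (E i1))
  (E i2)) (E i3)).
Qed.

Lemma derive_sdot (f g : plane -> space) :
  differentiable f p -> differentiable g p ->
  'D_h (fun q => sdot (f q) (g q)) p = sdot ('D_h f p) (g p) + sdot (f p) ('D_h g p).
Proof.
move=> df dg.
have df' i : differentiable (fun q => f q 0 i) p by exact: differentiable_entry.
have dg' i : differentiable (fun q => g q 0 i) p by exact: differentiable_entry.
have E i : differentiable (fun q => f q 0 i * g q 0 i) p by exact: differentiableM.
have M i : 'D_h (fun q => f q 0 i * g q 0 i) p =
    'D_h f p 0 i * g p 0 i + f p 0 i * 'D_h g p 0 i.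
  by rewrite (derive_mul (df' i) (dg' i)) !derive_entry.
have N0 := differentiableN (E i0); have N2 := differentiableN (E i2).
have S1 := differentiableD N0 (E i1); have S2 := differentiableD S1 N2.
under eq_fun do rewrite sdotE.
rewrite (derive_add S2 (E i3)) (derive_add S1 N2) (derive_add N0 (E i1)).
rewrite (derive_opp (E i0)) (derive_opp (E i2)) !M.
move: ('D_h f p) ('D_h g p) (f p) (g p) => F' G' F G; rewrite !sdotE; ring.
Qed.

End Rules.

Section Smooth.
Variables (D : set plane) (oD : open D).

Lemma smooth_scale (c : plane -> R) (f : plane -> space) :
  smooth D c -> smooth D f -> smooth D (fun q => c q *: f q).
Proof.
move=> sc sf; apply: smooth_mx => // i j; under eq_fun do rewrite mxE.
by apply: smooth_mul => //; exact: smooth_entry.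
Qed.

Lemma smooth_sdot (f g : plane -> space) :
  smooth D f -> smooth D g -> smooth D (fun q => sdot (f q) (g q)).
Proof.
move=> sf sg; under eq_fun do rewrite sdotE.
have E i : smooth D (fun q => f q 0 i * g q 0 i) by apply: smooth_mul => //; exact: smooth_entry.
exact: (smooth_add oD (smooth_add oD (smooth_add oD (smooth_opp oD (E i0)) (E i1))
  (smooth_opp oD (E i2))) (E i3)).
Qed.

Lemma derive2_entry (f : plane -> space) p h k j : smooth D f -> D p ->
  'D_h (fun q => 'D_k f q) p 0 j = 'D_h (fun q => 'D_k (fun q => f q 0 j) q) p.
Proof.
move=> sf Dp; have sD := smooth_diff (smooth_derive k sf) Dp.
transitivity ('D_h (fun q => 'D_k f q 0 j) p); first exact: derive_entry.
apply: (derive_on h oD _ Dp) => q Dq; apply: derive_entry; exact: smooth_diff sf Dq.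
Qed.

Lemma derive_swapV (f : plane -> space) p h k : smooth D f -> D p ->
  'D_h (fun q => 'D_k f q) p = 'D_k (fun q => 'D_h f q) p.
Proof.
move=> sf Dp; apply/rowP => j.
transitivity ('D_h (fun q => 'D_k (fun q => f q 0 j) q) p); first exact: derive2_entry.
transitivity ('D_k (fun q => 'D_h (fun q => f q 0 j) q) p).
  exact: (derive_swap h k oD (smooth_entry 0 j oD sf) Dp).
exact/esym/derive2_entry.
Qed.

End Smooth.

End VectorCalculus.

(** The derivatives along [wxi] and [weta] are the partial derivatives in the
null coordinates [xi = u + v] and [eta = u - v]. *)
Definition wxi (R : realType) : 'rV[R]_2 := 2^-1 *: (unitv R 0 + unitv R 1).
Definition weta (R : realType) : 'rV[R]_2 := 2^-1 *: (unitv R 0 - unitv R 1).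

HB.lock Definition dxi (R : realType) (W : normedModType R) (f : 'rV[R]_2 -> W) p :=
  'D_(wxi R) f p.
HB.lock Definition deta (R : realType) (W : normedModType R) (f : 'rV[R]_2 -> W) p :=
  'D_(weta R) f p.

Section NullCoordinates.
Variable R : realType.
Local Notation plane := 'rV[R]_2.
Local Notation space := 'rV[R]_4.
Local Notation wxi := (wxi R).
Local Notation weta := (weta R).
Implicit Types (p h k : plane) (D : set plane).

Lemma dxiE (W : normedModType R) (f : plane -> W) : dxi f = fun p => 'D_wxi f p.
Proof. by apply/funext => p; rewrite dxi.unlock. Qed.

Lemma detaE (W : normedModType R) (f : plane -> W) : deta f = fun p => 'D_weta f p.
Proof. by apply/funext => p; rewrite deta.unlock. Qed.

Lemma dxi_app (W : normedModType R) (f : plane -> W) p : dxi f p = 'D_wxi f p.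
Proof. by rewrite dxiE. Qed.

Lemma deta_app (W : normedModType R) (f : plane -> W) p : deta f p = 'D_weta f p.
Proof. by rewrite detaE. Qed.

Lemma smooth_dxi (W : normedModType R) D (f : plane -> W) : smooth D f -> smooth D (dxi f).
Proof. by rewrite dxiE; exact: smooth_derive. Qed.

Lemma smooth_deta (W : normedModType R) D (f : plane -> W) : smooth D f -> smooth D (deta f).
Proof. by rewrite detaE; exact: smooth_derive. Qed.

Lemma null_swap D (f : plane -> R) p : open D -> smooth D f -> D p ->
  deta (dxi f) p = dxi (deta f) p.
Proof. by move=> oD sf Dp; rewrite !dxiE !detaE; exact: (derive_swap _ _ oD sf Dp). Qed.

Lemma null_swapV D (f : plane -> space) p : open D -> smooth D f -> D p ->
  deta (dxi f) p = dxi (deta f) p.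
Proof. by move=> oD sf Dp; rewrite !dxiE !detaE; exact: (derive_swapV oD _ _ sf Dp). Qed.

Definition xi h : R := h 0 0 + h 0 1.
Definition et h : R := h 0 0 - h 0 1.
Lemma null_basis h : h = xi h *: wxi + et h *: weta.
Proof.
by apply/rowP => i; elim/ord2P: i; rewrite !mxE /= /xi /et; field.
Qed.

Lemma xi_wxi : xi wxi = 1. Proof. by rewrite /xi !mxE /=; field. Qed.
Lemma et_wxi : et wxi = 0. Proof. by rewrite /et !mxE /=; field. Qed.
Lemma xi_weta : xi weta = 0. Proof. by rewrite /xi !mxE /=; field. Qed.
Lemma et_weta : et weta = 1. Proof. by rewrite /et !mxE /=; field. Qed.

Lemma derive_null (W : normedModType R) (f : plane -> W) p h : differentiable f p ->
  'D_h f p = xi h *: dxi f p + et h *: deta f p.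
Proof. by move=> df; rewrite {1}(null_basis h) derive_dir_linear // dxiE detaE. Qed.

Lemma du_null (W : normedModType R) (f : plane -> W) p : differentiable f p ->
  du f p = dxi f p + deta f p.
Proof.
move=> df; rewrite /du derive_null // /xi /et !mxE /= .
by rewrite addr0 subr0 !scale1r.
Qed.

Lemma dv_null (W : normedModType R) (f : plane -> W) p : differentiable f p ->
  dv f p = dxi f p - deta f p.
Proof.
move=> df; rewrite /dv derive_null // /xi /et !mxE /= .
by rewrite add0r sub0r scaleN1r scale1r.
Qed.

Section SecondDerivatives.
Variables (W : normedModType R) (D : set plane) (oD : open D) (f : plane -> W).
Hypothesis sf : smooth D f.
Variables (p : plane) (Dp : D p).

Let dx := smooth_diff (smooth_dxi sf) Dp.
Let de := smooth_diff (smooth_deta sf) Dp.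
Let Eu q : D q -> du f q = dxi f q + deta f q.
Proof. by move=> Dq; apply: du_null; exact: smooth_diff sf Dq. Qed.
Let Ev q : D q -> dv f q = dxi f q - deta f q.
Proof. by move=> Dq; apply: dv_null; exact: smooth_diff sf Dq. Qed.

Lemma du_du : du (du f) p = dxi (dxi f) p + deta (dxi f) p + (dxi (deta f) p + deta (deta f) p).
Proof.
transitivity (du (fun q => dxi f q + deta f q) p); first exact: derive_on oD Eu Dp.
transitivity (du (dxi f) p + du (deta f) p); first exact: derive_add.
by congr (_ + _); exact: du_null.
Qed.

Lemma dv_du : dv (du f) p = dxi (dxi f) p - deta (dxi f) p + (dxi (deta f) p - deta (deta f) p).
Proof.
transitivity (dv (fun q => dxi f q + deta f q) p); first exact: derive_on oD Eu Dp.
transitivity (dv (dxi f) p + dv (deta f) p); first exact: derive_add.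
by congr (_ + _); exact: dv_null.
Qed.

Lemma dv_dv : dv (dv f) p = dxi (dxi f) p - deta (dxi f) p - (dxi (deta f) p - deta (deta f) p).
Proof.
transitivity (dv (fun q => dxi f q - deta f q) p); first exact: derive_on oD Ev Dp.
transitivity (dv (dxi f) p + dv (fun q => - deta f q) p).
  exact: (derive_add _ dx (differentiableN de)).
congr (_ + _); first exact: dv_null.
transitivity (- dv (deta f) p); first exact: derive_opp.
by congr (- _); exact: dv_null.
Qed.

Lemma du_dv : du (dv f) p = dxi (dxi f) p + deta (dxi f) p - (dxi (deta f) p + deta (deta f) p).
Proof.
transitivity (du (fun q => dxi f q - deta f q) p); first exact: derive_on oD Ev Dp.
transitivity (du (dxi f) p + du (fun q => - deta f q) p).
  exact: (derive_add _ dx (differentiableN de)).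
congr (_ + _); first exact: du_null.
transitivity (- du (deta f) p); first exact: derive_opp.
by congr (- _); exact: du_null.
Qed.

End SecondDerivatives.

Lemma hlaplacian_null D (f : plane -> R) p : open D -> smooth D f -> D p ->
  hlaplacian f p = 4 * dxi (deta f) p.
Proof.
move=> oD sf Dp; rewrite /hlaplacian.
have aux (a b b' c : R) : b' = b -> a + b' + (b + c) - (a - b' - (b - c)) = 4 * b.
  by move=> ->; ring.
exact: etrans (congr2 (fun a b => a - b) (du_du oD sf Dp) (dv_dv oD sf Dp))
  (aux _ _ _ _ (null_swap oD sf Dp)).
Qed.

End NullCoordinates.

(** * Projection onto the normal space *)

Section NormalProjection.
Variable R : realType.
Local Notation space := 'rV[R]_4.
Implicit Types a b v w : space.

(** Orthogonal projection onto the complement of the plane spanned by the null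
vectors [a] and [b]. *)
Definition nproj a b v : space := v - (sdot v b / sdot a b) *: a - (sdot v a / sdot a b) *: b.

Lemma nprojD a b v w : nproj a b (v + w) = nproj a b v + nproj a b w.
Proof.
rewrite /nproj !sdotDl !mulrDl !scalerDl !opprD.
apply/rowP => i; rewrite !mxE; ring.
Qed.

Lemma nprojZ a b k v : nproj a b (k *: v) = k *: nproj a b v.
Proof.
rewrite /nproj !sdotZl; apply/rowP => i; rewrite !mxE; ring.
Qed.

Section Null.
Variables (a b : space).
Hypotheses (a0 : sdot a a = 0) (b0 : sdot b b = 0) (e0 : sdot a b != 0).

Lemma nproj_l : nproj a b a = 0.
Proof. by rewrite /nproj a0 mul0r scale0r subr0 divff // scale1r subrr. Qed.

Lemma nproj_r : nproj a b b = 0.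
Proof. by rewrite /nproj b0 mul0r scale0r subr0 (sdotC b) divff // scale1r subrr. Qed.

Lemma nproj_orthl v : sdot (nproj a b v) a = 0.
Proof. by rewrite /nproj !sdotL a0 (sdotC b); field. Qed.

Lemma nproj_orthr v : sdot (nproj a b v) b = 0.
Proof. by rewrite /nproj !sdotL b0; field. Qed.

Lemma nproj_sdot v w : sdot (nproj a b v) (nproj a b w) =
  sdot v w - (sdot v b * sdot w a + sdot v a * sdot w b) / sdot a b.
Proof.
rewrite {2}/nproj !(sdotDr, sdotNr, sdotZr) nproj_orthl nproj_orthr.
rewrite /nproj !sdotL (sdotC a) (sdotC b w); field; exact: e0.
Qed.

(** The kernel of [eta T^T] consists of the vectors orthogonal to [a] and [b]; as
[a.b] does not vanish, it is complementary to their span. *)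
Lemma normal_proj_null (T : 'M[R]_(2, 4)) v : row 0 T = a + b -> row 1 T = a - b ->
  v *m proj_mx (kermx (Defs.eta R *m T^T)) <<T>>%MS = nproj a b v.
Proof.
move=> T0 T1.
have dotT w i : (w *m (Defs.eta R *m T^T)) 0 i = sdot w (row i T).
  by rewrite mulmxA /sdot !mxE; apply: eq_bigr => k _; rewrite !mxE.
have span w : (w <= T)%MS -> exists s t, w = s *: a + t *: b.
  move=> /submxP[c ->]; exists (c 0 0 + c 0 1), (c 0 0 - c 0 1).
  rewrite mulmx_sum_row sum2 T0 T1; apply/rowP => i; rewrite !mxE; ring.
have inT w s t : w = s *: a + t *: b -> (w <= T)%MS.
  move=> ->; have -> : s *: a + t *: b =
      ((s + t) / 2) *: row 0 T + ((s - t) / 2) *: row 1 T.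
    by rewrite T0 T1; apply/rowP => i; rewrite !mxE; field.
  by apply: addmx_sub; apply: scalemx_sub; exact: row_sub.
have inK w : sdot w a = 0 -> sdot w b = 0 -> (w <= kermx (Defs.eta R *m T^T))%MS.
  move=> wa wb; apply/sub_kermxP/rowP => i; rewrite dotT mxE.
  by elim/ord2P: i; rewrite ?T0 ?T1 sdotDr ?sdotNr wa wb ?oppr0 addr0.
have outK w : (w <= kermx (Defs.eta R *m T^T))%MS -> sdot w a = 0 /\ sdot w b = 0.
  move=> /sub_kermxP kw.
  have k0 : sdot w a + sdot w b = 0 by rewrite -sdotDr -T0 -dotT kw mxE.
  have k1 : sdot w a - sdot w b = 0 by rewrite -sdotNr -sdotDr -T1 -dotT kw mxE.
  by split; lra.
have cap0 : (kermx (Defs.eta R *m T^T) :&: <<T>>)%MS = 0.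
  apply/eqP/rowV0P => w; rewrite sub_capmx genmxE => /andP[/outK[wa wb] /span[s [t ew]]].
  move: wa wb; rewrite ew !sdotL a0 b0 (sdotC b) !mulr0 add0r addr0 => /eqP.
  rewrite mulf_eq0 (negPf e0) orbF => /eqP -> /eqP.
  by rewrite mulf_eq0 (negPf e0) orbF => /eqP ->; rewrite !scale0r addr0.
have {1}-> : v = nproj a b v + ((sdot v b / sdot a b) *: a + (sdot v a / sdot a b) *: b).
  by apply/rowP => i; rewrite !mxE; ring.
rewrite mulmxDl proj_mx_id // ?proj_mx_0 ?addr0 //.
  by rewrite genmxE; exact: inT.
by apply: inK; [exact: nproj_orthl|exact: nproj_orthr].
Qed.

End Null.
End NormalProjection.

(** * Minimal surfaces as sums of null curves *)

Section Isothermal.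
Variable R : realType.
Local Notation plane := 'rV[R]_2.
Local Notation space := 'rV[R]_4.
Local Notation vfield := (plane -> plane).
Variables (x : plane -> space) (U : set plane).
Hypotheses (oU : open U) (sx : smooth U x).

Definition null_tangents := forall p, U p ->
  [/\ sdot (dxi x p) (dxi x p) = 0, sdot (deta x p) (deta x p) = 0 &
      sdot (dxi x p) (deta x p) < 0].

Let dx p : U p -> differentiable x p := fun Up => smooth_diff sx Up.

(** As [x_u = a + b] and [x_v = a - b] for [a = x_xi] and [b = x_eta], the
isothermal conditions say that [a] and [b] are null. *)
Lemma isothermal_null : isothermal x U <-> null_tangents.
Proof.
have aux (a b : space) :
   [/\ sdot (a + b) (a + b) = - sdot (a - b) (a - b), sdot (a + b) (a - b) = 0 &
     sdot (a + b) (a + b) < 0] <-> [/\ sdot a a = 0, sdot b b = 0 & sdot a b < 0].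
  rewrite !sdotL (sdotC b a); split=> -[h1 h2 h3]; split; lra.
have E p : U p -> du x p = dxi x p + deta x p /\ dv x p = dxi x p - deta x p.
  by move=> Up; split; [exact: du_null (dx Up)|exact: dv_null (dx Up)].
by split=> H p Up; have [e1 e2] := E p Up; have := H p Up; rewrite e1 e2; apply aux.
Qed.

Hypothesis nx : null_tangents.

Let e0 p : U p -> sdot (dxi x p) (deta x p) != 0.
Proof. by move=> /nx[_ _ e]; rewrite lt_eqF. Qed.
Let a0 p : U p -> sdot (dxi x p) (dxi x p) = 0. Proof. by move=> /nx[]. Qed.
Let b0 p : U p -> sdot (deta x p) (deta x p) = 0. Proof. by move=> /nx[]. Qed.

Lemma normal_projE p v : U p -> v *m normal_proj x p = nproj (dxi x p) (deta x p) v.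
Proof.
move=> Up; apply: (normal_proj_null (a0 Up) (b0 Up) (e0 Up)).
  exact: etrans (rowK _ _) (du_null (dx Up)).
exact: etrans (rowK _ _) (dv_null (dx Up)).
Qed.

Lemma pushE (X : vfield) p : U p -> push x X p = xi (X p) *: dxi x p + et (X p) *: deta x p.
Proof. by move=> Up; exact: derive_null (dx Up). Qed.

Lemma smooth_xi V (X : vfield) : open V -> smooth V X -> smooth V (fun q => xi (X q)).
Proof. by move=> oV sX; apply: smooth_add => //; exact: smooth_entry. Qed.

Lemma smooth_et V (X : vfield) : open V -> smooth V X -> smooth V (fun q => et (X q)).
Proof.
move=> oV sX; apply: smooth_add => //; first exact: smooth_entry.
by apply: smooth_opp => //; exact: smooth_entry.
Qed.

Lemma derive_push V (Y : vfield) p h : open V -> V `<=` U -> smooth V Y -> V p ->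
  'D_h (push x Y) p =
    'D_h (fun q => xi (Y q)) p *: dxi x p + xi (Y p) *: 'D_h (dxi x) p +
    ('D_h (fun q => et (Y q)) p *: deta x p + et (Y p) *: 'D_h (deta x) p).
Proof.
move=> oV VU sY Vp; have Up := VU _ Vp.
have d1 := smooth_diff (smooth_xi oV sY) Vp; have d2 := smooth_diff (smooth_et oV sY) Vp.
have d3 := smooth_diff (smooth_dxi sx) Up; have d4 := smooth_diff (smooth_deta sx) Up.
transitivity ('D_h (fun q => xi (Y q) *: dxi x q + et (Y q) *: deta x q) p).
  by apply: (derive_on _ oV _ Vp) => q Vq; exact: pushE (VU _ Vq).
transitivity ('D_h (fun q => xi (Y q) *: dxi x q) p + 'D_h (fun q => et (Y q) *: deta x q) p).
  exact: derive_add (differentiable_scale d1 d3) (differentiable_scale d2 d4).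
by congr (_ + _); exact: derive_scale.
Qed.

Let swapx p : U p -> deta (dxi x) p = dxi (deta x) p.
Proof. by move=> Up; exact: (null_swapV oU sx Up). Qed.

Lemma sigmaE V (X Y : vfield) p : open V -> V `<=` U -> smooth V Y -> V p ->
  sigma x X Y p = let P := nproj (dxi x p) (deta x p) in
    (xi (X p) * xi (Y p)) *: P (dxi (dxi x) p) +
    (xi (X p) * et (Y p) + et (X p) * xi (Y p)) *: P (dxi (deta x) p) +
    (et (X p) * et (Y p)) *: P (deta (deta x) p).
Proof.
move=> oV VU sY Vp; have Up := VU _ Vp.
have d3 := smooth_diff (smooth_dxi sx) Up; have d4 := smooth_diff (smooth_deta sx) Up.
have E3 : 'D_(X p) (dxi x) p = xi (X p) *: dxi (dxi x) p + et (X p) *: dxi (deta x) p.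
  exact: etrans (derive_null _ d3) (congr1 (fun z => _ + _ *: z) (swapx Up)).
have E4 : 'D_(X p) (deta x) p = xi (X p) *: dxi (deta x) p + et (X p) *: deta (deta x) p.
  exact: derive_null d4.
have aux k l a b A C B : sdot a a = 0 -> sdot b b = 0 -> sdot a b != 0 ->
   nproj a b (k *: a + xi (Y p) *: (xi (X p) *: A + et (X p) *: C) +
     (l *: b + et (Y p) *: (xi (X p) *: C + et (X p) *: B))) =
    (xi (X p) * xi (Y p)) *: nproj a b A +
    (xi (X p) * et (Y p) + et (X p) * xi (Y p)) *: nproj a b C +
    (et (X p) * et (Y p)) *: nproj a b B.
  move=> aa bb ab; rewrite !(nprojD, nprojZ) nproj_l // nproj_r //.
  move: (nproj _ _ _) (nproj _ _ _) (nproj _ _ _) => nA nC nB.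
  by rewrite !scaler0 !add0r; apply/rowP => i; rewrite !mxE; ring.
apply: etrans (normal_projE _ Up) _.
apply: etrans (aux _ _ _ _ _ _ _ (a0 Up) (b0 Up) (e0 Up)).
congr (nproj _ _ _); apply: etrans (derive_push _ oV VU sY Vp) _.
exact: (congr2 (fun u w : space => _ *: _ + _ *: u + (_ *: _ + _ *: w)) E3 E4).
Qed.

End Isothermal.

Section NullForm.
Variable R : realType.
Local Notation plane := 'rV[R]_2.
Local Notation space := 'rV[R]_4.
Local Notation vfield := (plane -> plane).
Implicit Types (x : plane -> space) (U V : set plane).

Lemma dnum_eq (s t : dnum R) : dRe s = dRe t -> dIm s = dIm t -> s = t.
Proof. by case: s => a b; case: t => c d /= -> ->. Qed.

Lemma sdot_dnum (r i : space) :
  sdot (map2_mx (@DNum R) r i) (map2_mx (@DNum R) r i) =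
  DNum (sdot r r + sdot i i) (2 * sdot r i).
Proof. by rewrite !sdotE !mxE; apply: dnum_eq; rewrite /=; ring. Qed.

Lemma mul_dnum (r i : space) (N : 'M[R]_4) :
  map2_mx (@DNum R) r i *m map_mx (@dreal R) N = map2_mx (@DNum R) (r *m N) (i *m N).
Proof.
apply/rowP => k; rewrite !mxE !sum4 !mxE; apply: dnum_eq; rewrite /=; ring.
Qed.

Lemma dt_Phi x p : dt (Phi x) p =
  map2_mx (@DNum R) (2^-1 *: (du (du x) p + dv (dv x) p))
                    (2^-1 *: (du (dv x) p + dv (du x) p)).
Proof.
have aux (a b c d : space) : dreal (2^-1) *:
   (map2_mx (@DNum R) a b + dj R *: map2_mx (@DNum R) c d) =
   map2_mx (@DNum R) (2^-1 *: (a + d)) (2^-1 *: (b + c)).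
  by apply/rowP => i; rewrite !mxE; apply: dnum_eq; rewrite /=; ring.
have re (a b : space) :
    map_mx (@dRe R) (map_mx (@dreal R) a + dj R *: map_mx (@dreal R) b) = a.
  by apply/rowP => i; rewrite !mxE /=; ring.
have im (a b : space) :
    map_mx (@dIm R) (map_mx (@dreal R) a + dj R *: map_mx (@dreal R) b) = b.
  by apply/rowP => i; rewrite !mxE /=; ring.
have E1 : (fun q => map_mx (@dRe R) (Phi x q)) = du x by apply/funext => q; exact: re.
have E2 : (fun q => map_mx (@dIm R) (Phi x q)) = dv x by apply/funext => q; exact: im.
by rewrite /dt /dderive E1 E2; exact: aux.
Qed.

(** By the third condition [x_xi] depends on [xi] alone and [x_eta] on [eta]
alone; the last one normalises the parameters of these two null curves. *)
Definition null_form x U := [/\ smooth U x, null_tangents x U,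
  (forall p, U p -> dxi (deta x) p = 0) &
  (forall p, U p -> sdot (dxi (dxi x) p) (dxi (dxi x) p) = 4^-1 /\
                    sdot (deta (deta x) p) (deta (deta x) p) = - 4^-1)].

Section Tangents.
Variables (x : plane -> space) (U : set plane).
Hypotheses (oU : open U) (sx : smooth U x) (nx : null_tangents x U).

Lemma null_sdot_derive (f : plane -> space) (c : R) p h : smooth U f -> U p ->
  (forall q, U q -> sdot (f q) (f q) = c) -> sdot ('D_h f p) (f p) = 0.
Proof.
move=> sf Up f0; have df := smooth_diff sf Up.
have : 'D_h (fun q => sdot (f q) (f q)) p = 0.
  by apply: etrans (derive_on h oU f0 Up) _; exact: derive_cst.
move=> /(etrans (esym (derive_sdot h df df))).
by rewrite (sdotC (f p)); move: (sdot _ _) => z zz; lra.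
Qed.

Lemma dot_Da p h : U p -> sdot ('D_h (dxi x) p) (dxi x p) = 0.
Proof.
move=> Up; apply: (@null_sdot_derive (dxi x) 0 p h (smooth_dxi sx) Up) => q Uq.
by case: (nx Uq).
Qed.

Lemma dot_Db p h : U p -> sdot ('D_h (deta x) p) (deta x p) = 0.
Proof.
move=> Up; apply: (@null_sdot_derive (deta x) 0 p h (smooth_deta sx) Up) => q Uq.
by case: (nx Uq).
Qed.

Lemma swap_x p : U p -> deta (dxi x) p = dxi (deta x) p.
Proof. by move=> Up; exact: (null_swapV oU sx Up). Qed.

Lemma push_sdot (X Y : vfield) p : U p -> sdot (push x X p) (push x Y p) =
  sdot (dxi x p) (deta x p) * (xi (X p) * et (Y p) + et (X p) * xi (Y p)).
Proof.
move=> Up; have [aa bb _] := nx Up.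
have aux (a b : space) s t s' t' : sdot a a = 0 -> sdot b b = 0 ->
  sdot (s *: a + t *: b) (s' *: a + t' *: b) = sdot a b * (s * t' + t * s').
  by move=> a0 b0; rewrite !sdotL a0 b0 (sdotC b); ring.
by apply: etrans (congr2 (@sdot R) (pushE sx _ Up) (pushE sx _ Up)) _; exact: aux.
Qed.

Definition null_field (s t : plane -> R) : vfield := fun p => s p *: wxi R + t p *: weta R.

Lemma xi_null_field s t p : xi (null_field s t p) = s p.
Proof. by rewrite /xi !mxE /=; field. Qed.

Lemma et_null_field s t p : et (null_field s t p) = t p.
Proof. by rewrite /et !mxE /=; field. Qed.

Lemma smooth_null_field V s t : open V -> smooth V s -> smooth V t ->
  smooth V (null_field s t).
Proof.
move=> oV ss st; apply: smooth_mx => // i j; under eq_fun do rewrite !mxE.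
by apply: smooth_add => //; apply: smooth_mul => //; exact: smooth_cst.
Qed.

Lemma smooth_e : smooth U (fun p => sdot (dxi x p) (deta x p)).
Proof. exact: (smooth_sdot oU (smooth_dxi sx) (smooth_deta sx)). Qed.

Let e p := sdot (dxi x p) (deta x p).

(** The orthonormal frame [a - b/(2e), a + b/(2e)]: null vectors spare the
square roots of the frame along the coordinate axes. *)
Definition null_tangent1 : vfield := null_field (fun=> 1) (fun p => - (2 * e p)^-1).
Definition null_tangent2 : vfield := null_field (fun=> 1) (fun p => (2 * e p)^-1).

Lemma null_tangent_frame : tangent_frame x U null_tangent1 null_tangent2.
Proof.
have st : smooth U (fun p => (2 * e p)^-1).
  apply: smooth_inv => //; first exact: (smooth_mul oU (smooth_cst _ (2 : R)) smooth_e).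
  by move=> p /nx[_ _ e0]; rewrite mulf_eq0 negb_or pnatr_eq0 /= lt_eqF.
split; [| |move=> p Up].
- by apply: smooth_null_field => //; [exact: smooth_cst|exact: smooth_opp].
- by apply: smooth_null_field => //; exact: smooth_cst.
have /lt_eqF/negbT e0 : sdot (dxi x p) (deta x p) < 0 by case: (nx Up).
have aux1 (r : R) : r != 0 -> r * (1 * - (2 * r)^-1 + - (2 * r)^-1 * 1) = -1.
  by move=> r0; field.
have aux2 (r : R) : r != 0 -> r * (1 * (2 * r)^-1 + (2 * r)^-1 * 1) = 1.
  by move=> r0; field.
have aux3 (r : R) : r != 0 -> r * (1 * (2 * r)^-1 + - (2 * r)^-1 * 1) = 0.
  by move=> r0; ring.
split; apply: etrans (push_sdot _ _ Up) _; rewrite !xi_null_field !et_null_field.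
- exact: aux1.
- exact: aux2.
- exact: aux3.
Qed.

(** The components of [Phi'] on the idempotents [(1 + j) / 2] and [(1 - j) / 2]
are [2 x_xixi] and [2 x_etaeta], and these are orthogonal to [x_xi] and to
[x_eta] respectively, so that the projection does not change their squares. *)
Lemma Phi'N2_null p : U p -> dxi (deta x) p = 0 ->
  let AA := sdot (dxi (dxi x) p) (dxi (dxi x) p) in
  let BB := sdot (deta (deta x) p) (deta (deta x) p) in
  Phi'N2 x p = DNum (2 * (AA + BB)) (2 * (AA - BB)).
Proof.
move=> Up C0; have [aa bb /lt_eqF/negbT e0] := nx Up.
have C0' : deta (dxi x) p = 0 by rewrite swap_x.
have Aa : sdot (dxi (dxi x) p) (dxi x p) = 0 by rewrite dxi_app; exact: dot_Da.
have Bb : sdot (deta (deta x) p) (deta x p) = 0 by rewrite deta_app; exact: dot_Db.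
have half (c c' r s t u A B : space) : c = 0 -> c' = 0 ->
    r = A + c' + (c + B) -> s = A - c' - (c - B) ->
    t = A + c' - (c + B) -> u = A - c' + (c - B) ->
    2^-1 *: (r + s) = A + B /\ 2^-1 *: (t + u) = A - B.
  by move=> -> -> -> -> -> ->; split; apply/rowP => i; rewrite !mxE; field.
have [re im] := half _ _ _ _ _ _ _ _ C0 C0' (du_du oU sx Up) (dv_dv oU sx Up)
  (du_dv oU sx Up) (dv_du oU sx Up).
have E : Phi'N x p = map2_mx (@DNum R)
    (nproj (dxi x p) (deta x p) (dxi (dxi x) p + deta (deta x) p))
    (nproj (dxi x p) (deta x p) (dxi (dxi x) p - deta (deta x) p)).
  transitivity (map2_mx (@DNum R) (dxi (dxi x) p + deta (deta x) p)
      (dxi (dxi x) p - deta (deta x) p) *m map_mx (@dreal R) (normal_proj x p)).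
    by congr (_ *m _); rewrite dt_Phi; congr (map2_mx _ _ _); [exact: re|exact: im].
  apply: etrans (mul_dnum _ _ _) _.
  by congr (map2_mx _ _ _); exact: normal_projE.
apply: etrans (congr2 (@sdot _) E E) _; apply: etrans (sdot_dnum _ _) _.
move: Aa Bb aa bb e0.
move: (dxi x p) (deta x p) (dxi (dxi x) p) (deta (deta x) p) => a b A B Aa Bb aa bb e0.
apply: dnum_eq; rewrite /= !nproj_sdot // !sdotL Aa Bb (sdotC B A); field; exact: e0.
Qed.

Lemma null_form_third_type : null_form x U -> canonical_coordinates x U /\ third_type x U.
Proof.
move=> [_ _ C0 AB].
have N p : U p -> Phi'N2 x p = dj R.
  move=> Up; rewrite (Phi'N2_null Up (C0 p Up)); have [-> ->] := AB p Up.
  by apply: dnum_eq => /=; field.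
split; first by split=> //; apply/(isothermal_null sx).
move=> p Up; left; rewrite N //; split; rewrite /dnorm2 /=; lra.
Qed.

(** In the frame of null vectors the mean curvature vector is a multiple of the
normal part of [x_xieta]; its tangential part vanishes because [x_xi] and
[x_eta] keep square zero. *)
Lemma minimal_null : minimal x U -> forall p, U p -> dxi (deta x) p = 0.
Proof.
move=> mx p Up.
have [aa bb /lt_eqF/negbT e0] := nx Up.
have [s1 s2 _] := null_tangent_frame.
have Ca : sdot (dxi (deta x) p) (dxi x p) = 0.
  by rewrite -swap_x // deta_app; exact: dot_Da.
have Cb : sdot (dxi (deta x) p) (deta x p) = 0 by rewrite dxi_app; exact: dot_Db.
have aux (a b A B C : space) : sdot a a = 0 -> sdot b b = 0 -> sdot a b != 0 ->
    sdot C a = 0 -> sdot C b = 0 ->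
    2^-1 *: (- ((1 * 1) *: nproj a b A
               + (1 * - (2 * sdot a b)^-1 + - (2 * sdot a b)^-1 * 1) *: nproj a b C
               + (- (2 * sdot a b)^-1 * - (2 * sdot a b)^-1) *: nproj a b B)
             + ((1 * 1) *: nproj a b A
               + (1 * (2 * sdot a b)^-1 + (2 * sdot a b)^-1 * 1) *: nproj a b C
               + ((2 * sdot a b)^-1 * (2 * sdot a b)^-1) *: nproj a b B)) = 0 ->
    C = 0.
  move=> a0 b0 ab Ca0 Cb0 H.
  have -> : C = nproj a b C by rewrite /nproj Ca0 Cb0 !mul0r !scale0r !subr0.
  apply: (@scalerI _ _ (sdot a b)^-1); rewrite ?invr_eq0 // scaler0 -{}[RHS]H.
  apply/rowP => i; rewrite !mxE; move: (nproj a b A 0 i) (nproj a b B 0 i) (nproj a b C 0 i).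
  by move=> z1 z2 z3; field.
apply: aux aa bb e0 Ca Cb _.
have := mx U _ _ oU (@subset_refl _ U) null_tangent_frame p Up.
rewrite (sigmaE oU sx nx null_tangent1 oU (@subset_refl _ U) s1 Up).
rewrite (sigmaE oU sx nx null_tangent2 oU (@subset_refl _ U) s2 Up) /=.
by rewrite !xi_null_field !et_null_field; apply.
Qed.

(** Orthonormality forces the two frame vectors to have [xi]-components with
equal squares, and likewise for [eta]. Hence only [x_xieta] contributes to the
mean curvature vector. *)
Lemma null_minimal : (forall p, U p -> dxi (deta x) p = 0) -> minimal x U.
Proof.
move=> C0 V X1 X2 oV VU [s1 s2 fr] p Vp; have Up := VU _ Vp.
have [f1 f2 f3] := fr p Vp.
have := etrans (esym (push_sdot X1 X1 Up)) f1.
have := etrans (esym (push_sdot X2 X2 Up)) f2.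
have := etrans (esym (push_sdot X1 X2 Up)) f3.
rewrite (sigmaE oU sx nx X1 oV VU s1 Vp) (sigmaE oU sx nx X2 oV VU s2 Vp) /= (C0 _ Up).
have [aa bb _] := nx Up.
have -> : nproj (dxi x p) (deta x p) 0 = 0.
  by rewrite -[X in nproj _ _ X](scale0r (0 : space)) nprojZ scale0r.
move: (nproj _ _ _) (nproj _ _ _) (sdot _ _) => nA nB r.
move: (xi (X1 p)) (et (X1 p)) (xi (X2 p)) (et (X2 p)) => x1 t1 x2 t2 {}f3 {}f2 {}f1.
have e1 : x1 * x1 = x2 * x2.
  apply/eqP; rewrite -subr_eq0; apply/eqP.
  rewrite (_ : _ - _ = x1 ^+ 2 * (1 - r * (x2 * t2 + t2 * x2)) -
    x2 ^+ 2 * (1 + r * (x1 * t1 + t1 * x1)) +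
    2 * x1 * x2 * (r * (x1 * t2 + t1 * x2))); last by ring.
  by rewrite f1 f2 f3; ring.
have e2 : t1 * t1 = t2 * t2.
  apply/eqP; rewrite -subr_eq0; apply/eqP.
  rewrite (_ : _ - _ = t1 ^+ 2 * (1 - r * (x2 * t2 + t2 * x2)) -
    t2 ^+ 2 * (1 + r * (x1 * t1 + t1 * x1)) +
    2 * t1 * t2 * (r * (x1 * t2 + t1 * x2))); last by ring.
  by rewrite f1 f2 f3; ring.
by rewrite e1 e2 !scaler0 addNr scaler0.
Qed.

Lemma null_timelike : is_domain U -> timelike_surface x U.
Proof.
have ind (w : plane) (a b : space) : sdot a a = 0 -> sdot b b = 0 -> sdot a b < 0 ->
    w 0 0 *: (a + b) + w 0 1 *: (a - b) = 0 -> w = 0.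
  move=> aa bb e0 H.
  have := congr1 (fun v : space => sdot v a) H.
  have := congr1 (fun v : space => sdot v b) H.
  rewrite /= !sdotL aa bb (sdotC b) => h1 h2.
  have /eqP : (w 0 0 + w 0 1) * sdot a b = 0 by lra.
  have /eqP : (w 0 0 - w 0 1) * sdot a b = 0 by lra.
  rewrite !mulf_eq0 (lt_eqF e0) !orbF => /eqP k1 /eqP k2.
  by apply/rowP => i; elim/ord2P: i; rewrite mxE; lra.
move=> dU; split=> // p Up; have [aa bb e0] := nx Up.
have dx := smooth_diff sx Up.
have Eu := du_null dx; have Ev := dv_null dx; split.
  apply/eqP; change (row_free (tangent_mx x p)); apply: inj_row_free => w.
  rewrite mulmx_sum_row sum2.
  have -> : row 0 (tangent_mx x p) = dxi x p + deta x p by exact: etrans (rowK _ _) Eu.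
  have -> : row 1 (tangent_mx x p) = dxi x p - deta x p by exact: etrans (rowK _ _) Ev.
  move=> H; apply: ind aa bb e0 H.
exists (unitv R 0), (unitv R 1).
have aux (a b : space) : sdot a a = 0 -> sdot b b = 0 -> sdot a b < 0 ->
  sdot (a + b) (a + b) < 0 < sdot (a - b) (a - b).
  by move=> a0 b0 ab; rewrite !sdotL a0 b0 (sdotC b); lra.
have := aux _ _ aa bb e0; rewrite -Eu -Ev; exact.
Qed.

End Tangents.

Theorem canonical_null_form x U : canonical_third_type_minimal_surface x U ->
  null_form x U.
Proof.
move=> [[[oU _] sx _] mx [/(isothermal_null sx) nx N] _].
have C0 := minimal_null oU sx nx mx; split=> // p Up.
have := N p Up; rewrite (Phi'N2_null oU sx nx Up (C0 p Up)) => -[h1 h2]; lra.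
Qed.

Theorem null_form_canonical x U : is_domain U -> null_form x U ->
  canonical_third_type_minimal_surface x U.
Proof.
move=> dU nf; have [oU _] := dU; have [sx nx C0 AB] := nf.
have [] := null_form_third_type oU sx nx nf.
by split=> //; [exact: null_timelike|exact: null_minimal].
Qed.

End NullForm.

(** * The Gauss curvature *)

Section Der.
Variable R : realType.
Local Notation plane := 'rV[R]_2.
Local Notation space := 'rV[R]_4.

(** Differentiability is carried along with the value, so that derivatives of
compound expressions can be assembled from those of their parts. *)
Definition has_der (W : normedModType R) (p h : plane) (f : plane -> W) (v : W) :=
  differentiable f p /\ 'D_h f p = v.

Variables (p h : plane).
Implicit Types (f g : plane -> R) (F G : plane -> space).

Lemma has_der_eq (W : normedModType R) (f : plane -> W) v w : has_der p h f v -> v = w -> has_der p h f w.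
Proof. by move=> ? <-. Qed.

Lemma has_der_cst (W : normedModType R) (c : W) : has_der p h (fun=> c) 0.
Proof. by split; [exact: differentiable_cst|exact: derive_cst]. Qed.

Lemma has_der_smooth (W : normedModType R) D (f : plane -> W) : smooth D f -> D p ->
  has_der p h f ('D_h f p).
Proof. by move=> sf Dp; split=> //; exact: smooth_diff sf Dp. Qed.

Lemma has_der_null (W : normedModType R) D (f : plane -> W) : smooth D f -> D p ->
  has_der p h f (xi h *: dxi f p + et h *: deta f p).
Proof.
by move=> sf Dp; split; [exact: smooth_diff sf Dp|apply: derive_null; exact: smooth_diff sf Dp].
Qed.

Lemma has_der_on (W : normedModType R) D (f g : plane -> W) v : open D ->
  (forall q, D q -> f q = g q) -> D p -> has_der p h g v -> has_der p h f v.
Proof.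
move=> oD fg Dp [dg <-]; have gf q : D q -> g q = f q by move=> /fg.
by split; [exact: differentiable_on gf Dp dg|exact: derive_on fg Dp].
Qed.

Lemma has_der_add (W : normedModType R) (f g : plane -> W) v w : has_der p h f v -> has_der p h g w ->
  has_der p h (fun q => f q + g q) (v + w).
Proof. by move=> [df <-] [dg <-]; split; [exact: differentiableD|exact: derive_add]. Qed.

Lemma has_der_opp (W : normedModType R) (f : plane -> W) v : has_der p h f v -> has_der p h (fun q => - f q) (- v).
Proof. by move=> [df <-]; split; [exact: differentiableN|exact: derive_opp]. Qed.

Lemma has_der_mul f g v w : has_der p h f v -> has_der p h g w ->
  has_der p h (fun q => f q * g q) (v * g p + f p * w).
Proof. by move=> [df <-] [dg <-]; split; [exact: differentiableM|exact: derive_mul]. Qed.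

Lemma has_der_inv f v : has_der p h f v -> f p != 0 ->
  has_der p h (fun q => (f q)^-1) (- (v / f p ^+ 2)).
Proof. by move=> [df <-] f0; split; [exact: differentiableV|exact: derive_inv]. Qed.

Lemma has_der_scale f F v w : has_der p h f v -> has_der p h F w ->
  has_der p h (fun q => f q *: F q) (v *: F p + f p *: w).
Proof. by move=> [df <-] [dg <-]; split; [exact: differentiable_scale|exact: derive_scale]. Qed.

Lemma has_der_sdot F G v w : has_der p h F v -> has_der p h G w ->
  has_der p h (fun q => sdot (F q) (G q)) (sdot v (G p) + sdot (F p) w).
Proof. by move=> [df <-] [dg <-]; split; [exact: differentiable_sdot|exact: derive_sdot]. Qed.

Lemma has_der_xi (F : plane -> plane) v : has_der p h F v -> has_der p h (fun q => xi (F q)) (xi v).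
Proof.
move=> [dF <-]; split.
  exact: differentiableD (differentiable_entry 0 0 dF) (differentiable_entry 0 1 dF).
rewrite /xi (derive_entry h 0 0 dF) (derive_entry h 0 1 dF).
exact: derive_add (differentiable_entry 0 0 dF) (differentiable_entry 0 1 dF).
Qed.

Lemma has_der_et (F : plane -> plane) v : has_der p h F v -> has_der p h (fun q => et (F q)) (et v).
Proof.
move=> [dF <-]; have d1 := differentiable_entry 0 1 dF; split.
  exact: differentiableB (differentiable_entry 0 0 dF) d1.
rewrite /et (derive_entry h 0 0 dF) (derive_entry h 0 1 dF).
apply: etrans (derive_add _ (differentiable_entry 0 0 dF) (differentiableN d1)) _.
by congr (_ + _); exact: derive_opp.
Qed.

End Der.

Lemma smooth_of_null (R : realType) V (F : 'rV[R]_2 -> 'rV[R]_2) : open V ->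
  smooth V (fun q => xi (F q)) -> smooth V (fun q => et (F q)) -> smooth V F.
Proof.
move=> oV sX sE; have := smooth_null_field oV sX sE.
by apply: (smooth_on oV) => q _; exact/esym/null_basis.
Qed.

Section Connection.
Variable R : realType.
Local Notation plane := 'rV[R]_2.
Local Notation vfield := (plane -> plane).

Lemma xiB (h k : plane) : xi (h - k) = xi h - xi k.
Proof. by rewrite /xi !mxE; ring. Qed.

Lemma etB (h k : plane) : et (h - k) = et h - et k.
Proof. by rewrite /et !mxE; ring. Qed.

Lemma xiD (h k : plane) : xi (h + k) = xi h + xi k.
Proof. by rewrite /xi !mxE; ring. Qed.

Lemma etD (h k : plane) : et (h + k) = et h + et k.
Proof. by rewrite /et !mxE; ring. Qed.

(** The connection [d + w1 dxi + w2 deta] on a trivial line bundle. *)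
Definition conn (w1 w2 : plane -> R) (X : vfield) (f : plane -> R) (p : plane) : R :=
  'D_(X p) f p + (w1 p * xi (X p) + w2 p * et (X p)) * f p.

Variables (V : set plane) (oV : open V) (w1 w2 : plane -> R).
Hypotheses (sw1 : smooth V w1) (sw2 : smooth V w2).

Lemma connE X f p : smooth V f -> V p -> conn w1 w2 X f p =
  xi (X p) * dxi f p + et (X p) * deta f p + (w1 p * xi (X p) + w2 p * et (X p)) * f p.
Proof. by move=> sf Vp; congr (_ + _); exact: derive_null (smooth_diff sf Vp). Qed.

Lemma smooth_conn X f : smooth V X -> smooth V f -> smooth V (conn w1 w2 X f).
Proof.
move=> sX sf; have x1 := smooth_xi oV sX; have x2 := smooth_et oV sX.
have H : smooth V (fun p => xi (X p) * dxi f p + et (X p) * deta f p +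
    (w1 p * xi (X p) + w2 p * et (X p)) * f p).
  exact: (smooth_add oV (smooth_add oV (smooth_mul oV x1 (smooth_dxi sf))
    (smooth_mul oV x2 (smooth_deta sf)))
    (smooth_mul oV (smooth_add oV (smooth_mul oV sw1 x1) (smooth_mul oV sw2 x2)) sf)).
by apply: (smooth_on oV) H => q Vq; exact/esym/connE.
Qed.

Lemma derive_conn X f p h : smooth V X -> smooth V f -> V p -> 'D_h (conn w1 w2 X f) p =
  'D_h (fun q => xi (X q)) p * dxi f p + xi (X p) * (xi h * dxi (dxi f) p + et h * deta (dxi f) p)
  + ('D_h (fun q => et (X q)) p * deta f p +
     et (X p) * (xi h * dxi (deta f) p + et h * deta (deta f) p))
  + (((xi h * dxi w1 p + et h * deta w1 p) * xi (X p) + w1 p * 'D_h (fun q => xi (X q)) p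
      + ((xi h * dxi w2 p + et h * deta w2 p) * et (X p) + w2 p * 'D_h (fun q => et (X q)) p)) * f p
     + (w1 p * xi (X p) + w2 p * et (X p)) * (xi h * dxi f p + et h * deta f p)).
Proof.
move=> sX sf Vp.
have dX := has_der_smooth h (smooth_xi oV sX) Vp; have dE := has_der_smooth h (smooth_et oV sX) Vp.
have df := has_der_null h sf Vp; have d1 := has_der_null h sw1 Vp; have d2 := has_der_null h sw2 Vp.
have df1 := has_der_null h (smooth_dxi sf) Vp; have df2 := has_der_null h (smooth_deta sf) Vp.
have := has_der_add (has_der_add (has_der_mul dX df1) (has_der_mul dE df2))
  (has_der_mul (has_der_add (has_der_mul d1 dX) (has_der_mul d2 dE)) df).
by move=> /(has_der_on oV (fun q => connE X sf) Vp)[_].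
Qed.

Lemma xi_lie X Y p : smooth V X -> smooth V Y -> V p ->
  xi (lie X Y p) = 'D_(X p) (fun q => xi (Y q)) p - 'D_(Y p) (fun q => xi (X q)) p.
Proof.
move=> sX sY Vp.
have [_ ->] := has_der_xi (has_der_smooth (X p) sY Vp); have [_ ->] := has_der_xi (has_der_smooth (Y p) sX Vp).
exact: xiB.
Qed.

Lemma et_lie X Y p : smooth V X -> smooth V Y -> V p ->
  et (lie X Y p) = 'D_(X p) (fun q => et (Y q)) p - 'D_(Y p) (fun q => et (X q)) p.
Proof.
move=> sX sY Vp.
have [_ ->] := has_der_et (has_der_smooth (X p) sY Vp); have [_ ->] := has_der_et (has_der_smooth (Y p) sX Vp).
exact: etB.
Qed.

(** The curvature of a line bundle connection is the exterior derivative of its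
connection form: second derivatives of the section cancel by symmetry, and
first derivatives of the vector fields are absorbed by the Lie bracket. *)
Lemma conn_curvature X Y f p : smooth V X -> smooth V Y -> smooth V f -> V p ->
  conn w1 w2 X (conn w1 w2 Y f) p - conn w1 w2 Y (conn w1 w2 X f) p
    - conn w1 w2 (lie X Y) f p =
  (xi (X p) * et (Y p) - et (X p) * xi (Y p)) * (dxi w2 p - deta w1 p) * f p.
Proof.
move=> sX sY sf Vp.
rewrite {1}/conn [X in _ - X - _]/conn.
rewrite (derive_conn _ sY sf Vp) (derive_conn _ sX sf Vp) !(connE _ sf Vp).
rewrite (xi_lie sX sY Vp) (et_lie sX sY Vp) (null_swap oV sf Vp).
move: ('D_(X p) _ p) ('D_(X p) _ p) ('D_(Y p) _ p) ('D_(Y p) _ p) => a b c d.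
ring.
Qed.

End Connection.

Section Gauss.
Variable R : realType.
Local Notation plane := 'rV[R]_2.
Local Notation space := 'rV[R]_4.
Local Notation vfield := (plane -> plane).
Variables (x : plane -> space) (U : set plane).
Hypotheses (oU : open U) (sx : smooth U x) (nx : null_tangents x U).

Definition metric (p : plane) : R := sdot (dxi x p) (deta x p).
Local Notation e := metric.

Lemma smooth_metric : smooth U e.
Proof. exact: smooth_e. Qed.

Lemma metric_neq0 p : U p -> e p != 0.
Proof. by move=> /nx[_ _ e0]; rewrite lt_eqF. Qed.

Lemma gramE p : U p -> [/\ gram x p 0 0 = 2 * e p, gram x p 0 1 = 0,
  gram x p 1 0 = 0 & gram x p 1 1 = - (2 * e p)].
Proof.
move=> Up; have [aa bb _] := nx Up; have dx := smooth_diff sx Up.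
have aux (a b : space) : sdot a a = 0 -> sdot b b = 0 ->
  [/\ sdot (a + b) (a + b) = 2 * sdot a b, sdot (a + b) (a - b) = 0,
    sdot (a - b) (a + b) = 0 & sdot (a - b) (a - b) = - (2 * sdot a b)].
  by move=> a0 b0; rewrite !sdotL a0 b0 (sdotC b); split; ring.
have := aux _ _ aa bb; rewrite -(du_null dx) -(dv_null dx) => -[h1 h2 h3 h4].
rewrite /gram; split; rewrite mxE; [exact: h1|exact: h2|exact: h3|exact: h4].
Qed.

Lemma invmx_gramE p : U p -> [/\ invmx (gram x p) 0 0 = (2 * e p)^-1,
  invmx (gram x p) 0 1 = 0, invmx (gram x p) 1 0 = 0 &
  invmx (gram x p) 1 1 = - (2 * e p)^-1].
Proof.
move=> Up; have e0 := metric_neq0 Up; have [g00 g01 g10 g11] := gramE Up.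
have aux (G : 'M[R]_2) (r : R) : r != 0 -> G 0 0 = 2 * r -> G 0 1 = 0 -> G 1 0 = 0 ->
  G 1 1 = - (2 * r) -> [/\ invmx G 0 0 = (2 * r)^-1, invmx G 0 1 = 0,
    invmx G 1 0 = 0 & invmx G 1 1 = - (2 * r)^-1].
  move=> r0 h00 h01 h10 h11.
  pose H : 'M[R]_2 := \matrix_(i, j) (if i == j then (-1) ^+ i * (2 * r)^-1 else 0).
  have GH : G *m H = 1%:M.
    apply/matrixP => i j; rewrite !mxE sum2 !mxE.
    elim/ord2P: i; elim/ord2P: j; rewrite ?h00 ?h01 ?h10 ?h11 /= ?expr0 ?expr1; field; exact: r0.
  have -> : invmx G = H.
    by have [uG _] := mulmx1_unit GH; rewrite -[H]mul1mx -(mulVmx uG) -mulmxA GH mulmx1.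
  by rewrite !mxE /= expr0 expr1 mul1r mulN1r.
exact: aux e0 g00 g01 g10 g11.
Qed.

Lemma derive_gram p h : U p ->
  let g := 'D_h (fun q => 2 * e q) p in
  [/\ 'D_h (fun q => gram x q 0 0) p = g, 'D_h (fun q => gram x q 0 1) p = 0,
   'D_h (fun q => gram x q 1 0) p = 0 & 'D_h (fun q => gram x q 1 1) p = - g].
Proof.
move=> Up; have d2e := smooth_diff (smooth_mul oU (smooth_cst U (2 : R)) smooth_metric) Up.
have g00 q : U q -> gram x q 0 0 = 2 * e q by case/gramE.
have g01 q : U q -> gram x q 0 1 = (fun=> 0) q by case/gramE.
have g10 q : U q -> gram x q 1 0 = (fun=> 0) q by case/gramE.
have g11 q : U q -> gram x q 1 1 = (fun q => - (2 * e q)) q by case/gramE.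
split.
- by have E := derive_on h oU g00 Up; exact: E.
- by have E := etrans (derive_on h oU g01 Up) (derive_cst (0 : R) p h); exact: E.
- by have E := etrans (derive_on h oU g10 Up) (derive_cst (0 : R) p h); exact: E.
- by have E := etrans (derive_on h oU g11 Up) (derive_opp h d2e); exact: E.
Qed.

Definition log_xi p := dxi e p / e p.
Definition log_eta p := deta e p / e p.

(** The metric is [2 e dxi deta] up to a constant factor, and its only
Christoffel symbols in null coordinates are [e_xi / e] and [e_eta / e]. So the
connection is the direct sum of two line bundle connections. *)
Lemma nabla_null V (X Y : vfield) p : open V -> V `<=` U -> smooth V Y -> V p ->
  xi (nabla x X Y p) = conn log_xi (fun=> 0) X (fun q => xi (Y q)) p /\
  et (nabla x X Y p) = conn (fun=> 0) log_eta X (fun q => et (Y q)) p.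
Proof.
move=> oV VU sY Vp; have Up := VU _ Vp.
have [_ dxiY] := has_der_xi (has_der_smooth (X p) sY Vp).
have [_ detY] := has_der_et (has_der_smooth (X p) sY Vp).
have aux (G : 'M[R]_2) (dG : 'I_2 -> 'I_2 -> 'I_2 -> R) (r g0 g1 d1 d2 : R) (v w : plane) :
    r != 0 -> [/\ G 0 0 = (2 * r)^-1, G 0 1 = 0, G 1 0 = 0 & G 1 1 = - (2 * r)^-1] ->
    [/\ dG 0 0 0 = g0, dG 0 0 1 = 0, dG 0 1 0 = 0 & dG 0 1 1 = - g0] ->
    [/\ dG 1 0 0 = g1, dG 1 0 1 = 0, dG 1 1 0 = 0 & dG 1 1 1 = - g1] ->
    g0 = 2 * (d1 + d2) -> g1 = 2 * (d1 - d2) ->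
    let N := \row_k \sum_(i < 2) \sum_(j < 2)
      (2^-1 * \sum_(l < 2) G k l * (dG i j l + dG j i l - dG l i j)) * v 0 i * w 0 j in
    xi N = (d1 / r * xi v + 0 * et v) * xi w /\ et N = (0 * xi v + d2 / r * et v) * et w.
  move=> r0 [h00 h01 h10 h11] [a1 a2 a3 a4] [b1 b2 b3 b4] e0 e1.
  rewrite /xi /et !mxE !sum2 h00 h01 h10 h11 a1 a2 a3 a4 b1 b2 b3 b4 e0 e1.
  by split; field; exact: r0.
have de := smooth_diff smooth_metric Up.
have d2e h : 'D_h (fun q => 2 * e q) p = 2 * 'D_h e p.
  have [_ ->] := has_der_mul (has_der_cst p h (2 : R)) (has_der_smooth h smooth_metric Up).
  by rewrite mul0r add0r.
have [h1 h2] := aux _ (fun i j l => 'D_(unitv R i) (fun q => gram x q j l) p) _ _ _ _ _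
  (X p) (Y p) (metric_neq0 Up) (invmx_gramE Up) (derive_gram _ Up) (derive_gram _ Up)
  (etrans (d2e _) (congr1 _ (du_null de))) (etrans (d2e _) (congr1 _ (dv_null de))).
split.
  by apply: etrans (xiD _ _) _; apply: congr2 (esym dxiY) h1.
by apply: etrans (etD _ _) _; apply: congr2 (esym detY) h2.
Qed.

Lemma smooth_log_xi : smooth U log_xi.
Proof.
exact: (smooth_mul oU (smooth_dxi smooth_metric) (smooth_inv oU smooth_metric metric_neq0)).
Qed.

Lemma smooth_log_eta : smooth U log_eta.
Proof.
exact: (smooth_mul oU (smooth_deta smooth_metric) (smooth_inv oU smooth_metric metric_neq0)).
Qed.

(** For a surface in null form this is the scalar product of the normal parts
of [x_xixi] and [x_etaeta], see [mixedE]. *)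
Definition mixed (p : plane) : R := dxi (deta e) p - dxi e p * deta e p / e p.

Lemma deta_log_xi p : U p -> deta log_xi p = mixed p / e p.
Proof.
move=> Up; rewrite deta_app; have e0 := metric_neq0 Up.
have [_ ->] := has_der_mul (has_der_smooth (weta R) (smooth_dxi smooth_metric) Up)
  (has_der_inv (has_der_smooth (weta R) smooth_metric Up) e0).
rewrite -!deta_app (null_swap oU smooth_metric Up) /mixed.
by move: (dxi _ _) (dxi _ _) (deta _ _) => a b c; field.
Qed.

Lemma dxi_log_eta p : U p -> dxi log_eta p = mixed p / e p.
Proof.
move=> Up; rewrite dxi_app; have e0 := metric_neq0 Up.
have [_ ->] := has_der_mul (has_der_smooth (wxi R) (smooth_deta smooth_metric) Up)
  (has_der_inv (has_der_smooth (wxi R) smooth_metric Up) e0).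
rewrite -!dxi_app /mixed.
by move: (dxi _ _) (dxi _ _) (deta _ _) => a b c; field.
Qed.

Lemma curvature_null V (X Y : vfield) p : open V -> V `<=` U -> smooth V X -> smooth V Y -> V p ->
  let J := xi (X p) * et (Y p) - et (X p) * xi (Y p) in
  xi (curvature (nabla x) X Y Y p) = - (J * (mixed p / e p) * xi (Y p)) /\
  et (curvature (nabla x) X Y Y p) = J * (mixed p / e p) * et (Y p).
Proof.
move=> oV VU sX sY Vp J; have Up := VU _ Vp.
have s1 := smooth_sub VU smooth_log_xi; have s2 := smooth_sub VU smooth_log_eta.
have sc := smooth_cst V (0 : R).
have xY := smooth_xi oV sY; have eY := smooth_et oV sY.
have N1 Z q : V q -> xi (nabla x Z Y q) = conn log_xi (fun=> 0) Z (fun q => xi (Y q)) q.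
  by move=> Vq; have [] := nabla_null Z oV VU sY Vq.
have N2 Z q : V q -> et (nabla x Z Y q) = conn (fun=> 0) log_eta Z (fun q => et (Y q)) q.
  by move=> Vq; have [] := nabla_null Z oV VU sY Vq.
have S Z : smooth V Z -> smooth V (nabla x Z Y).
  move=> sZ; apply: (smooth_of_null oV).
    by apply: (smooth_on oV) (smooth_conn oV s1 sc sZ xY) => q Vq; rewrite N1.
  by apply: (smooth_on oV) (smooth_conn oV sc s2 sZ eY) => q Vq; rewrite N2.
have M1 W Z : smooth V Z -> xi (nabla x W (nabla x Z Y) p) =
    conn log_xi (fun=> 0) W (conn log_xi (fun=> 0) Z (fun q => xi (Y q))) p.
  move=> sZ; have [-> _] := nabla_null W oV VU (S Z sZ) Vp.
  by congr (_ + _ * _); [exact: derive_on oV (N1 Z) Vp|exact: N1].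
have M2 W Z : smooth V Z -> et (nabla x W (nabla x Z Y) p) =
    conn (fun=> 0) log_eta W (conn (fun=> 0) log_eta Z (fun q => et (Y q))) p.
  move=> sZ; have [_ ->] := nabla_null W oV VU (S Z sZ) Vp.
  by congr (_ + _ * _); [exact: derive_on oV (N2 Z) Vp|exact: N2].
split.
  rewrite /curvature !xiB (M1 X Y sY) (M1 Y X sX) N1 //.
  rewrite (conn_curvature oV s1 sc sX sY xY Vp) (deta_log_xi Up) dxi_app derive_cst.
  by rewrite sub0r mulrN mulNr.
rewrite /curvature !etB (M2 X Y sY) (M2 Y X sX) N2 //.
rewrite (conn_curvature oV sc s2 sX sY eY Vp) (dxi_log_eta Up) deta_app derive_cst.
by rewrite subr0.
Qed.

(** The Gram determinant of an orthonormal frame, computed in null coordinates. *)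
Lemma frame_jacobian (r x1 t1 x2 t2 : R) :
  r * (x1 * t1 + t1 * x1) = -1 -> r * (x2 * t2 + t2 * x2) = 1 ->
  r * (x1 * t2 + t1 * x2) = 0 -> ((x1 * t2 - t1 * x2) * r) ^+ 2 = 1.
Proof.
move=> f1 f2 f3; rewrite (_ : _ ^+ 2 = (r * (x1 * t2 + t1 * x2)) ^+ 2 -
  (r * (x1 * t1 + t1 * x1)) * (r * (x2 * t2 + t2 * x2))); last by ring.
by rewrite f1 f2 f3; ring.
Qed.

Lemma gauss_frame V (X1 X2 : vfield) p : open V -> V `<=` U -> tangent_frame x V X1 X2 -> V p ->
  - sdot (push x (curvature (nabla x) X1 X2 X2) p) (push x X1 p) = - mixed p / e p ^+ 2.
Proof.
move=> oV VU [s1 s2 fr] Vp; have Up := VU _ Vp; have [f1 f2 f3] := fr p Vp.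
have g1 := etrans (esym (push_sdot sx nx X1 X1 Up)) f1.
have g2 := etrans (esym (push_sdot sx nx X2 X2 Up)) f2.
have g3 := etrans (esym (push_sdot sx nx X1 X2 Up)) f3.
have J := frame_jacobian g1 g2 g3.
have [c1 c2] := curvature_null oV VU s1 s2 Vp; have e0 := metric_neq0 Up.
apply: etrans (congr1 -%R (push_sdot sx nx (curvature (nabla x) X1 X2 X2) X1 Up)) _.
rewrite c1 c2; change (sdot (dxi x p) (deta x p)) with (e p).
move: J; change (sdot (dxi x p) (deta x p)) with (e p).
move: (e p) (mixed p) (xi (X1 p)) (et (X1 p)) (xi (X2 p)) (et (X2 p)) e0 => r m x1 t1 x2 t2 r0 J.
rewrite -[in RHS](mulr1 m) -J; field; exact: r0.
Qed.

Lemma gauss_curvatureE (K : plane -> R) :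
  has_gauss_curvature x U K <-> forall p, U p -> K p = - mixed p / e p ^+ 2.
Proof.
split=> H; last by move=> V X1 X2 oV VU fr p Vp; rewrite (gauss_frame oV VU fr Vp) H //; exact: VU.
move=> p Up; have fr := null_tangent_frame oU sx nx.
rewrite (H U _ _ oU (@subset_refl _ U) fr p Up).
exact: gauss_frame oU (@subset_refl _ U) fr Up.
Qed.

End Gauss.

(** * The curvature of the normal connection *)

Section FrameDeterminants.
Variable R : realType.
Local Notation space := 'rV[R]_4.
Implicit Types a b A B n : space.

(** The determinant of the matrix of scalar products, because [eta] has
determinant one. *)
Lemma det_frame_mul a b c d a' b' c' d' :
  \det (frame a b c d) * \det (frame a' b' c' d') =
  \det (frame a b c d *m Defs.eta R *m (frame a' b' c' d')^T).
Proof. by rewrite !det_mulmx det_eta mulr1 det_tr. Qed.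

Lemma det_orthonormal (c d n n' : space) :
  sdot c c = -1 -> sdot d d = 1 -> sdot c d = 0 -> sdot n n = -1 -> sdot n' n' = 1 ->
  sdot n n' = 0 -> sdot c n = 0 -> sdot c n' = 0 -> sdot d n = 0 -> sdot d n' = 0 ->
  0 < \det (frame c d n n') -> \det (frame c d n n') = 1.
Proof.
move=> cc dd cd nn n'n' nn' cn cn' dn dn' pos.
have : \det (frame c d n n') * \det (frame c d n n') = 1.
  rewrite det_frame_mul det4 !frame_gram /= (sdotC d c) (sdotC n c) (sdotC n d) (sdotC n' c).
  rewrite (sdotC n' d) (sdotC n' n) cc dd cd nn n'n' nn' cn cn' dn dn'; ring.
move: (\det _) pos => z z0 /eqP; rewrite -subr_eq0 -[1]mulr1 -expr2 -[1 * 1]expr2 subr_sqr.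
rewrite mulf_eq0 => /orP[|] /eqP; lra.
Qed.

(** The matrix of scalar products is block triangular: the normal vectors [n1]
and [n2] are orthogonal to [a] and [b]. *)
Lemma det_frame_null a b A B X1 X2 n1 n2 x1 t1 x2 t2 :
  sdot a a = 0 -> sdot b b = 0 ->
  X1 = x1 *: a + t1 *: b -> X2 = x2 *: a + t2 *: b ->
  sdot a n1 = 0 -> sdot b n1 = 0 -> sdot a n2 = 0 -> sdot b n2 = 0 ->
  \det (frame a b A B) * \det (frame X1 X2 n1 n2) =
  - sdot a b ^+ 2 * (x1 * t2 - t1 * x2) * (sdot A n1 * sdot B n2 - sdot A n2 * sdot B n1).
Proof.
move=> aa bb eX1 eX2 an1 bn1 an2 bn2.
rewrite det_frame_mul det4 !frame_gram /= an1 bn1 an2 bn2 eX1 eX2 !sdotL aa bb (sdotC b a).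
ring.
Qed.

Lemma det_frame_gram a b A B :
  sdot a a = 0 -> sdot b b = 0 -> sdot a b != 0 -> sdot A a = 0 -> sdot B b = 0 ->
  sdot A A = 4^-1 -> sdot B B = - 4^-1 ->
  \det (frame a b A B) ^+ 2 =
  sdot a b ^+ 2 * (16^-1 + (sdot A B - sdot A b * sdot B a / sdot a b) ^+ 2).
Proof.
move=> aa bb r0 Aa Bb AA BB; rewrite expr2 det_frame_mul det4 !frame_gram /=.
rewrite (sdotC b a) (sdotC a A) (sdotC a B) (sdotC b A) (sdotC b B) (sdotC B A).
by rewrite aa bb Aa Bb AA BB; field.
Qed.

End FrameDeterminants.

Section NormalCurvature.
Variable R : realType.
Local Notation plane := 'rV[R]_2.
Local Notation space := 'rV[R]_4.
Local Notation vfield := (plane -> plane).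
Variables (x : plane -> space) (U : set plane).
Hypotheses (oU : open U) (nf : null_form x U).
Let sx : smooth U x. Proof. by case: nf. Qed.
Let nx : null_tangents x U. Proof. by case: nf. Qed.
Let C0 p : U p -> dxi (deta x) p = 0. Proof. by case: nf => _ _ H _; exact: H. Qed.
Let C0' p : U p -> deta (dxi x) p = 0.
Proof. by move=> Up; have E := etrans (null_swapV oU sx Up) (C0 Up); exact: E. Qed.
Local Notation a := (dxi x).
Local Notation b := (deta x).
Local Notation A := (dxi (dxi x)).
Local Notation B := (deta (deta x)).
Local Notation e := (metric x).

Let sa : smooth U a. Proof. exact: smooth_dxi. Qed.
Let sb : smooth U b. Proof. exact: smooth_deta. Qed.
Let sA : smooth U A. Proof. exact: smooth_dxi. Qed.
Let sB : smooth U B. Proof. exact: smooth_deta. Qed.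

Lemma null_dots p : U p -> [/\ sdot (A p) (a p) = 0, sdot (B p) (b p) = 0,
  sdot (A p) (A p) = 4^-1 & sdot (B p) (B p) = - 4^-1].
Proof.
move=> Up; have [_ _ _ H] := nf; have [AA BB] := H p Up; split=> //.
  by rewrite dxi_app; exact: (dot_Da oU sx nx).
by rewrite deta_app; exact: (dot_Db oU sx nx).
Qed.

Lemma derive_a p h : U p -> has_der p h a (xi h *: A p).
Proof.
by move=> Up; apply: has_der_eq (has_der_null h sa Up) _; rewrite C0' // scaler0 addr0.
Qed.

Lemma derive_b p h : U p -> has_der p h b (et h *: B p).
Proof.
by move=> Up; apply: has_der_eq (has_der_null h sb Up) _; rewrite C0 // scaler0 add0r.
Qed.

Lemma dxi_metric p : U p -> dxi e p = sdot (A p) (b p).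
Proof.
move=> Up; rewrite dxi_app; have [_ E] := has_der_sdot (derive_a (wxi R) Up) (derive_b (wxi R) Up).
by apply: etrans E _; rewrite xi_wxi et_wxi scale1r scale0r sdot0r addr0.
Qed.

Lemma deta_metric p : U p -> deta e p = sdot (B p) (a p).
Proof.
move=> Up; rewrite deta_app; have [_ E] := has_der_sdot (derive_a (weta R) Up) (derive_b (weta R) Up).
by apply: etrans E _; rewrite xi_weta et_weta scale1r scale0r sdot0l add0r sdotC.
Qed.

Lemma dxi_B p : U p -> dxi B p = 0.
Proof.
move=> Up; apply: etrans (esym (null_swapV oU sb Up)) _; rewrite deta_app.
have E := etrans (derive_on (weta R) oU (g := fun=> 0) (fun q Uq => C0 Uq) Up)
  (derive_cst (0 : space) p (weta R)).
exact: E.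
Qed.

Lemma dxi_deta_metric p : U p -> dxi (deta e) p = sdot (A p) (B p).
Proof.
move=> Up; rewrite dxi_app.
have E := derive_on (wxi R) oU (fun q Uq => deta_metric Uq) Up; apply: etrans E _.
have [_ E] := has_der_sdot (has_der_smooth (wxi R) sB Up) (derive_a (wxi R) Up).
apply: etrans E _; rewrite -dxi_app dxi_B // sdot0l add0r xi_wxi scale1r.
exact: sdotC.
Qed.

Lemma mixedE p : U p -> mixed x p = sdot (A p) (B p) - sdot (A p) (b p) * sdot (B p) (a p) / e p.
Proof.
by move=> Up; rewrite /mixed dxi_deta_metric // dxi_metric // deta_metric.
Qed.

Definition frame_det p := \det (frame (a p) (b p) (A p) (B p)).

Lemma frame_det_sqr p : U p -> frame_det p ^+ 2 = e p ^+ 2 * (16^-1 + mixed x p ^+ 2).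
Proof.
move=> Up; have [Aa Bb AA BB] := null_dots Up; have [aa bb _] := nx Up.
by rewrite mixedE //; apply: det_frame_gram => //; exact: (metric_neq0 nx Up).
Qed.

Section Frames.
Variables (V : set plane) (oV : open V) (VU : V `<=` U).

Definition normal_field (n : plane -> space) :=
  forall p, V p -> sdot (n p) (a p) = 0 /\ sdot (n p) (b p) = 0.

(** Differentiate the relations [n.a = 0] and [n.b = 0]. *)
Lemma derive_normal n p h : smooth V n -> normal_field n -> V p ->
  sdot ('D_h n p) (a p) = - (xi h * sdot (n p) (A p)) /\
  sdot ('D_h n p) (b p) = - (et h * sdot (n p) (B p)).
Proof.
move=> sn nn Vp; have Up := VU Vp; have dn := has_der_smooth h sn Vp.
have Z (f : plane -> R) : (forall q, V q -> f q = 0) -> 'D_h f p = 0.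
  by move=> f0; have E := etrans (derive_on h oV f0 Vp) (derive_cst (0 : R) p h); exact: E.
have [_ E1] := has_der_sdot dn (derive_a h Up).
have [_ E2] := has_der_sdot dn (derive_b h Up).
have z1 := etrans (esym E1) (Z _ (fun q Vq => (nn q Vq).1)).
have z2 := etrans (esym E2) (Z _ (fun q Vq => (nn q Vq).2)).
by move: z1 z2; rewrite !sdotZr => /eqP; rewrite addr_eq0 => /eqP -> /eqP; rewrite addr_eq0 => /eqP ->.
Qed.

(** The derivative of a normal field minus its tangential part, written without
derivatives of the field in the correction terms. *)
Definition nablaN_rhs (X : vfield) (n : plane -> space) q : space :=
  xi (X q) *: dxi n q + et (X q) *: deta n q
  + (et (X q) * sdot (n q) (B q) * (e q)^-1) *: a q
  + (xi (X q) * sdot (n q) (A q) * (e q)^-1) *: b q.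

Lemma nablaN_null X n p : smooth V n -> normal_field n -> V p ->
  nablaN x X n p = nablaN_rhs X n p.
Proof.
move=> sn nn Vp; apply: etrans (normal_projE sx nx _ (VU Vp)) _.
have [h1 h2] := derive_normal (X p) sn nn Vp.
rewrite /nproj h1 h2; apply: etrans (congr1 (fun z => z - _ - _) (derive_null _ (smooth_diff sn Vp))) _.
by rewrite !mulNr !scaleNr !opprK.
Qed.

Lemma sdot_nproj (m v : space) p : sdot m (a p) = 0 -> sdot m (b p) = 0 ->
  sdot (nproj (a p) (b p) v) m = sdot v m.
Proof.
move=> ma mb; rewrite /nproj !sdotL (sdotC (a p) m) (sdotC (b p) m) ma mb.
by rewrite !mulr0 !subr0.
Qed.

Lemma nablaN2 X Y n (m : space) p : smooth V Y -> smooth V n -> normal_field n ->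
  V p -> sdot m (a p) = 0 -> sdot m (b p) = 0 ->
  sdot (nablaN x X (nablaN x Y n) p) m =
    'D_(X p) (fun q => xi (Y q)) p * sdot (dxi n p) m
    + xi (Y p) * (xi (X p) * sdot (dxi (dxi n) p) m + et (X p) * sdot (deta (dxi n) p) m)
    + ('D_(X p) (fun q => et (Y q)) p * sdot (deta n p) m
    + et (Y p) * (xi (X p) * sdot (dxi (deta n) p) m + et (X p) * sdot (deta (deta n) p) m))
    + et (Y p) * sdot (n p) (B p) * (e p)^-1 * (xi (X p) * sdot (A p) m)
    + xi (Y p) * sdot (n p) (A p) * (e p)^-1 * (et (X p) * sdot (B p) m).
Proof.
move=> sY sn nn Vp ma mb; have Up := VU Vp.
have -> : nablaN x X (nablaN x Y n) p = nproj (a p) (b p) ('D_(X p) (nablaN x Y n) p).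
  exact: normal_projE.
rewrite sdot_nproj //.
set h := X p.
have dxY := has_der_smooth h (smooth_xi oV sY) Vp.
have deY := has_der_smooth h (smooth_et oV sY) Vp.
have d1 := has_der_null h (smooth_dxi sn) Vp; have d2 := has_der_null h (smooth_deta sn) Vp.
have ie := smooth_inv oU (smooth_metric oU sx) (metric_neq0 nx).
have c1 : smooth V (fun q => et (Y q) * sdot (n q) (B q) * (e q)^-1).
  exact: (smooth_mul oV (smooth_mul oV (smooth_et oV sY)
    (smooth_sdot oV sn (smooth_sub VU sB))) (smooth_sub VU ie)).
have c2 : smooth V (fun q => xi (Y q) * sdot (n q) (A q) * (e q)^-1).
  exact: (smooth_mul oV (smooth_mul oV (smooth_xi oV sY)
    (smooth_sdot oV sn (smooth_sub VU sA))) (smooth_sub VU ie)).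
have := has_der_add (has_der_add (has_der_add (has_der_scale dxY d1) (has_der_scale deY d2))
  (has_der_scale (has_der_smooth h c1 Vp) (derive_a h Up)))
  (has_der_scale (has_der_smooth h c2 Vp) (derive_b h Up)).
move=> /(has_der_on oV (fun q Vq => nablaN_null Y sn nn Vq) Vp)[_ E].
apply: etrans (congr1 (fun z => sdot z m) E) _.
rewrite !sdotL (sdotC (a p) m) (sdotC (b p) m) ma mb !mulr0 !add0r.
by [].
Qed.

Lemma nablaN1 X n (m : space) p : smooth V n -> V p -> sdot m (a p) = 0 -> sdot m (b p) = 0 ->
  sdot (nablaN x X n p) m = xi (X p) * sdot (dxi n p) m + et (X p) * sdot (deta n p) m.
Proof.
move=> sn Vp ma mb; have Up := VU Vp.
have -> : nablaN x X n p = nproj (a p) (b p) ('D_(X p) n p) by exact: normal_projE.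
rewrite sdot_nproj //.
apply: etrans (congr1 (fun z => sdot z m) (derive_null _ (smooth_diff sn Vp))) _.
by rewrite !sdotL.
Qed.

(** The equation of Ricci. The second derivatives of [n] cancel against each other
and against the Lie bracket; what remains comes from differentiating the
tangential corrections in [nablaN_rhs]. *)
Lemma normal_curvature_ricci X Y n (m : space) p : smooth V X -> smooth V Y -> smooth V n ->
  normal_field n -> V p -> sdot m (a p) = 0 -> sdot m (b p) = 0 ->
  sdot (curvature (nablaN x) X Y n p) m =
  (xi (X p) * et (Y p) - et (X p) * xi (Y p)) *
  (sdot (n p) (B p) * sdot (A p) m - sdot (n p) (A p) * sdot (B p) m) / e p.
Proof.
move=> sX sY sn nn Vp ma mb.
have sub3 (u v w : space) : sdot (u - v - w) m = sdot u m - sdot v m - sdot w m.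
  by rewrite !sdotL.
apply: etrans (sub3 _ _ _) _.
have E := congr2 (fun s t => s - t) (congr2 (fun s t => s - t) (nablaN2 X sY sn nn Vp ma mb)
  (nablaN2 Y sX sn nn Vp ma mb)) (nablaN1 (lie X Y) sn Vp ma mb).
apply: etrans E _.
rewrite (xi_lie sX sY Vp) (et_lie sX sY Vp) (null_swapV oV sn Vp).
move: ('D_(X p) _ p) ('D_(X p) _ p) ('D_(Y p) _ p) ('D_(Y p) _ p) => k1 k2 k3 k4.
move: (e p)^-1 => ie; ring.
Qed.

Lemma normal_curvature_frame X1 X2 n1 n2 p : tangent_frame x V X1 X2 ->
  normal_frame x V n1 n2 ->
  (forall p, V p -> right_oriented (push x X1 p) (push x X2 p) (n1 p) (n2 p)) -> V p ->
  sdot (curvature (nablaN x) X1 X2 n2 p) (n1 p) = - frame_det p / e p ^+ 3.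
Proof.
move=> [s1 s2 tf] [sn1 sn2 nfr] ro Vp; have Up := VU Vp.
have no q : V q -> [/\ sdot (n1 q) (a q) = 0, sdot (n1 q) (b q) = 0,
    sdot (n2 q) (a q) = 0 & sdot (n2 q) (b q) = 0].
  by move=> Vq; have [H _ _ _] := nfr q Vq; rewrite dxi_app deta_app;
    have [? ?] := H (wxi R); have [? ?] := H (weta R).
have nn2 : normal_field n2 by move=> q /no[].
have [n1a n1b n2a n2b] := no p Vp.
rewrite (normal_curvature_ricci s1 s2 sn2 nn2 Vp n1a n1b).
have [t1 t2 t3] := tf p Vp; have [_ m1 m2 m3] := nfr p Vp; have := ro p Vp.
have [aa bb _] := nx Up; have e0 : sdot (a p) (b p) != 0 := metric_neq0 nx Up.
move=> pos.
have P1 := pushE sx X1 Up; have P2 := pushE sx X2 Up.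
have aux (c d n : space) s t : c = s *: a p + t *: b p -> sdot n (a p) = 0 -> sdot n (b p) = 0 ->
  sdot c n = 0.
  by move=> -> na nb; rewrite sdotDl !sdotZl !(sdotC _ n) na nb !mulr0 addr0.
have D1 := det_orthonormal t1 t2 t3 m1 m2 m3 (aux _ 0 _ _ _ P1 n1a n1b) (aux _ 0 _ _ _ P1 n2a n2b)
  (aux _ 0 _ _ _ P2 n1a n1b) (aux _ 0 _ _ _ P2 n2a n2b) pos.
have := @det_frame_null _ (a p) (b p) (A p) (B p) _ _ (n1 p) (n2 p) _ _ _ _ aa bb P1 P2.
rewrite !(sdotC (a p)) !(sdotC (b p)) => /(_ n1a n1b n2a n2b).
rewrite D1 mulr1 /frame_det => ->; rewrite /metric (sdotC (n2 p)) (sdotC (n2 p) (A p)).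
field; exact: e0.
Qed.

End Frames.
End NormalCurvature.

Section SmoothDet.
Variable R : realType.
Local Notation plane := 'rV[R]_2.
Variables (D : set plane) (oD : open D).

Lemma smooth_bigsum (I : Type) (r : seq I) (F : I -> plane -> R) :
  (forall i, smooth D (F i)) -> smooth D (fun p => \sum_(i <- r) F i p).
Proof.
move=> sF; elim: r => [|i r IH].
  by under eq_fun do rewrite big_nil; exact: smooth_cst.
by under eq_fun do rewrite big_cons; have E := smooth_add oD (sF i) IH; exact: E.
Qed.

Lemma smooth_bigprod (I : Type) (r : seq I) (F : I -> plane -> R) :
  (forall i, smooth D (F i)) -> smooth D (fun p => \prod_(i <- r) F i p).
Proof.
move=> sF; elim: r => [|i r IH].
  by under eq_fun do rewrite big_nil; exact: smooth_cst.
by under eq_fun do rewrite big_cons; have E := smooth_mul oD (sF i) IH; exact: E.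
Qed.

Lemma smooth_det n (M : plane -> 'M[R]_n) :
  (forall i j, smooth D (fun p => M p i j)) -> smooth D (fun p => \det (M p)).
Proof.
move=> sM.
have E (t : 'S_n) := smooth_mul oD (smooth_cst D ((-1) ^+ t : R))
  (smooth_bigprod (index_enum _) (fun i => sM i (t i))).
have E' := smooth_bigsum (index_enum _) E; rewrite /determinant.
exact: E'.
Qed.

Lemma smooth_adj n (M : plane -> 'M[R]_n) i j :
  (forall i j, smooth D (fun p => M p i j)) -> smooth D (fun p => (\adj (M p)) i j).
Proof.
move=> sM; under eq_fun do rewrite mxE /cofactor.
have sC k l : smooth D (fun p => row' j (col' i (M p)) k l).
  by under eq_fun do rewrite !mxE; exact: sM.
have E := smooth_mul oD (smooth_cst D ((-1) ^+ (j + i) : R)) (smooth_det sC).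
exact: E.
Qed.

Lemma smooth_frame (a b c d : plane -> 'rV[R]_4) i j : smooth D a -> smooth D b -> smooth D c ->
  smooth D d -> smooth D (fun p => frame (a p) (b p) (c p) (d p) i j).
Proof.
move=> sa sb sc sd; under eq_fun do rewrite mxE.
by elim/ord4P: i => /=; exact: smooth_entry.
Qed.

End SmoothDet.

Section NormalFrame.
Variable R : realType.
Local Notation space := 'rV[R]_4.

(** Orthonormalising the normal parts of [A] and [B] needs a square root of
[1/16 + m^2], and the Gram determinant of the frame provides one: it is
[s = det / (a.b)]. With this choice of root the orientation is right. *)
Lemma normal_frame_alg (a b A B : space) :
  sdot a a = 0 -> sdot b b = 0 -> sdot a b != 0 -> sdot A a = 0 -> sdot B b = 0 ->
  sdot A A = 4^-1 -> sdot B B = - 4^-1 ->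
  let r := sdot a b in let nA := nproj a b A in let nB := nproj a b B in
  let m := sdot nA nB in let s := \det (frame a b A B) / r in
  let n1 := (-2) *: nB in let n2 := (2 * s)^-1 *: (nA + (4 * m) *: nB) in
  [/\ s != 0, [/\ sdot n1 a = 0, sdot n1 b = 0, sdot n2 a = 0 & sdot n2 b = 0],
   sdot n1 n1 = -1 /\ sdot n2 n2 = 1, sdot n1 n2 = 0 &
   \det (frame (1 *: a + (- (2 * r)^-1) *: b) (1 *: a + (2 * r)^-1 *: b) n1 n2) = 1].
Proof.
move=> aa bb r0 Aa Bb AA BB r nA nB m s n1 n2.
have nAnA : sdot nA nA = 4^-1 by rewrite nproj_sdot // AA Aa; ring.
have nBnB : sdot nB nB = - 4^-1 by rewrite nproj_sdot // BB Bb; ring.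
have mE : m = sdot A B - sdot A b * sdot B a / r.
  by rewrite /m nproj_sdot // Aa Bb mul0r addr0.
have s2 : s ^+ 2 = 16^-1 + m ^+ 2.
  by rewrite /s expr_div_n det_frame_gram // -/r -mE; field; exact: r0.
have s0 : s != 0.
  have : 0 < s ^+ 2 by rewrite s2; have := sqr_ge0 m; lra.
  by apply: contraL => /eqP ->; rewrite expr0n /= ltxx.
have Aa' := nproj_orthl aa r0 A; have Ab' := nproj_orthr bb r0 A.
have Ba' := nproj_orthl aa r0 B; have Bb' := nproj_orthr bb r0 B.
have out v w : sdot w a = 0 -> sdot w b = 0 -> sdot (nproj a b v) w = sdot v w.
  by move=> wa wb; rewrite /nproj !sdotL (sdotC a w) (sdotC b w) wa wb !mulr0 !subr0.
have AnB : sdot A nB = m := esym (out A nB Ba' Bb').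
have AnA : sdot A nA = 4^-1 := etrans (esym (out A nA Aa' Ab')) nAnA.
have BnB : sdot B nB = - 4^-1 := etrans (esym (out B nB Ba' Bb')) nBnB.
have BnA : sdot B nA = m := etrans (esym (out B nA Aa' Ab')) (sdotC _ _).
have o1 : sdot n1 a = 0 by rewrite sdotZl Ba' mulr0.
have o2 : sdot n1 b = 0 by rewrite sdotZl Bb' mulr0.
have o3 : sdot n2 a = 0 by rewrite sdotZl sdotDl sdotZl Aa' Ba' !mulr0 addr0 mulr0.
have o4 : sdot n2 b = 0 by rewrite sdotZl sdotDl sdotZl Ab' Bb' !mulr0 addr0 mulr0.
have nBA : sdot nB nA = m by rewrite sdotC.
have s2' : 4^-1 + 4 * m ^+ 2 = 4 * s ^+ 2 by rewrite s2; field.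
have dot1 (w : space) : sdot w n1 = -2 * sdot w nB := sdotZr (-2) w nB.
have dot2 (w : space) : sdot w n2 = (2 * s)^-1 * (sdot w nA + 4 * m * sdot w nB).
  exact: etrans (sdotZr _ w (nA + (4 * m) *: nB))
    (congr1 _ (etrans (sdotDr w nA _) (congr1 _ (sdotZr _ w nB)))).
have nAnB : sdot nA nB = m by [].
have q1 : sdot n1 n1 = -1.
  by rewrite dot1 (sdotC n1) dot1 nBnB; field.
have q2 : sdot n2 n2 = 1.
  rewrite dot2 !(sdotC n2) !dot2 nAnA nBnB nBA nAnB.
  rewrite (_ : _ * _ = (4^-1 + 4 * m ^+ 2) / (4 * s ^+ 2)); last by field; exact: s0.
  by rewrite s2'; field; exact: s0.
have q3 : sdot n1 n2 = 0.
  by rewrite dot2 !(sdotC n1) !dot1 nBnB nAnB; field; exact: s0.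
split; [exact: s0|by split|by split|exact: q3|].
have dF0 : \det (frame a b A B) != 0.
  by apply: contraNneq s0; rewrite /s => ->; rewrite mul0r.
apply: (mulfI dF0); rewrite mulr1.
have E := @det_frame_null _ a b A B _ _ n1 n2 1 (- (2 * r)^-1) 1 (2 * r)^-1 aa bb
  (erefl _) (erefl _) (etrans (sdotC _ _) o1) (etrans (sdotC _ _) o2) (etrans (sdotC _ _) o3)
  (etrans (sdotC _ _) o4).
apply: etrans E _; rewrite !dot1 !dot2 AnB AnA BnB BnA -/r.
have -> : \det (frame a b A B) = s * r by rewrite /s divfK.
have fin (t z k : R) : t != 0 -> z != 0 -> 4^-1 + 4 * k ^+ 2 = 4 * z ^+ 2 ->
  - t ^+ 2 * (1 * (2 * t)^-1 - - (2 * t)^-1 * 1) *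
   (-2 * k * ((2 * z)^-1 * (k + 4 * k * - 4^-1)) -
    (2 * z)^-1 * (4^-1 + 4 * k * k) * (-2 * - 4^-1)) = z * t.
  move=> t0 z0 h; rewrite (_ : 4 * k * k = 4 * k ^+ 2) ?h; last by ring.
  by field; rewrite z0 t0.
exact: fin r0 s0 s2'.
Qed.

Local Notation plane := 'rV[R]_2.
Variables (x : plane -> space) (U : set plane).
Hypotheses (oU : open U) (nf : null_form x U).
Local Notation a := (dxi x).
Local Notation b := (deta x).
Local Notation A := (dxi (dxi x)).
Local Notation B := (deta (deta x)).
Local Notation e := (metric x).

Definition null_normal1 p : space := (-2) *: nproj (a p) (b p) (B p).
Definition null_normal2 p : space :=
  (2 * (frame_det x p / e p))^-1 *:
    (nproj (a p) (b p) (A p) +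
     (4 * sdot (nproj (a p) (b p) (A p)) (nproj (a p) (b p) (B p))) *: nproj (a p) (b p) (B p)).

Let sx : smooth U x. Proof. by case: nf. Qed.
Let nx : null_tangents x U. Proof. by case: nf. Qed.
Let sa : smooth U a. Proof. exact: smooth_dxi. Qed.
Let sb : smooth U b. Proof. exact: smooth_deta. Qed.
Let sA : smooth U A. Proof. exact: smooth_dxi. Qed.
Let sB : smooth U B. Proof. exact: smooth_deta. Qed.

Lemma smooth_nproj (f : plane -> space) : smooth U f ->
  smooth U (fun q => nproj (a q) (b q) (f q)).
Proof.
move=> sf; have ie := smooth_inv oU (smooth_metric oU sx) (metric_neq0 nx).
have H : smooth U (fun q => f q + (- (sdot (f q) (b q) * (e q)^-1)) *: a q
     + (- (sdot (f q) (a q) * (e q)^-1)) *: b q).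
  exact: (smooth_add oU (smooth_add oU sf
    (smooth_scale oU (smooth_opp oU (smooth_mul oU (smooth_sdot oU sf sb) ie)) sa))
    (smooth_scale oU (smooth_opp oU (smooth_mul oU (smooth_sdot oU sf sa) ie)) sb)).
by apply: (smooth_on oU) H => q _; rewrite /nproj !scaleNr.
Qed.

Lemma smooth_frame_det : smooth U (frame_det x).
Proof. by apply: (smooth_det oU) => i j; exact: smooth_frame. Qed.

Let alg p (Up : U p) := normal_frame_alg (let: And3 h _ _ := nx Up in h)
  (let: And3 _ h _ := nx Up in h) (metric_neq0 nx Up)
  (let: And4 h _ _ _ := null_dots oU nf Up in h) (let: And4 _ h _ _ := null_dots oU nf Up in h)
  (let: And4 _ _ h _ := null_dots oU nf Up in h) (let: And4 _ _ _ h := null_dots oU nf Up in h).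

Lemma null_normal_frame : normal_frame x U null_normal1 null_normal2.
Proof.
have snA := smooth_nproj sA; have snB := smooth_nproj sB.
have ie := smooth_inv oU (smooth_metric oU sx) (metric_neq0 nx).
have ss := smooth_mul oU (smooth_cst U (2 : R)) (smooth_mul oU smooth_frame_det ie).
split.
- exact: (smooth_scale oU (smooth_cst U (-2 : R)) snB).
- apply: (smooth_scale oU).
    apply: (smooth_inv oU ss) => p Up; have [s0 _ _ _ _] := alg Up.
    by rewrite mulf_neq0 // pnatr_eq0.
  exact: (smooth_add oU snA (smooth_scale oU (smooth_mul oU (smooth_cst U (4 : R))
    (smooth_sdot oU snA snB)) snB)).
move=> p Up; have [_ [h1 h2 h3 h4] [q1 q2] q3 _] := alg Up.
have aux (n c d : space) k l : sdot n c = 0 -> sdot n d = 0 -> sdot n (k *: c + l *: d) = 0.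
  by move=> nc nd; rewrite sdotDr !sdotZr nc nd !mulr0 addr0.
split; [|exact: q1|exact: q2|exact: q3].
move=> h; have E := derive_null h (smooth_diff sx Up).
by split; apply: etrans (congr1 (sdot _) E) _; apply: aux; [exact: h1|exact: h2|exact: h3|exact: h4].
Qed.

Lemma null_right_oriented p : U p -> right_oriented (push x (null_tangent1 x) p)
  (push x (null_tangent2 x) p) (null_normal1 p) (null_normal2 p).
Proof.
move=> Up; have [_ _ _ _ d] := alg Up.
rewrite /right_oriented.
have P1 := pushE sx (null_tangent1 x) Up; have P2 := pushE sx (null_tangent2 x) Up.
rewrite xi_null_field et_null_field in P1; rewrite xi_null_field et_null_field in P2.
change (0 < \det (frame (push x (null_tangent1 x) p) (push x (null_tangent2 x) p) (null_normal1 p) (null_normal2 p))).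
rewrite P1 P2; move: d; set X := frame _ _ _ _ => d.
by rewrite d ltr01.
Qed.

Lemma normal_curvatureE (kappa : plane -> R) : has_normal_curvature x U kappa <->
  forall p, U p -> kappa p = - frame_det x p / e p ^+ 3.
Proof.
split=> H.
  move=> p Up.
  rewrite (H U _ _ _ _ oU (@subset_refl _ U) (null_tangent_frame oU sx nx) null_normal_frame
     null_right_oriented p Up).
  exact: (normal_curvature_frame oU nf oU (@subset_refl _ U) (null_tangent_frame oU sx nx)
    null_normal_frame null_right_oriented Up).
move=> V X1 X2 n1 n2 oV VU tf nfr ro p Vp.
by rewrite (normal_curvature_frame oU nf oV VU tf nfr ro Vp) H //; exact: VU.
Qed.

End NormalFrame.

(** * Uniqueness *)

Section HasDerMatrix.
Variable R : realType.
Local Notation plane := 'rV[R]_2.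
Variables (p h : plane).

Lemma has_der_bigsum (I : Type) (r : seq I) (F : I -> plane -> R) (v : I -> R) :
  (forall i, has_der p h (F i) (v i)) ->
  has_der p h (fun q => \sum_(i <- r) F i q) (\sum_(i <- r) v i).
Proof.
move=> dF; elim: r => [|i r IH].
  rewrite big_nil; under eq_fun do rewrite big_nil.
  exact: has_der_cst.
rewrite big_cons; under eq_fun do rewrite big_cons.
by have E := has_der_add (dF i) IH; exact: E.
Qed.

Lemma has_der_mx m n (F : plane -> 'M[R]_(m, n)) (v : 'M[R]_(m, n)) :
  (forall i j, has_der p h (fun q => F q i j) (v i j)) -> has_der p h F v.
Proof.
move=> dF; have d : differentiable F p by apply: differentiable_mx => i j; case: (dF i j).
by split=> //; apply/matrixP => i j; rewrite derive_entry //; case: (dF i j).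
Qed.

Lemma has_der_entry m n (F : plane -> 'M[R]_(m, n)) (v : 'M[R]_(m, n)) i j :
  has_der p h F v -> has_der p h (fun q => F q i j) (v i j).
Proof.
by move=> [d <-]; split; [exact: differentiable_entry|rewrite derive_entry].
Qed.

Lemma has_der_mulmx m n k (F : plane -> 'M[R]_(m, n)) (G : plane -> 'M[R]_(n, k)) v w :
  has_der p h F v -> has_der p h G w ->
  has_der p h (fun q => F q *m G q) (v *m G p + F p *m w).
Proof.
move=> dF dG; apply: has_der_mx => i j.
have E := has_der_bigsum (index_enum _)
  (fun l => has_der_mul (has_der_entry i l dF) (has_der_entry l j dG)).
have e1 : (fun q => (F q *m G q) i j) = (fun q => \sum_l F q i l * G q l j).
  by apply/funext => q; rewrite mxE.
rewrite e1; apply: has_der_eq E _.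
by rewrite !mxE -big_split.
Qed.

Lemma has_der_uniq (W : normedModType R) (f : plane -> W) v w :
  has_der p h f v -> has_der p h f w -> v = w.
Proof. by move=> [_ <-] [_ <-]. Qed.

End HasDerMatrix.

Section IsometryOfFrames.
Variable R : fieldType.
Implicit Types (F G : 'M[R]_4) (w : 'rV[R]_4).

Lemma sdotEmx (u v : 'rV[R]_4) : sdot u v = (u *m Defs.eta R *m v^T) 0 0.
Proof. by []. Qed.

Lemma sdot_row w F j : (w *m Defs.eta R *m F^T) 0 j = sdot w (row j F).
Proof. by rewrite /sdot !mxE; apply: eq_bigr => k _; rewrite !mxE. Qed.

Variables F G S : 'M[R]_4.
Hypotheses (uF : F \in unitmx) (uG : G \in unitmx).
Hypothesis gram_eq : F *m Defs.eta R *m F^T = G *m Defs.eta R *m G^T.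
Hypothesis FS : F *m S = G.

Lemma frame_isometry_mx : S *m Defs.eta R *m S^T = Defs.eta R.
Proof.
have uFt : F^T \in unitmx by rewrite unitmx_tr.
have H : F *m (S *m Defs.eta R *m S^T) *m F^T = F *m Defs.eta R *m F^T.
  by rewrite gram_eq -FS (trmx_mul F S) !mulmxA.
by have := congr1 (fun M => invmx F *m M *m invmx F^T) H; rewrite !mulmxA !mulmxK // !mulVmx // !mul1mx.
Qed.

Lemma frame_isometry (u v : 'rV[R]_4) : sdot (u *m S) (v *m S) = sdot u v.
Proof. by rewrite !sdotEmx (trmx_mul v S) -!mulmxA (mulmxA S) (mulmxA (S *m _)) frame_isometry_mx. Qed.

(** A vector is determined by its scalar products with the members of a basis. *)
Lemma frame_isometry_char w w' :
  (forall j, sdot w (row j F) = sdot w' (row j G)) -> w *m S = w'.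
Proof.
move=> ww.
have uS : S \in unitmx by move: uG; rewrite -FS unitmx_mul uF.
have uE : Defs.eta R *m S^T \in unitmx.
  by rewrite unitmx_mul unitmx_tr uS andbT unitmxE det_eta unitr1.
have uFt : F^T \in unitmx by rewrite unitmx_tr.
have H : w *m Defs.eta R *m F^T = w' *m Defs.eta R *m G^T.
  by apply/rowP => j; rewrite !sdot_row.
have H2 : w *m Defs.eta R = w' *m Defs.eta R *m S^T.
  by rewrite -[LHS](mulmxK uFt) H -[in LHS]FS (trmx_mul F S) -!mulmxA mulmxV // mulmx1.
rewrite -[LHS](mulmxK uE) -[RHS](mulmxK uE); congr (_ *m _).
by rewrite -[LHS]mulmxA (mulmxA S) frame_isometry_mx H2 mulmxA.
Qed.

End IsometryOfFrames.

Section Structure.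
Variable R : realType.
Local Notation plane := 'rV[R]_2.
Local Notation space := 'rV[R]_4.
Variables (x : plane -> space) (U : set plane).
Hypotheses (oU : open U) (nf : null_form x U).
Local Notation a := (dxi x).
Local Notation b := (deta x).
Local Notation A := (dxi (dxi x)).
Local Notation B := (deta (deta x)).
Local Notation e := (metric x).
Let sx : smooth U x. Proof. by case: nf. Qed.
Let nx : null_tangents x U. Proof. by case: nf. Qed.
Let sa : smooth U a. Proof. exact: smooth_dxi. Qed.
Let sb : smooth U b. Proof. exact: smooth_deta. Qed.
Let sA : smooth U A. Proof. exact: smooth_dxi. Qed.
Let sB : smooth U B. Proof. exact: smooth_deta. Qed.

Definition null_frame p : 'M[R]_4 := frame (a p) (b p) (A p) (B p).

Lemma null_frame_unit p : U p -> null_frame p \in unitmx.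
Proof.
move=> Up; rewrite unitmxE unitfE; suff : frame_det x p ^+ 2 != 0 by rewrite expf_eq0.
rewrite (frame_det_sqr oU nf Up) mulf_eq0 negb_or expf_eq0 /= (metric_neq0 nx Up) /=.
by rewrite gt_eqF //; have := sqr_ge0 (mixed x p); lra.
Qed.

Definition gram_of (e e1 e2 e12 : R) : 'M[R]_4 :=
  \matrix_(i, j) nth 0 (nth [::]
    [:: [:: 0; e; 0; e2]; [:: e; 0; e1; 0]; [:: 0; e1; 4^-1; e12]; [:: e2; 0; e12; - 4^-1]] i) j.

Lemma null_frame_gram p : U p -> null_frame p *m Defs.eta R *m (null_frame p)^T =
  gram_of (e p) (dxi e p) (deta e p) (dxi (deta e) p).
Proof.
move=> Up; have [Aa Bb AA BB] := null_dots oU nf Up; have [aa bb _] := nx Up.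
rewrite (dxi_metric oU nf Up) (deta_metric oU nf Up) (dxi_deta_metric oU nf Up).
rewrite /metric; apply/matrixP => i j; rewrite frame_gram !mxE.
move: (a p) (b p) (A p) (B p) Aa Bb AA BB aa bb => a b A B Aa Bb AA BB aa bb.
by elim/ord4P: i; elim/ord4P: j => /=; rewrite ?aa ?bb ?Aa ?Bb ?AA ?BB //;
  rewrite sdotC ?Aa ?Bb.
Qed.

Lemma deta_A p : U p -> deta A p = 0.
Proof.
move=> Up; apply: etrans (null_swapV oU sa Up) _; rewrite dxi_app.
have C0 q : U q -> deta a q = 0.
  by move=> Uq; have [_ _ C0 _] := nf; apply: etrans (null_swapV oU sx Uq) (C0 q Uq).
have E := etrans (derive_on (wxi R) oU (g := fun=> 0) C0 Up)
  (derive_cst (0 : space) p (wxi R)).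
exact: E.
Qed.

Lemma derive_A p h : U p -> has_der p h A (xi h *: dxi A p).
Proof.
by move=> Up; apply: has_der_eq (has_der_null h sA Up) _; rewrite deta_A // scaler0 addr0.
Qed.

Lemma derive_B p h : U p -> has_der p h B (et h *: deta B p).
Proof.
by move=> Up; apply: has_der_eq (has_der_null h sB Up) _; rewrite (dxi_B oU nf) // scaler0 add0r.
Qed.

Let on (f g : plane -> R) p h v : (forall q, U q -> f q = g q) -> U p -> has_der p h f v ->
  'D_h g p = v.
Proof. by move=> fg Up [_ <-]; have E := derive_on h oU fg Up; exact: esym E. Qed.

(** Differentiate in [xi] the scalar products of [x_xixi] with the members of the
frame; of these only [x_xi] and [x_xixi] depend on [xi]. *)
Lemma dots_dxiA p : U p -> [/\ sdot (dxi A p) (a p) = - 4^-1,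
  sdot (dxi A p) (b p) = dxi (dxi e) p, sdot (dxi A p) (A p) = 0 &
  sdot (dxi A p) (B p) = dxi (dxi (deta e)) p].
Proof.
move=> Up; have dA := derive_A (wxi R) Up; have da := derive_a oU nf (wxi R) Up.
have db := derive_b nf (wxi R) Up; have dB := derive_B (wxi R) Up.
have D := null_dots oU nf; have [_ _ AA _] := D p Up.
have E1 := on (g := fun=> 0) (fun q Uq => let: And4 h _ _ _ := D q Uq in h) Up (has_der_sdot dA da).
have E2 := on (fun q Uq => esym (dxi_metric oU nf Uq)) Up (has_der_sdot dA db).
have E3 := on (g := fun=> 4^-1) (fun q Uq => let: And4 _ _ h _ := D q Uq in h) Up (has_der_sdot dA dA).
have E4 := on (fun q Uq => esym (dxi_deta_metric oU nf Uq)) Up (has_der_sdot dA dB).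
rewrite derive_cst in E1; rewrite derive_cst in E3; rewrite -dxi_app in E2; rewrite -dxi_app in E4.
move: E1 E2 E3 E4; rewrite xi_wxi et_wxi !scale1r !scale0r !sdot0r !addr0 AA.
rewrite [sdot (A p) (dxi A p)]sdotC => E1 -> E3 ->.
by split=> //; lra.
Qed.

(** Differentiate in [eta] the scalar products of [x_etaeta] with the members of
the frame; of these only [x_eta] and [x_etaeta] depend on [eta]. *)
Lemma dots_detaB p : U p -> [/\ sdot (deta B p) (a p) = deta (deta e) p,
  sdot (deta B p) (b p) = 4^-1, sdot (deta B p) (A p) = deta (dxi (deta e)) p &
  sdot (deta B p) (B p) = 0].
Proof.
move=> Up; have dA := derive_A (weta R) Up; have da := derive_a oU nf (weta R) Up.
have db := derive_b nf (weta R) Up; have dB := derive_B (weta R) Up.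
have D := null_dots oU nf; have [_ _ _ BB] := D p Up.
have E1 := on (fun q Uq => esym (deta_metric oU nf Uq)) Up (has_der_sdot dB da).
have E2 := on (g := fun=> 0) (fun q Uq => let: And4 _ h _ _ := D q Uq in h) Up (has_der_sdot dB db).
have E3 := on (fun q Uq => esym (dxi_deta_metric oU nf Uq)) Up (has_der_sdot dA dB).
have E4 := on (g := fun=> - 4^-1) (fun q Uq => let: And4 _ _ _ h := D q Uq in h) Up (has_der_sdot dB dB).
rewrite derive_cst in E2; rewrite derive_cst in E4; rewrite -deta_app in E1; rewrite -deta_app in E3.
move: E1 E2 E3 E4; rewrite xi_weta et_weta !scale1r !scale0r !sdot0r !sdot0l !addr0 !add0r BB.
rewrite [sdot (B p) (deta B p)]sdotC [sdot (A p) (deta B p)]sdotC => -> E2 -> E4.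
by split=> //; lra.
Qed.

Lemma derive_null_frame p h : U p -> has_der p h null_frame
  (frame (xi h *: A p) (et h *: B p) (xi h *: dxi A p) (et h *: deta B p)).
Proof.
move=> Up; apply: has_der_mx => i j; rewrite /null_frame /frame.
under eq_fun do rewrite mxE; rewrite mxE.
elim/ord4P: i => /=.
- exact: has_der_entry (derive_a oU nf h Up).
- exact: has_der_entry (derive_b nf h Up).
- exact: has_der_entry (derive_A h Up).
- exact: has_der_entry (derive_B h Up).
Qed.

(** The terms with [m^2] cancel, so the curvatures determine [e^4], and [e] is
negative. *)
Lemma curvatures_metric p : U p ->
  (- frame_det x p / e p ^+ 3) ^+ 2 - (- mixed x p / e p ^+ 2) ^+ 2 = (16 * e p ^+ 4)^-1.
Proof.
move=> Up; have e0 := metric_neq0 nx Up.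
rewrite expr_div_n sqrrN (frame_det_sqr oU nf Up) expr_div_n sqrrN; field; exact: e0.
Qed.

End Structure.

Section Uniqueness.
Variable R : realType.
Local Notation plane := 'rV[R]_2.
Local Notation space := 'rV[R]_4.
Variables (x y : plane -> space) (U : set plane).
Hypotheses (oU : open U) (cU : connected U) (nfx : null_form x U) (nfy : null_form y U).
Hypothesis metric_eq : forall p, U p -> metric x p = metric y p.
Hypothesis det_eq : forall p, U p -> frame_det x p = frame_det y p.

Let dxi_eq (f g : plane -> R) : (forall p, U p -> f p = g p) -> forall p, U p -> dxi f p = dxi g p.
Proof. by move=> fg p Up; rewrite !dxi_app; have E := derive_on (wxi R) oU fg Up; exact: E. Qed.
Let deta_eq (f g : plane -> R) : (forall p, U p -> f p = g p) -> forall p, U p -> deta f p = deta g p.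
Proof. by move=> fg p Up; rewrite !deta_app; have E := derive_on (weta R) oU fg Up; exact: E. Qed.

Let gram_eq p : U p -> null_frame x p *m Defs.eta R *m (null_frame x p)^T =
  null_frame y p *m Defs.eta R *m (null_frame y p)^T.
Proof.
move=> Up; rewrite (null_frame_gram oU nfx Up) (null_frame_gram oU nfy Up); congr gram_of.
- exact: metric_eq.
- exact: dxi_eq.
- exact: deta_eq.
- by apply: dxi_eq => // q; exact: deta_eq.
Qed.

Definition transition p : 'M[R]_4 := invmx (null_frame x p) *m null_frame y p.

Let FS p : U p -> null_frame x p *m transition p = null_frame y p.
Proof. by move=> Up; rewrite mulmxA mulmxV ?mul1mx //; exact: (null_frame_unit oU nfx Up). Qed.

(** The rows of the first frame are mapped to those of the second by definition.
The same holds for their derivatives, whose scalar products with the frames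
are the same expressions in the common metric. *)
Lemma transition_rows p : U p ->
  [/\ dxi x p *m transition p = dxi y p, deta x p *m transition p = deta y p,
   dxi (dxi x) p *m transition p = dxi (dxi y) p &
   deta (deta x) p *m transition p = deta (deta y) p] /\
  dxi (dxi (dxi x)) p *m transition p = dxi (dxi (dxi y)) p /\
  deta (deta (deta x)) p *m transition p = deta (deta (deta y)) p.
Proof.
move=> Up; have E i : nth 0 [:: dxi x p; deta x p; dxi (dxi x) p; deta (deta x) p] i *m transition p
    = nth 0 [:: dxi y p; deta y p; dxi (dxi y) p; deta (deta y) p] i :> space.
  have [i4|i4] := ltnP i 4; last by rewrite !nth_default // mul0mx.
  have := congr1 (row (Ordinal i4)) (FS Up); rewrite row_mul !rowK; exact.
split; first by split; [exact: (E 0%N)|exact: (E 1%N)|exact: (E 2%N)|exact: (E 3%N)].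
have uF := null_frame_unit oU nfx Up; have uG := null_frame_unit oU nfy Up.
have char := frame_isometry_char uF uG (gram_eq Up) (FS Up).
have dyx := dots_dxiA oU nfx Up; have dyy := dots_dxiA oU nfy Up.
have dex := dots_detaB oU nfx Up; have dey := dots_detaB oU nfy Up.
have e11 : dxi (dxi (metric x)) p = dxi (dxi (metric y)) p.
  by apply: dxi_eq => // q; exact: dxi_eq.
have e112 : dxi (dxi (deta (metric x))) p = dxi (dxi (deta (metric y))) p.
  by do 2!(apply: dxi_eq => // ? ?); exact: deta_eq.
have e22 : deta (deta (metric x)) p = deta (deta (metric y)) p.
  by apply: deta_eq => // q; exact: deta_eq.
have e122 : deta (dxi (deta (metric x))) p = deta (dxi (deta (metric y))) p.
  by apply: deta_eq => // q Uq; apply: dxi_eq => // r; exact: deta_eq.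
split; apply: char => j; rewrite !rowK; elim/ord4P: j => /=.
- by case: dyx dyy => -> _ _ _ [-> _ _ _].
- by case: dyx dyy => _ -> _ _ [_ -> _ _].
- by case: dyx dyy => _ _ -> _ [_ _ -> _].
- by case: dyx dyy => _ _ _ -> [_ _ _ ->].
- by case: dex dey => -> _ _ _ [-> _ _ _].
- by case: dex dey => _ -> _ _ [_ -> _ _].
- by case: dex dey => _ _ -> _ [_ _ -> _].
- by case: dex dey => _ _ _ -> [_ _ _ ->].
Qed.

Lemma smooth_transition : smooth U transition.
Proof.
have sfr z (nz : null_form z U) i j : smooth U (fun p => null_frame z p i j).
  have [sz _ _ _] := nz; have s1 := smooth_dxi sz; have s2 := smooth_deta sz.
  exact: (smooth_frame oU i j s1 s2 (smooth_dxi s1) (smooth_deta s2)).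
have d0 p : U p -> \det (null_frame x p) != 0.
  by move=> /(null_frame_unit oU nfx); rewrite unitmxE unitfE.
have sd := smooth_inv oU (smooth_det oU (sfr x nfx)) d0.
apply: (smooth_mx oU) => i j.
have E := smooth_bigsum oU (index_enum _) (fun k => smooth_mul oU
  (smooth_mul oU sd (smooth_adj oU i k (sfr x nfx))) (sfr y nfy k j)).
apply: (smooth_on oU) E => p Up; rewrite [RHS]mxE; apply: eq_bigr => k _; congr (_ * _).
by rewrite /invmx (null_frame_unit oU nfx Up) [RHS]mxE.
Qed.

(** Differentiating [F_x S = F_y] and using that [S] also takes the derivative of
[F_x] to that of [F_y] leaves [F_x S' = 0]. *)
Lemma derive_transition p h : U p -> 'D_h transition p = 0.
Proof.
move=> Up; have uF := null_frame_unit oU nfx Up.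
have dS := has_der_smooth h smooth_transition Up.
have E := has_der_on oU (fun q Uq => esym (FS Uq)) Up
  (has_der_mulmx (derive_null_frame oU nfx h Up) dS).
have := has_der_uniq (derive_null_frame oU nfy h Up) E.
have [[r1 r2 r3 r4] [r5 r6]] := transition_rows Up.
have -> : frame (xi h *: dxi (dxi y) p) (et h *: deta (deta y) p)
     (xi h *: dxi (dxi (dxi y)) p) (et h *: deta (deta (deta y)) p) =
   frame (xi h *: dxi (dxi x) p) (et h *: deta (deta x) p)
     (xi h *: dxi (dxi (dxi x)) p) (et h *: deta (deta (deta x)) p) *m transition p.
  apply/row_matrixP => i; rewrite row_mul !rowK.
  by elim/ord4P: i => /=; rewrite -scalemxAl ?r3 ?r4 ?r5 ?r6.
move=> /eqP; rewrite eq_sym -subr_eq0 addrAC subrr add0r => /eqP H.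
by have := congr1 (mulmx (invmx (null_frame x p))) H; rewrite mulmx0 mulKmx.
Qed.

Theorem null_form_unique t0 : U t0 -> exists (M : 'M[R]_4) (c : space),
  in_SO22 M /\ forall p, U p -> y p = x p *m M + c.
Proof.
move=> Ut0; pose M := transition t0.
have uF := null_frame_unit oU nfx Ut0; have uG := null_frame_unit oU nfy Ut0.
have tr_const p : U p -> transition p = M.
  move=> Up; apply/matrixP => i j.
  apply: (connected_const (f := fun q => transition q i j) oU cU _ _ Ut0 Up).
    by move=> q Uq; apply: differentiable_entry; exact: smooth_diff smooth_transition Uq.
  move=> q h Uq; have E := has_der_entry i j (has_der_smooth h smooth_transition Uq).
  by apply: etrans E.2 _; rewrite derive_transition // mxE.
have [sx _ _ _] := nfx; have [sy _ _ _] := nfy.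
have dz p h : U p -> has_der p h (fun q => y q - x q *m M) 0.
  move=> Up; have [[r1 r2 _ _] _] := transition_rows Up.
  have d1 := has_der_mulmx (has_der_null h sx Up) (has_der_cst p h M).
  apply: has_der_eq (has_der_add (has_der_null h sy Up) (has_der_opp d1)) _.
  by rewrite mulmx0 addr0 mulmxDl -!scalemxAl -(tr_const p Up) r1 r2 subrr.
exists M, (y t0 - x t0 *m M); split.
  split; first exact: frame_isometry uF (gram_eq Ut0) (FS Ut0).
  have := congr1 determinant (FS Ut0); rewrite det_mulmx -[RHS](det_eq Ut0).
  rewrite /frame_det -/(null_frame x t0) => H.
  have d0 : \det (null_frame x t0) != 0 by move: uF; rewrite unitmxE unitfE.
  by apply: (mulfI d0); rewrite mulr1.
move=> p Up; suff -> : y t0 - x t0 *m M = y p - x p *m M by rewrite addrC subrK.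
apply/rowP => j.
apply: (connected_const (f := fun q => (y q - x q *m M) 0 j) oU cU _ _ Up Ut0).
  by move=> q Uq; have [d _] := has_der_entry 0 j (dz q 0 Uq).
by move=> q h Uq; have [_ ->] := has_der_entry 0 j (dz q h Uq); rewrite mxE.
Qed.

End Uniqueness.

Lemma metric_of_curvatures (R : realType) (r s : R) : r < 0 -> s < 0 ->
  (16 * r ^+ 4)^-1 = (16 * s ^+ 4)^-1 -> r = s.
Proof.
move=> r0 s0 /invr_inj H.
have H4 : r ^+ 4 = s ^+ 4 by apply: (@mulfI _ 16) => //; rewrite pnatr_eq0.
have : (r + s) * (r ^+ 2 + s ^+ 2) * (r - s) = 0.
  have -> : (r + s) * (r ^+ 2 + s ^+ 2) * (r - s) = r ^+ 4 - s ^+ 4 by ring.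
  by rewrite H4 subrr.
have h1 : r + s != 0 by rewrite lt_eqF //; lra.
have h2 : r ^+ 2 + s ^+ 2 != 0.
  by rewrite gt_eqF // ltr_pwDl // ?sqr_ge0 // exprn_even_gt0 //= lt_eqF.
by move/eqP; rewrite !mulf_eq0 (negPf h1) (negPf h2) /= subr_eq0 => /eqP.
Qed.

Theorem canonical_unique (R : realType) (U : set 'rV[R]_2) (x y : 'rV[R]_2 -> 'rV[R]_4)
    (K kappa : 'rV[R]_2 -> R) t0 : is_domain U -> U t0 ->
  canonical_third_type_minimal_surface x U ->
  has_gauss_curvature x U K -> has_normal_curvature x U kappa ->
  canonical_third_type_minimal_surface y U ->
  has_gauss_curvature y U K -> has_normal_curvature y U kappa ->
  exists (M : 'M[R]_4) (c : 'rV[R]_4), in_SO22 M /\ forall p, U p -> y p = x p *m M + c.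
Proof.
move=> [oU cU] Ut0 /canonical_null_form nfx Kx kx /canonical_null_form nfy Ky ky.
have [sx nx _ _] := nfx; have [sy ny _ _] := nfy.
move: Kx Ky kx ky => /(gauss_curvatureE oU sx nx) Kx /(gauss_curvatureE oU sy ny) Ky
  /(normal_curvatureE oU nfx) kx /(normal_curvatureE oU nfy) ky.
have me p : U p -> metric x p = metric y p.
  move=> Up; have [_ _ ex] := nx p Up; have [_ _ ey] := ny p Up.
  apply: metric_of_curvatures ex ey _.
  have E1 := curvatures_metric oU nfx Up; have E2 := curvatures_metric oU nfy Up.
  by apply: etrans (esym E1) (etrans _ E2); rewrite -Kx // -Ky // -kx // -ky.
apply: (null_form_unique oU cU nfx nfy me _ Ut0) => p Up.
have e0 := metric_neq0 ny Up.
have := etrans (esym (kx p Up)) (ky p Up); rewrite (me p Up) => H.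
have e3 : (metric y p ^+ 3)^-1 != 0 by rewrite invr_eq0 expf_eq0.
by apply: oppr_inj; exact: (mulIf e3 H).
Qed.

(** * Integration along null lines *)

Section Antiderivative.
Variable R : realType.

(** The integral from the left end of the interval. *)
Lemma antiderivative (g : R -> R) (c d : R) :
  (forall z, c - d <= z <= c + d -> {for z, continuous g}) ->
  exists G : R -> R, forall z, c - d < z < c + d -> is_derive z 1 G (g z).
Proof.
move=> cg; pose mu := @lebesgue_measure R.
have cgw : {within `[c - d, c + d], continuous g}.
  by apply: continuous_in_subspaceT => z; rewrite inE /= in_itv /=; exact: cg.
have ig : mu.-integrable `[c - d, c + d] (EFin \o g).
  by apply: continuous_compact_integrable => //; exact: segment_compact.
exists (fun z => \int[mu]_(t in `[c - d, z]) g t)%R => z /andP[z1 z2].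
have cz : {for z, continuous g} by apply: cg; rewrite !ltW.
have [dG eG] := continuous_FTC1_closed z2 ig z1 cz.
by split; [exact: dG|rewrite -derive1E].
Qed.

End Antiderivative.

Section NullProjections.
Variable R : realType.
Local Notation plane := 'rV[R]_2.
Local Notation space := 'rV[R]_4.
Implicit Types (p h q : plane).

Lemma has_der_id p h : has_der p h (fun q => q) h.
Proof. by split; [exact: ex_diff|exact: derive_id]. Qed.

Lemma xi_comb (s t : R) : xi (s *: wxi R + t *: weta R) = s.
Proof. by rewrite /xi !mxE /=; field. Qed.
Lemma xi_Zwxi (s : R) : xi (s *: wxi R) = s.
Proof. by rewrite /xi !mxE /=; field. Qed.
Lemma et_Zwxi (s : R) : et (s *: wxi R) = 0.
Proof. by rewrite /et !mxE /=; field. Qed.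
Lemma xi_Zweta (s : R) : xi (s *: weta R) = 0.
Proof. by rewrite /xi !mxE /=; field. Qed.
Lemma et_Zweta (s : R) : et (s *: weta R) = s.
Proof. by rewrite /et !mxE /=; field. Qed.

Variable t0 : plane.

Definition xi_mx : 'M[R]_2 := \matrix_(i < 2) (xi (unitv R i) *: wxi R).
Definition et_mx : 'M[R]_2 := \matrix_(i < 2) (et (unitv R i) *: weta R).

Lemma mul_xi_mx p : p *m xi_mx = xi p *: wxi R.
Proof.
rewrite mulmx_sum_row sum2 !rowK !scalerA -scalerDl; congr (_ *: _).
by rewrite /xi !mxE /=; ring.
Qed.

Lemma mul_et_mx p : p *m et_mx = et p *: weta R.
Proof.
rewrite mulmx_sum_row sum2 !rowK !scalerA -scalerDl; congr (_ *: _).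
by rewrite /et !mxE /=; ring.
Qed.

(** The projection along [weta] onto the null line through [t0] on which [eta] is
constant. It replaces the restriction to that line: a function of [xi] alone
is one that is not changed by composition with it. *)
Definition proj_xi p := p *m xi_mx + et t0 *: weta R.
(** The projection along [wxi] onto the null line through [t0] on which [xi] is
constant. *)
Definition proj_et p := p *m et_mx + xi t0 *: wxi R.

Lemma proj_xiE p : proj_xi p = xi p *: wxi R + et t0 *: weta R.
Proof. by rewrite /proj_xi mul_xi_mx. Qed.

Lemma proj_etE p : proj_et p = xi t0 *: wxi R + et p *: weta R.
Proof. by rewrite /proj_et mul_et_mx addrC. Qed.

Lemma proj_xi_et p : proj_xi (proj_et p) = t0.
Proof. by rewrite proj_xiE proj_etE xi_comb -null_basis. Qed.

Lemma proj_etB p : proj_et p - p = (xi t0 - xi p) *: wxi R.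
Proof. by rewrite proj_etE {2}(null_basis p) opprD addrACA subrr addr0 -scalerBl. Qed.

Lemma proj_xiB p : proj_xi p - p = (et t0 - et p) *: weta R.
Proof. have {2}-> := null_basis p; rewrite proj_xiE opprD addrACA subrr add0r.
by rewrite -scalerBl. Qed.

Lemma ball2 p (r : R) q : 0 < r ->
  ball p r q <-> `|p 0 0 - q 0 0| < r /\ `|p 0 1 - q 0 1| < r.
Proof.
move=> r0; split=> [[_ H]|[H0 H1]]; first by split; exact: H.
by split=> // i j; rewrite [i]ord1; elim/ord2P: j.
Qed.

Lemma ball_gt0 p (r : R) q : ball p r q -> 0 < r.
Proof. by case. Qed.

Lemma ball_proj_xi r p : ball t0 r p -> ball t0 r (proj_xi p).
Proof.
move=> Bp; have r0 := ball_gt0 Bp; have /(ball2 _ _ r0) := Bp.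
rewrite !ltr_norml => -[/andP[h1 h2] /andP[h3 h4]].
by apply/(ball2 _ _ r0); rewrite !ltr_norml proj_xiE /xi /et !mxE /=; lra.
Qed.

Lemma ball_proj_et r p : ball t0 r p -> ball t0 r (proj_et p).
Proof.
move=> Bp; have r0 := ball_gt0 Bp; have /(ball2 _ _ r0) := Bp.
rewrite !ltr_norml => -[/andP[h1 h2] /andP[h3 h4]].
by apply/(ball2 _ _ r0); rewrite !ltr_norml proj_etE /xi /et !mxE /=; lra.
Qed.

Variable r : R.
Local Notation W := (ball t0 r).

Let oW : open W. Proof. exact: ball_open. Qed.

Lemma has_der_proj_xi (V : normedModType R) (f : plane -> V) p h : smooth W f -> W p ->
  has_der p h (fun q => f (proj_xi q)) (xi h *: dxi f (proj_xi p)).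
Proof.
move=> sf Wp; have d := smooth_diff sf (ball_proj_xi Wp).
have [d1 E] := derive_affine h d; split; first exact: d1.
apply: etrans E _; rewrite (mul_xi_mx h).
have E' := derive_null (xi h *: wxi R) d; apply: etrans E' _.
by rewrite xi_Zwxi et_Zwxi scale0r addr0.
Qed.

Lemma has_der_proj_et (V : normedModType R) (f : plane -> V) p h : smooth W f -> W p ->
  has_der p h (fun q => f (proj_et q)) (et h *: deta f (proj_et p)).
Proof.
move=> sf Wp; have d := smooth_diff sf (ball_proj_et Wp).
have [d1 E] := derive_affine h d; split; first exact: d1.
apply: etrans E _; rewrite (mul_et_mx h).
have E' := derive_null (et h *: weta R) d; apply: etrans E' _.
by rewrite xi_Zweta et_Zweta scale0r add0r.
Qed.

Lemma smooth_proj_xi (V : normedModType R) (f : plane -> V) : smooth W f ->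
  smooth W (fun q => f (proj_xi q)).
Proof. by move=> sf; apply: (smooth_affine oW sf) => p; exact: ball_proj_xi. Qed.

Lemma smooth_proj_et (V : normedModType R) (f : plane -> V) : smooth W f ->
  smooth W (fun q => f (proj_et q)).
Proof. by move=> sf; apply: (smooth_affine oW sf) => p; exact: ball_proj_et. Qed.

Lemma const_along_xi (f : plane -> R) p : smooth W f -> (forall q, W q -> dxi f q = 0) ->
  W p -> f (proj_et p) = f p.
Proof.
move=> sf f0 Wp.
have S s : 0 <= s <= 1 -> W (p + s *: (proj_et p - p)).
  by move=> s01; apply: ball_segment => //; exact: ball_proj_et.
have <- : p + (proj_et p - p) = proj_et p by rewrite addrC subrK.
apply: line_const => s /S Ws; first exact: smooth_diff sf Ws.
have E := derive_null (proj_et p - p) (smooth_diff sf Ws); apply: etrans E _.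
by rewrite f0 // proj_etB et_Zwxi scale0r scaler0 addr0.
Qed.

Lemma const_along_eta (f : plane -> R) p : smooth W f -> (forall q, W q -> deta f q = 0) ->
  W p -> f (proj_xi p) = f p.
Proof.
move=> sf f0 Wp.
have S s : 0 <= s <= 1 -> W (p + s *: (proj_xi p - p)).
  by move=> s01; apply: ball_segment => //; exact: ball_proj_xi.
have <- : p + (proj_xi p - p) = proj_xi p by rewrite addrC subrK.
apply: line_const => s /S Ws; first exact: smooth_diff sf Ws.
have E := derive_null (proj_xi p - p) (smooth_diff sf Ws); apply: etrans E _.
by rewrite f0 // proj_xiB xi_Zweta scale0r scaler0 addr0.
Qed.

Lemma ball_half p : 0 < r -> ball t0 (r / 2) p -> [/\ W p, xi t0 - r < xi p < xi t0 + r &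
  et t0 - r < et p < et t0 + r].
Proof.
move=> r0 Bp; have r20 := ball_gt0 Bp; have /(ball2 _ _ r20) := Bp.
rewrite !ltr_norml => -[/andP[h1 h2] /andP[h3 h4]]; split.
- by apply/(ball2 _ _ r0); rewrite !ltr_norml; lra.
- by rewrite /xi; lra.
- by rewrite /et; lra.
Qed.

(** [f] is a function of [xi] alone, so it is enough to integrate it along one
null line. The smaller ball keeps the segment of integration inside the ball
on which [f] is smooth. *)
Lemma antiderivative_xi (f : plane -> R) : 0 < r -> smooth W f ->
  (forall q, W q -> deta f q = 0) ->
  exists F : plane -> R, forall p h, ball t0 (r / 2) p -> has_der p h F (xi h * f p).
Proof.
move=> r0 sf f0.
pose g z := f (t0 + (z - xi t0) *: wxi R).
have Wz z : xi t0 - r <= z <= xi t0 + r -> W (t0 + (z - xi t0) *: wxi R).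
  by move=> zr; apply/(ball2 _ _ r0); rewrite !ltr_norml !mxE /=; lra.
have [|G dG] := @antiderivative _ g (xi t0) r.
  move=> z zr; have df := smooth_diff sf (Wz z zr).
  have [d _] := is_derive_line df; apply: differentiable_continuous.
  have /derivable1_diffP d' := d.
  have d2 : differentiable (fun z : R => z - xi t0) z by exact: differentiableB.
  have E := differentiable_comp d2 d'; exact: E.
exists (fun p => G (xi p)) => p h Bp; have [Wp zp _] := ball_half r0 Bp.
have dx : has_der p h (@xi R) (xi h) := has_der_xi (has_der_id p h).
have [d1 E] := derive_comp1 h (dG _ zp) dx.1.
split; first exact: d1.
rewrite E dx.2 mulrC /g; congr (_ * _).
rewrite -(const_along_eta sf f0 Wp); congr (f _).
have aux (a b c d : plane) : d = a + b -> c + b = d + (c - a).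
  by move=> ->; apply/rowP => i; rewrite !mxE; ring.
rewrite proj_xiE (scalerBl (xi p) (xi t0)); symmetry; apply: aux; exact: null_basis.
Qed.

Lemma antiderivative_eta (f : plane -> R) : 0 < r -> smooth W f ->
  (forall q, W q -> dxi f q = 0) ->
  exists F : plane -> R, forall p h, ball t0 (r / 2) p -> has_der p h F (et h * f p).
Proof.
move=> r0 sf f0.
pose g z := f (t0 + (z - et t0) *: weta R).
have Wz z : et t0 - r <= z <= et t0 + r -> W (t0 + (z - et t0) *: weta R).
  by move=> zr; apply/(ball2 _ _ r0); rewrite !ltr_norml !mxE /=; lra.
have [|G dG] := @antiderivative _ g (et t0) r.
  move=> z zr; have df := smooth_diff sf (Wz z zr).
  have [d _] := is_derive_line df; apply: differentiable_continuous.
  have /derivable1_diffP d' := d.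
  have d2 : differentiable (fun z : R => z - et t0) z by exact: differentiableB.
  have E := differentiable_comp d2 d'; exact: E.
exists (fun p => G (et p)) => p h Bp; have [Wp _ zp] := ball_half r0 Bp.
have dx : has_der p h (@et R) (et h) := has_der_et (has_der_id p h).
have [d1 E] := derive_comp1 h (dG _ zp) dx.1.
split; first exact: d1.
rewrite E dx.2 mulrC /g; congr (_ * _).
rewrite -(const_along_xi sf f0 Wp); congr (f _).
have aux (a b c d : plane) : d = a + b -> a + c = d + (c - b).
  by move=> ->; apply/rowP => i; rewrite !mxE; ring.
rewrite proj_etE (scalerBl (et p) (et t0)); symmetry; apply: aux; exact: null_basis.
Qed.

End NullProjections.

(** * Factorisation of solutions of the Liouville equation *)

Section Factorisation.
Variable R : realType.
Local Notation plane := 'rV[R]_2.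
Local Notation space := 'rV[R]_4.
Implicit Types (p h q : plane).

Lemma has_der_dxi (V : normedModType R) D (f : plane -> V) p : smooth D f -> D p ->
  has_der p (wxi R) f (dxi f p).
Proof. by move=> sf Dp; rewrite dxi_app; exact: has_der_smooth sf Dp. Qed.

Lemma has_der_deta (V : normedModType R) D (f : plane -> V) p : smooth D f -> D p ->
  has_der p (weta R) f (deta f p).
Proof. by move=> sf Dp; rewrite deta_app; exact: has_der_smooth sf Dp. Qed.

Lemma dxi_val (V : normedModType R) (f : plane -> V) p v : has_der p (wxi R) f v -> dxi f p = v.
Proof. by rewrite dxi_app => -[]. Qed.

Lemma deta_val (V : normedModType R) (f : plane -> V) p v : has_der p (weta R) f v -> deta f p = v.
Proof. by rewrite deta_app => -[]. Qed.

(** Smoothness is one order better than that of the two partial derivatives. *)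
Lemma smooth_of_der U (x a b : plane -> space) : open U -> smooth U a -> smooth U b ->
  (forall p h, U p -> has_der p h x (xi h *: a p + et h *: b p)) ->
  [/\ smooth U x, forall p, U p -> dxi x p = a p & forall p, U p -> deta x p = b p].
Proof.
move=> oU sa sb dx; split.
- case=> // n; split; first by move=> p Up; case: (dx p 0 Up).
  move=> h; have S := smooth_add oU (smooth_scale oU (smooth_cst U (xi h)) sa)
    (smooth_scale oU (smooth_cst U (et h)) sb).
  by apply: (times_differentiable_on oU) (S n) => p Up; case: (dx p h Up).
- by move=> p Up; rewrite (dxi_val (dx p _ Up)) xi_wxi et_wxi scale1r scale0r addr0.
- by move=> p Up; rewrite (deta_val (dx p _ Up)) xi_weta et_weta scale1r scale0r add0r.
Qed.

Variables (t0 : plane) (r : R) (r0 : 0 < r).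
Local Notation W := (ball t0 r).
Let oW : open W. Proof. exact: ball_open. Qed.

(** The form [a dxi + b deta] is the sum of two forms of one variable. *)
Lemma exact_null_form (a b : plane -> space) : smooth W a -> smooth W b ->
  (forall p, W p -> deta a p = 0) -> (forall p, W p -> dxi b p = 0) ->
  exists x : plane -> space, forall p h, ball t0 (r / 2) p ->
    has_der p h x (xi h *: a p + et h *: b p).
Proof.
move=> sa sb a0 b0.
have HF i : exists F : plane -> R, forall p h, ball t0 (r / 2) p ->
    has_der p h F (xi h * a p 0 i).
  apply: (antiderivative_xi r0 (smooth_entry 0 i oW sa)) => q Wq.
  rewrite (deta_val (has_der_entry 0 i (has_der_deta sa Wq))) a0 //; exact: mxE.
have HG i : exists G : plane -> R, forall p h, ball t0 (r / 2) p ->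
    has_der p h G (et h * b p 0 i).
  apply: (antiderivative_eta r0 (smooth_entry 0 i oW sb)) => q Wq.
  rewrite (dxi_val (has_der_entry 0 i (has_der_dxi sb Wq))) b0 //; exact: mxE.
have [F dF] := choice HF; have [G dG] := choice HG.
exists (fun p => \row_i (F i p + G i p)) => p h Bp; apply: has_der_mx => i j.
rewrite !mxE; under eq_fun do rewrite mxE.
by rewrite [i]ord1; have E := has_der_add (dF j p h Bp) (dG j p h Bp); exact: E.
Qed.

Local Notation pxi := (proj_xi t0).
Local Notation pet := (proj_et t0).

Lemma dxi_proj (f : plane -> R) p : smooth W f -> W p ->
  has_der p (wxi R) (fun q => f (pxi q)) (dxi f (pxi p)).
Proof.
by move=> sf Wp; have := has_der_proj_xi (wxi R) sf Wp; rewrite xi_wxi scale1r.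
Qed.

Lemma deta_proj (f : plane -> R) p : smooth W f -> W p ->
  has_der p (weta R) (fun q => f (pet q)) (deta f (pet p)).
Proof.
by move=> sf Wp; have := has_der_proj_et (weta R) sf Wp; rewrite et_weta scale1r.
Qed.

Lemma dxi_pet (f : plane -> R) p : smooth W f -> W p ->
  has_der p (wxi R) (fun q => f (pet q)) 0.
Proof.
by move=> sf Wp; have := has_der_proj_et (wxi R) sf Wp; rewrite et_wxi scale0r.
Qed.

Lemma deta_pxi (f : plane -> R) p : smooth W f -> W p ->
  has_der p (weta R) (fun q => f (pxi q)) 0.
Proof.
by move=> sf Wp; have := has_der_proj_xi (weta R) sf Wp; rewrite xi_weta scale0r.
Qed.

Variables (psi : plane -> R) (d : R).
Hypotheses (spsi : smooth W psi) (psi0 : forall p, W p -> psi p != 0) (d0 : d != 0).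
Hypothesis wronskian : forall p, W p ->
  psi p * dxi (deta psi) p - dxi psi p * deta psi p = d.
Local Notation psi1 := (dxi psi).
Local Notation psi2 := (deta psi).
Local Notation psi12 := (dxi (deta psi)).
Local Notation psi11 := (dxi (dxi psi)).
Let s1 : smooth W psi1. Proof. exact: smooth_dxi. Qed.
Let s2 : smooth W psi2. Proof. exact: smooth_deta. Qed.
Let s12 : smooth W psi12. Proof. exact: smooth_dxi. Qed.
Let s11 : smooth W psi11. Proof. exact: smooth_dxi. Qed.

(** The derivative in [xi] of the constant [wronskian]. *)
Lemma psi_prolongation p : W p -> psi p * dxi psi12 p = psi11 p * psi2 p.
Proof.
move=> Wp.
have E := has_der_add (has_der_mul (has_der_dxi spsi Wp) (has_der_dxi s12 Wp))
  (has_der_opp (has_der_mul (has_der_dxi s1 Wp) (has_der_dxi s2 Wp))).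
have z := has_der_uniq (has_der_on oW (g := fun=> d) wronskian Wp (has_der_cst _ _ _)) E.
by apply/eqP; rewrite -subr_eq0; apply/eqP; rewrite {}[RHS]z; ring.
Qed.

Lemma deta_psi11 p : W p -> deta psi11 p = dxi psi12 p.
Proof.
move=> Wp; apply: etrans (null_swap oW s1 Wp) _; rewrite !dxi_app.
have E := derive_on (wxi R) oW (fun q Wq => null_swap oW spsi Wq) Wp; exact: E.
Qed.

(** The derivative in [eta] of [psi11 / psi] vanishes by [psi_prolongation]. So
all the functions [psi(., eta)] solve one linear equation of order two in [xi]. *)
Lemma psi_ode p : W p -> psi11 (pxi p) * psi p = psi11 p * psi (pxi p).
Proof.
move=> Wp; have Wx := ball_proj_xi Wp.
have si := smooth_inv oW spsi psi0; have ss := smooth_mul oW s11 si.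
have H := const_along_eta ss _ Wp.
have : psi11 (pxi p) * (psi (pxi p))^-1 = psi11 p * (psi p)^-1.
  apply: H => q Wq.
  have E := has_der_mul (has_der_deta s11 Wq) (has_der_inv (has_der_deta spsi Wq) (psi0 Wq)).
  rewrite (deta_val E) deta_psi11 //.
  have := psi_prolongation Wq; have := psi0 Wq.
  move: (psi q) (dxi psi12 q) (psi11 q) (psi2 q) => f f1 f2 f3 f0 e.
  have -> : f1 / f + f2 * (- (f3 / f ^+ 2)) = (f * f1 - f2 * f3) / f ^+ 2 by field.
  by rewrite e subrr mul0r.
have p1 := psi0 Wp; have p2 := psi0 Wx.
move=> e; rewrite -[psi11 (pxi p)](divfK p2) e; field; exact: p1.
Qed.

(** On the line through [t0] the functions [psi] and [psi2] of [xi] are two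
solutions of the linear equation of [psi_ode], with Wronskian [d]. The functions
[factor_eta2] and [- factor_eta1] of [eta] are the coordinates of [psi(., eta)]
in this basis. *)
Definition factor_xi1 q := psi (pxi q).
Definition factor_xi2 q := psi2 (pxi q).
Definition factor_eta1 q := (psi1 t0 * psi (pet q) - psi t0 * psi1 (pet q)) / d.
Definition factor_eta2 q := (psi12 t0 * psi (pet q) - psi2 t0 * psi1 (pet q)) / d.

(** The coordinates of [psi(., eta)] in the basis of the solutions [factor_xi1] and
[factor_xi2] are quotients of Wronskians by [d]. Wronskians of solutions do not
depend on [xi], so they may be evaluated on the line [xi = xi(t0)]. *)
Lemma factorisation p : W p ->
  factor_xi1 p * factor_eta2 p - factor_xi2 p * factor_eta1 p = psi p.
Proof.
move=> Wp; have Wx := ball_proj_xi Wp.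
pose al q := psi q * psi12 (pxi q) - psi1 q * psi2 (pxi q).
pose be q := psi q * psi1 (pxi q) - psi1 q * psi (pxi q).
have sx (f : plane -> R) : smooth W f -> smooth W (fun q => f (pxi q)).
  exact: smooth_proj_xi.
have sal : smooth W al.
  have E := smooth_add oW (smooth_mul oW spsi (sx _ s12))
    (smooth_opp oW (smooth_mul oW s1 (sx _ s2))).
  exact: E.
have sbe : smooth W be.
  have E := smooth_add oW (smooth_mul oW spsi (sx _ s1))
    (smooth_opp oW (smooth_mul oW s1 (sx _ spsi))).
  exact: E.
have al0 : al (pet p) = al p.
  apply: (const_along_xi sal _ Wp) => q Wq; have Wxq := ball_proj_xi Wq.
  have E := has_der_add (has_der_mul (has_der_dxi spsi Wq) (dxi_proj s12 Wq))
    (has_der_opp (has_der_mul (has_der_dxi s1 Wq) (dxi_proj s2 Wq))).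
  rewrite (dxi_val E); have := psi_prolongation Wxq; have := psi_ode Wq; have := psi0 Wxq.
  move: (psi q) (psi1 q) (psi11 q) (psi (pxi q)) (psi11 (pxi q)) (psi2 (pxi q))
    (psi12 (pxi q)) (dxi psi12 (pxi q)) => f f1 f11 g g11 g2 g12 g112 g0 e1 e2.
  apply: (mulfI g0); rewrite mulr0 [LHS](_ : _ = f * (g * g112) - (f11 * g) * g2); last by ring.
  by rewrite e2 -e1; ring.
have be0 : be (pet p) = be p.
  apply: (const_along_xi sbe _ Wp) => q Wq; have Wxq := ball_proj_xi Wq.
  have E := has_der_add (has_der_mul (has_der_dxi spsi Wq) (dxi_proj s1 Wq))
    (has_der_opp (has_der_mul (has_der_dxi s1 Wq) (dxi_proj spsi Wq))).
  rewrite (dxi_val E); have := psi_ode Wq.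
  move: (psi q) (psi1 q) (psi11 q) (psi (pxi q)) (psi11 (pxi q)) (psi1 (pxi q))
    => f f1 f11 g g11 g1 e1.
  rewrite [LHS](_ : _ = g11 * f - f11 * g); last by ring.
  by rewrite e1 subrr.
have wx := wronskian Wx; move: al0 be0; rewrite /al /be proj_xi_et.
rewrite /factor_xi1 /factor_xi2 /factor_eta1 /factor_eta2.
move: (psi p) (psi1 p) (psi (pet p)) (psi1 (pet p)) (psi (pxi p)) (psi1 (pxi p))
  (psi2 (pxi p)) (psi12 (pxi p)) (psi t0) (psi1 t0) (psi2 t0) (psi12 t0) wx.
move=> f f1 h h1 g g1 g2 g12 k k1 k2 k12 wx al0 be0.
rewrite [LHS](_ : _ = (g * (h * k12 - h1 * k2) - g2 * (h * k1 - h1 * k)) / d); last by ring.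
rewrite al0 be0 [X in X / d](_ : _ = f * (g * g12 - g1 * g2)); last by ring.
by rewrite wx mulfK.
Qed.

Lemma factor_xi_props p : W p -> [/\ deta factor_xi1 p = 0, deta factor_xi2 p = 0 &
  factor_xi1 p * dxi factor_xi2 p - factor_xi2 p * dxi factor_xi1 p = d].
Proof.
move=> Wp; rewrite (deta_val (deta_pxi spsi Wp)) (deta_val (deta_pxi s2 Wp)).
rewrite (dxi_val (dxi_proj spsi Wp)) (dxi_val (dxi_proj s2 Wp)); split=> //.
by rewrite -(wronskian (ball_proj_xi Wp)) [_ * psi1 _]mulrC.
Qed.

Lemma factor_eta_props p : W p -> [/\ dxi factor_eta1 p = 0, dxi factor_eta2 p = 0 &
  factor_eta1 p * deta factor_eta2 p - factor_eta2 p * deta factor_eta1 p = 1].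
Proof.
move=> Wp; have We := ball_proj_et Wp; have Wt : W t0 := ballxx t0 r0.
have K (k : R) h := has_der_cst p h k.
have dx (k l : R) := has_der_mul (has_der_add (has_der_mul (K k _) (dxi_pet spsi Wp))
  (has_der_opp (has_der_mul (K l _) (dxi_pet s1 Wp)))) (K d^-1 _).
have de (k l : R) := has_der_mul (has_der_add (has_der_mul (K k _) (deta_proj spsi Wp))
  (has_der_opp (has_der_mul (K l _) (deta_proj s1 Wp)))) (K d^-1 _).
rewrite (dxi_val (dx (psi1 t0) (psi t0))) (dxi_val (dx (psi12 t0) (psi2 t0))).
rewrite (deta_val (de (psi1 t0) (psi t0))) (deta_val (de (psi12 t0) (psi2 t0))).
split; [by ring|by ring|].
rewrite /factor_eta1 /factor_eta2 (null_swap oW spsi We).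
have := wronskian We; have := wronskian Wt.
move: (psi (pet p)) (psi1 (pet p)) (psi2 (pet p)) (psi12 (pet p)) => f f1 f2 f12.
move: (psi t0) (psi1 t0) (psi2 t0) (psi12 t0) => g g1 g2 g12 e1 e2.
rewrite [LHS](_ : _ = (f * f12 - f1 * f2) * (g * g12 - g1 * g2) / (d * d)).
  by rewrite e1 e2; field; exact: d0.
by field; exact: d0.
Qed.

Lemma smooth_factors : [/\ smooth W factor_xi1, smooth W factor_xi2,
  smooth W factor_eta1 & smooth W factor_eta2].
Proof.
have se (f : plane -> R) : smooth W f -> smooth W (fun q => f (pet q)).
  exact: smooth_proj_et.
have C k : smooth W (fun=> k : R) by exact: smooth_cst.
have F k l := smooth_mul oW (smooth_add oW (smooth_mul oW (C k) (se _ spsi))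
  (smooth_opp oW (smooth_mul oW (C l) (se _ s1)))) (C d^-1).
split; [exact: smooth_proj_xi|exact: smooth_proj_xi|exact: F|exact: F].
Qed.

End Factorisation.

(** * The surface built from the factors *)

Section Tensor.
Variable R : realType.
Local Notation plane := 'rV[R]_2.
Local Notation space := 'rV[R]_4.

(** The tensor product of the vectors [(p1, p2)] and [(q1, q2)], for an
identification of the matrices of order two with [R^4_2] under which the
determinant is the quadratic form. The sign of the last coordinate decides the
orientation, see [det_tensor]. *)
Definition tensor (p1 p2 q1 q2 : R) : space := \row_(i < 4)
  nth 0 [:: (p2 * q2 - p1 * q1) / 2; (p2 * q2 + p1 * q1) / 2;
            (p1 * q2 + p2 * q1) / 2; (p1 * q2 - p2 * q1) / 2] i.

Lemma sdot_tensor p1 p2 q1 q2 r1 r2 s1 s2 :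
  sdot (tensor p1 p2 q1 q2) (tensor r1 r2 s1 s2) =
  2^-1 * (p1 * r2 - p2 * r1) * (q1 * s2 - q2 * s1).
Proof. by rewrite sdotE !mxE /=; field. Qed.

Lemma det_tensor (p1 p2 q1 q2 r1 r2 s1 s2 dp1 dp2 dq1 dq2 dr1 dr2 ds1 ds2 : R) :
  \det (frame (2 *: tensor p1 p2 q1 q2) ((- 2^-1) *: tensor r1 r2 s1 s2)
     (2 *: (tensor dp1 dp2 q1 q2 + tensor p1 p2 dq1 dq2))
     ((- 2^-1) *: (tensor dr1 dr2 s1 s2 + tensor r1 r2 ds1 ds2))) =
  4^-1 * ((p1 * dp2 - p2 * dp1) * (r1 * dr2 - r2 * dr1) * (q1 * s2 - q2 * s1) ^+ 2
        - (q1 * dq2 - q2 * dq1) * (s1 * ds2 - s2 * ds1) * (p1 * r2 - p2 * r1) ^+ 2).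
Proof.
by rewrite det4 /frame !mxE /=; field.
Qed.

Lemma has_der_tensor (P1 P2 Q1 Q2 : plane -> R) p h p1 p2 q1 q2 :
  has_der p h P1 p1 -> has_der p h P2 p2 -> has_der p h Q1 q1 -> has_der p h Q2 q2 ->
  has_der p h (fun z => tensor (P1 z) (P2 z) (Q1 z) (Q2 z))
    (tensor p1 p2 (Q1 p) (Q2 p) + tensor (P1 p) (P2 p) q1 q2).
Proof.
move=> d1 d2 e1 e2; apply: has_der_mx => i j; rewrite [i]ord1.
under eq_fun do rewrite mxE; rewrite !mxE.
have half := has_der_cst p h (2^-1 : R).
elim/ord4P: j => /=.
- apply: has_der_eq (has_der_mul (has_der_add (has_der_mul d2 e2)
    (has_der_opp (has_der_mul d1 e1))) half) _; ring.
- apply: has_der_eq (has_der_mul (has_der_add (has_der_mul d2 e2)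
    (has_der_mul d1 e1)) half) _; ring.
- apply: has_der_eq (has_der_mul (has_der_add (has_der_mul d1 e2)
    (has_der_mul d2 e1)) half) _; ring.
- apply: has_der_eq (has_der_mul (has_der_add (has_der_mul d1 e2)
    (has_der_opp (has_der_mul d2 e1))) half) _; ring.
Qed.

Lemma smooth_tensor D (P1 P2 Q1 Q2 : plane -> R) : open D -> smooth D P1 -> smooth D P2 ->
  smooth D Q1 -> smooth D Q2 -> smooth D (fun z => tensor (P1 z) (P2 z) (Q1 z) (Q2 z)).
Proof.
move=> oD s1 s2 r1 r2; apply: (smooth_mx oD) => i j; rewrite [i]ord1.
under eq_fun do rewrite mxE.
have half := smooth_cst D (2^-1 : R).
elim/ord4P: j => /=.
- exact: (smooth_mul oD (smooth_add oD (smooth_mul oD s2 r2) (smooth_opp oD (smooth_mul oD s1 r1))) half).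
- exact: (smooth_mul oD (smooth_add oD (smooth_mul oD s2 r2) (smooth_mul oD s1 r1)) half).
- exact: (smooth_mul oD (smooth_add oD (smooth_mul oD s1 r2) (smooth_mul oD s2 r1)) half).
- exact: (smooth_mul oD (smooth_add oD (smooth_mul oD s1 r2) (smooth_opp oD (smooth_mul oD s2 r1))) half).
Qed.

End Tensor.

Section SurfaceFromFactors.
Variable R : realType.
Local Notation plane := 'rV[R]_2.
Local Notation space := 'rV[R]_4.
Variables (t0 : plane) (r : R) (r0 : 0 < r) (psi chi : plane -> R) (eps : R).
Local Notation W := (ball t0 r).
Local Notation U := (ball t0 (r / 2)).
Hypotheses (spsi : smooth W psi) (schi : smooth W chi).
Hypotheses (psi0 : forall p, W p -> 0 < psi p) (chi0 : forall p, W p -> 0 < chi p).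
Hypothesis eps2 : eps ^+ 2 = 1.
Hypothesis wpsi : forall p, W p -> psi p * dxi (deta psi) p - dxi psi p * deta psi p = eps / 4.
Hypothesis wchi : forall p, W p -> chi p * dxi (deta chi) p - dxi chi p * deta chi p = - eps / 4.

(** The tangents are [2 p (x) q] and [- (1/2) r (x) s], for the factors [p, r] of
[psi] and [q, s] of [chi]. The Wronskians [eps/4] and [- eps/4] of [p] and [q]
and [1] of [r] and [s] make the squares of the second derivatives [1/4] and
[- 1/4]. *)
Lemma surface_from_factors : exists x : plane -> space,
  [/\ null_form x U, forall p, U p -> metric x p = - 2^-1 * (psi p * chi p) &
      forall p, U p -> frame_det x p = eps / 16 * (psi p ^+ 2 + chi p ^+ 2)].
Proof.
have oW : open W by exact: ball_open.
have oU : open U by exact: ball_open.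
have UW : U `<=` W by apply: le_ball; have := r0; lra.
have e0 : eps != 0 by apply: contraPneq eps2 => ->; rewrite expr0n /= => /esym /eqP; rewrite oner_eq0.
have d1 : eps / 4 != 0 by rewrite mulf_neq0 // invr_eq0 pnatr_eq0.
have d2 : - eps / 4 != 0 by rewrite mulf_neq0 ?oppr_eq0 // invr_eq0 pnatr_eq0.
have psin0 p : W p -> psi p != 0 by move=> /psi0; rewrite lt0r => /andP[].
have chin0 p : W p -> chi p != 0 by move=> /chi0; rewrite lt0r => /andP[].
have [sp1 sp2 sr1 sr2] := smooth_factors (eps / 4) spsi.
have [sq1 sq2 ss1 ss2] := smooth_factors (- eps / 4) schi.
have FP := factorisation spsi psin0 d1 wpsi.
have FQ := factorisation schi chin0 d2 wchi.
have XP := factor_xi_props spsi wpsi; have XQ := factor_xi_props schi wchi.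
have EP := factor_eta_props r0 spsi d1 wpsi; have EQ := factor_eta_props r0 schi d2 wchi.
move: (factor_xi1 t0 psi) (factor_xi2 t0 psi) (factor_eta1 t0 psi (eps / 4))
  (factor_eta2 t0 psi (eps / 4)) sp1 sp2 sr1 sr2 FP XP EP => p1 p2 r1 r2 sp1 sp2 sr1 sr2 FP XP EP.
move: (factor_xi1 t0 chi) (factor_xi2 t0 chi) (factor_eta1 t0 chi (- eps / 4))
  (factor_eta2 t0 chi (- eps / 4)) sq1 sq2 ss1 ss2 FQ XQ EQ => q1 q2 s1 s2 sq1 sq2 ss1 ss2 FQ XQ EQ.
pose a p := 2 *: tensor (p1 p) (p2 p) (q1 p) (q2 p).
pose b p := (- 2^-1) *: tensor (r1 p) (r2 p) (s1 p) (s2 p).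
have sa : smooth W a := smooth_scale oW (smooth_cst W (2 : R)) (smooth_tensor oW sp1 sp2 sq1 sq2).
have sb : smooth W b := smooth_scale oW (smooth_cst W (- 2^-1 : R)) (smooth_tensor oW sr1 sr2 ss1 ss2).
have da h p v1 v2 v3 v4 : has_der p h p1 v1 -> has_der p h p2 v2 -> has_der p h q1 v3 ->
    has_der p h q2 v4 -> has_der p h a
    (2 *: (tensor v1 v2 (q1 p) (q2 p) + tensor (p1 p) (p2 p) v3 v4)).
  move=> h1 h2 h3 h4; have E := has_der_scale (has_der_cst p h (2 : R)) (has_der_tensor h1 h2 h3 h4).
  by apply: has_der_eq E _; rewrite scale0r add0r.
have db h p v1 v2 v3 v4 : has_der p h r1 v1 -> has_der p h r2 v2 -> has_der p h s1 v3 ->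
    has_der p h s2 v4 -> has_der p h b
    ((- 2^-1) *: (tensor v1 v2 (s1 p) (s2 p) + tensor (r1 p) (r2 p) v3 v4)).
  move=> h1 h2 h3 h4; have E := has_der_scale (has_der_cst p h (- 2^-1 : R)) (has_der_tensor h1 h2 h3 h4).
  by apply: has_der_eq E _; rewrite scale0r add0r.
have t00 (u v u' v' : R) : tensor 0 0 u v + tensor u' v' 0 0 = 0.
  by apply/rowP => i; rewrite !mxE; elim/ord4P: i => /=; rewrite !(mul0r, mulr0) ?subrr ?addr0 mul0r addr0.
have a_eta p : W p -> deta a p = 0.
  move=> Wp; have [x1 x2 _] := XP p Wp; have [x3 x4 _] := XQ p Wp.
  rewrite (deta_val (da _ _ _ _ _ _ (has_der_deta sp1 Wp) (has_der_deta sp2 Wp)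
    (has_der_deta sq1 Wp) (has_der_deta sq2 Wp))).
  by rewrite x1 x2 x3 x4 t00 scaler0.
have b_xi p : W p -> dxi b p = 0.
  move=> Wp; have [x1 x2 _] := EP p Wp; have [x3 x4 _] := EQ p Wp.
  rewrite (dxi_val (db _ _ _ _ _ _ (has_der_dxi sr1 Wp) (has_der_dxi sr2 Wp)
    (has_der_dxi ss1 Wp) (has_der_dxi ss2 Wp))).
  by rewrite x1 x2 x3 x4 t00 scaler0.
have [x dx] := exact_null_form r0 sa sb a_eta b_xi.
have [sx xa xb] := smooth_of_der oU (smooth_sub UW sa) (smooth_sub UW sb) dx.
have xA p : U p -> dxi (dxi x) p = 2 *: (tensor (dxi p1 p) (dxi p2 p) (q1 p) (q2 p)
    + tensor (p1 p) (p2 p) (dxi q1 p) (dxi q2 p)).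
  move=> Up; have Wp := UW _ Up; apply: dxi_val; apply: (has_der_on oU xa Up).
  exact: da (has_der_dxi sp1 Wp) (has_der_dxi sp2 Wp) (has_der_dxi sq1 Wp) (has_der_dxi sq2 Wp).
have xB p : U p -> deta (deta x) p = (- 2^-1) *: (tensor (deta r1 p) (deta r2 p) (s1 p) (s2 p)
    + tensor (r1 p) (r2 p) (deta s1 p) (deta s2 p)).
  move=> Up; have Wp := UW _ Up; apply: deta_val; apply: (has_der_on oU xb Up).
  exact: db (has_der_deta sr1 Wp) (has_der_deta sr2 Wp) (has_der_deta ss1 Wp) (has_der_deta ss2 Wp).
have xC p : U p -> dxi (deta x) p = 0.
  move=> Up; have Wp := UW _ Up; rewrite -(b_xi _ Wp) !dxi_app.
  by have E := derive_on (wxi R) oU xb Up; exact: E.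
have met p : U p -> metric x p = - 2^-1 * (psi p * chi p).
  move=> Up; have Wp := UW _ Up; rewrite /metric xa // xb // -(FP _ Wp) -(FQ _ Wp).
  by rewrite /a /b sdotZl sdotZr sdot_tensor; field.
exists x; split=> //; last first.
  move=> p Up; have Wp := UW _ Up; rewrite /frame_det xa // xb // xA // xB // /a /b det_tensor.
  have [_ _ ->] := XP p Wp; have [_ _ ->] := XQ p Wp.
  have [_ _ ->] := EP p Wp; have [_ _ ->] := EQ p Wp.
  by rewrite (FP _ Wp) (FQ _ Wp); field.
split=> // p Up; have Wp := UW _ Up.
  rewrite -/(metric x p) met // xa // xb // /a /b !(sdotZl, sdotZr) !sdot_tensor.
  have := mulr_gt0 (psi0 Wp) (chi0 Wp); move: (_ * _) => z z0.
  by split; [ring|ring|lra].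
rewrite xA // xB //.
have [_ _ wP] := XP p Wp; have [_ _ wQ] := XQ p Wp.
have [_ _ wR] := EP p Wp; have [_ _ wS] := EQ p Wp.
split.
  rewrite !sdotL !sdot_tensor.
  move: (p1 p) (p2 p) (q1 p) (q2 p) (dxi p1 p) (dxi p2 p) (dxi q1 p) (dxi q2 p) wP wQ.
  move=> u v u' v' w z w' z' e1 e2.
  rewrite [LHS](_ : _ = - 4 * (u * z - v * w) * (u' * z' - v' * w')); last by field.
  rewrite e1 e2 [LHS](_ : _ = 4^-1 * eps ^+ 2); last by field.
  by rewrite eps2 mulr1.
rewrite !sdotL !sdot_tensor.
move: (r1 p) (r2 p) (s1 p) (s2 p) (deta r1 p) (deta r2 p) (deta s1 p) (deta s2 p) wR wS.
move=> u v u' v' w z w' z' e1 e2.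
rewrite [LHS](_ : _ = - 4^-1 * (u * z - v * w) * (u' * z' - v' * w')); last by field.
by rewrite e1 e2 !mulr1.
Qed.

End SurfaceFromFactors.

(** * Decoupling of the system *)

Section Liouville.
Variable R : realType.
Local Notation plane := 'rV[R]_2.
Variables (W : set plane) (oW : open W).

Lemma has_der_exp (f : plane -> R) p h v : has_der p h f v ->
  has_der p h (fun q => expR (f q)) (expR (f p) * v).
Proof. by move=> [df <-]; exact: derive_comp1 (is_derive_expR _) df. Qed.

Lemma hlaplacian_on (f g : plane -> R) p : (forall q, W q -> f q = g q) -> W p ->
  hlaplacian f p = hlaplacian g p.
Proof.
move=> fg Wp.
have H w : 'D_w (fun q => 'D_w f q) p = 'D_w (fun q => 'D_w g q) p.
  by have E := derive_on w oW (fun q Wq => derive_on w oW fg Wq) Wp; exact: E.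
by have E := congr2 (fun s t => s - t) (H (unitv R 0)) (H (unitv R 1)); exact: E.
Qed.

Lemma mixed_comb (u v : plane -> R) (c d : R) p : smooth W u -> smooth W v -> W p ->
  dxi (deta (fun q => c * u q + d * v q)) p = c * dxi (deta u) p + d * dxi (deta v) p.
Proof.
move=> su sv; have lin h (s t : plane -> R) q : smooth W s -> smooth W t -> W q ->
    has_der q h (fun q => c * s q + d * t q) (c * 'D_h s q + d * 'D_h t q).
  move=> ss st Wq; apply: has_der_eq (has_der_add (has_der_mul (has_der_cst _ _ c) (has_der_smooth h ss Wq))
    (has_der_mul (has_der_cst _ _ d) (has_der_smooth h st Wq))) _.
  by rewrite !mul0r !add0r.
have E q : W q -> deta (fun q => c * u q + d * v q) q = c * deta u q + d * deta v q.
  by move=> Wq; rewrite (deta_val (lin _ _ _ _ su sv Wq)) -!deta_app.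
move=> Wp; have su' := smooth_deta su; have sv' := smooth_deta sv.
by rewrite (dxi_val (has_der_on oW E Wp (lin _ _ _ _ su' sv' Wp))) -!dxi_app.
Qed.

Lemma exp_mixed (c : R) (f : plane -> R) p : smooth W f -> W p ->
  let E := fun q => c * expR (f q) in
  [/\ dxi E p = E p * dxi f p, deta E p = E p * deta f p &
      dxi (deta E) p = E p * (dxi f p * deta f p + dxi (deta f) p)].
Proof.
move=> sf; have lin h q : W q -> has_der q h (fun q => c * expR (f q)) (c * expR (f q) * 'D_h f q).
  move=> Wq; apply: has_der_eq (has_der_mul (has_der_cst _ _ c) (has_der_exp (has_der_smooth h sf Wq))) _.
  by rewrite mul0r add0r mulrA.
move=> Wp E.
have D2 q : W q -> deta E q = E q * deta f q by move=> Wq; rewrite (deta_val (lin _ _ Wq)) -deta_app.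
split; [by rewrite (dxi_val (lin _ _ Wp)) -dxi_app|exact: D2|].
have H := has_der_mul (lin (wxi R) _ Wp) (has_der_dxi (smooth_deta sf) Wp).
rewrite (dxi_val (has_der_on oW D2 Wp H)) -dxi_app /E.
by rewrite mulrDr mulrA.
Qed.

Lemma exp_wronskian (f : plane -> R) p : smooth W f -> W p ->
  let E := fun q => expR (f q) in
  E p * dxi (deta E) p - dxi E p * deta E p = E p ^+ 2 * dxi (deta f) p.
Proof.
move=> sf Wp E; have [] := exp_mixed 1 sf Wp.
have -> : (fun q => 1 * expR (f q)) = E by apply/funext => q; rewrite mul1r.
by rewrite mul1r => -> -> ->; rewrite /E; ring.
Qed.

Variables (K kappa : plane -> R) (eps : R).
Hypotheses (sK : smooth W K) (skappa : smooth W kappa) (eps2 : eps ^+ 2 = 1).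
Hypothesis posA : forall p, W p -> 0 < eps * (K p + kappa p).
Hypothesis posB : forall p, W p -> 0 < eps * (kappa p - K p).
Hypothesis eqK : forall p, W p ->
  `|K p ^+ 2 - kappa p ^+ 2| `^ (4^-1) *
     hlaplacian (fun q => ln `|K q ^+ 2 - kappa q ^+ 2|) p = - 8 * K p.
Hypothesis eqkappa : forall p, W p ->
  `|K p ^+ 2 - kappa p ^+ 2| `^ (4^-1) *
     hlaplacian (fun q => ln `|(K q + kappa q) / (K q - kappa q)|) p = - 4 * kappa p.

Definition lnA p := ln (eps * (K p + kappa p)).
Definition lnB p := ln (eps * (kappa p - K p)).
(** The functions [P = exp (- 2 log_psi)] and [Q = exp (- 2 log_chi)] satisfy the
Liouville equations [2 (ln P)_xieta = - eps P] and [2 (ln Q)_xieta = eps Q]. *)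
Definition log_psi p := (- 3 / 8) * lnA p + 8^-1 * lnB p.
Definition log_chi p := 8^-1 * lnA p + (- 3 / 8) * lnB p.

Lemma smooth_lnA : smooth W lnA.
Proof.
apply: (smooth_ln oW) posA.
exact: (smooth_mul oW (smooth_cst W eps) (smooth_add oW sK skappa)).
Qed.

Lemma smooth_lnB : smooth W lnB.
Proof.
apply: (smooth_ln oW) posB.
exact: (smooth_mul oW (smooth_cst W eps) (smooth_add oW skappa (smooth_opp oW sK))).
Qed.

Lemma smooth_comb (u v : plane -> R) (c d : R) : smooth W u -> smooth W v ->
  smooth W (fun q => c * u q + d * v q).
Proof.
move=> su sv.
exact: (smooth_add oW (smooth_mul oW (smooth_cst W c) su) (smooth_mul oW (smooth_cst W d) sv)).
Qed.

Lemma smooth_log_psi : smooth W log_psi.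
Proof. exact: smooth_comb smooth_lnA smooth_lnB. Qed.
Lemma smooth_log_chi : smooth W log_chi.
Proof. exact: smooth_comb smooth_lnA smooth_lnB. Qed.

Let abs_eps : `|eps| = 1.
Proof. by apply/eqP; rewrite -sqrp_eq1 // real_normK ?num_real // eps2. Qed.

Lemma abs_sum p : W p -> `|K p + kappa p| = expR (lnA p).
Proof.
by move=> Wp; rewrite /lnA lnK ?posrE ?posA // -[RHS](gtr0_norm (posA Wp)) normrM abs_eps mul1r.
Qed.

Lemma abs_diff p : W p -> `|K p - kappa p| = expR (lnB p).
Proof.
by move=> Wp; rewrite /lnB lnK ?posrE ?posB // -[RHS](gtr0_norm (posB Wp)) normrM abs_eps
  mul1r distrC.
Qed.

(** The fourth root of [kappa^2 - K^2]. *)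
Definition weight p := expR (4^-1 * (lnA p + lnB p)).

Lemma abs_prod p : W p -> `|K p ^+ 2 - kappa p ^+ 2| = expR (lnA p + lnB p).
Proof.
by move=> Wp; rewrite subr_sqr mulrC normrM abs_sum // abs_diff // -expRD.
Qed.

(** The wave operator is four times the mixed derivative, and the arguments of the
two logarithms in the system are the product and the quotient of [eps (K + kappa)]
and [eps (kappa - K)]. *)
Lemma mixed_logs p : W p ->
  weight p * (dxi (deta lnA) p + dxi (deta lnB) p) = - 2 * K p /\
  weight p * (dxi (deta lnA) p - dxi (deta lnB) p) = - kappa p.
Proof.
move=> Wp; have sA := smooth_lnA; have sB := smooth_lnB.
have := eqK Wp; have := eqkappa Wp.
have -> : `|K p ^+ 2 - kappa p ^+ 2| `^ 4^-1 = weight p.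
  by rewrite abs_prod // /powR gt_eqF ?expR_gt0 // expRK.
have L1 q : W q -> ln `|K q ^+ 2 - kappa q ^+ 2| = 1 * lnA q + 1 * lnB q.
  by move=> Wq; rewrite abs_prod // expRK !mul1r.
have L2 q : W q -> ln `|(K q + kappa q) / (K q - kappa q)| = 1 * lnA q + (-1) * lnB q.
  move=> Wq; rewrite normrM normfV abs_sum // abs_diff // -expRN -expRD expRK.
  by rewrite mul1r mulN1r.
rewrite (hlaplacian_on L1 Wp) (hlaplacian_on L2 Wp).
rewrite (hlaplacian_null oW (smooth_comb 1 1 sA sB) Wp) (hlaplacian_null oW (smooth_comb 1 (-1) sA sB) Wp).
rewrite !mixed_comb //.
move: (weight p) (dxi _ p) (dxi _ p) => w u v e1 e2.
by split; lra.
Qed.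

Let expA p : W p -> expR (lnA p) = eps * (K p + kappa p).
Proof. by move=> Wp; rewrite /lnA lnK // posrE posA. Qed.
Let expB p : W p -> expR (lnB p) = eps * (kappa p - K p).
Proof. by move=> Wp; rewrite /lnB lnK // posrE posB. Qed.

Lemma exp_log_psi p : expR (log_psi p) ^+ 2 * expR (lnA p) = weight p.
Proof.
by rewrite expr2 -!expRD /weight; congr expR; rewrite /log_psi; field.
Qed.

Lemma exp_log_chi p : expR (log_chi p) ^+ 2 * expR (lnB p) = weight p.
Proof.
by rewrite expr2 -!expRD /weight; congr expR; rewrite /log_chi; field.
Qed.

Lemma exp_log_prod p : expR (log_psi p) * expR (log_chi p) * weight p = 1.
Proof.
by rewrite /weight -!expRD -[RHS]expR0; congr expR; rewrite /log_psi /log_chi; field.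
Qed.

Lemma mixed_log_psi p : W p -> weight p * dxi (deta log_psi) p = (K p + kappa p) / 4.
Proof.
move=> Wp; rewrite mixed_comb //; [|exact: smooth_lnA|exact: smooth_lnB].
have [] := mixed_logs Wp; move: (dxi _ p) (dxi _ p) (weight p) => u v w; lra.
Qed.

Lemma mixed_log_chi p : W p -> weight p * dxi (deta log_chi) p = (K p - kappa p) / 4.
Proof.
move=> Wp; rewrite mixed_comb //; [|exact: smooth_lnA|exact: smooth_lnB].
have [] := mixed_logs Wp; move: (dxi _ p) (dxi _ p) (weight p) => u v w; lra.
Qed.

Lemma liouville_psi p : W p -> expR (log_psi p) ^+ 2 * dxi (deta log_psi) p = eps / 4.
Proof.
move=> Wp; have A0 := posA Wp; have H := mixed_log_psi Wp; have E := exp_log_psi p.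
rewrite expA // in E; apply: (@mulIf _ (eps * (K p + kappa p))); first by rewrite gt_eqF.
rewrite mulrAC E H [RHS](_ : _ = eps ^+ 2 * (K p + kappa p) / 4); last by ring.
by rewrite eps2 mul1r.
Qed.

Lemma liouville_chi p : W p -> expR (log_chi p) ^+ 2 * dxi (deta log_chi) p = - eps / 4.
Proof.
move=> Wp; have B0 := posB Wp; have H := mixed_log_chi Wp; have E := exp_log_chi p.
rewrite expB // in E; apply: (@mulIf _ (eps * (kappa p - K p))); first by rewrite gt_eqF.
rewrite mulrAC E H [RHS](_ : _ = eps ^+ 2 * (K p - kappa p) / 4); last by ring.
by rewrite eps2 mul1r.
Qed.

(** [K] is twice [weight] times the mixed derivative of [log_psi + log_chi], that
is, of the logarithm of the metric. And [kappa] is half the sum of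
[eps (K + kappa)] and [eps (kappa - K)] up to the sign [eps], and these are
[weight / psi^2] and [weight / chi^2]. *)
Lemma curvatures_from_logs U (x : plane -> 'rV[R]_4) : open U -> U `<=` W ->
  (forall p, U p -> metric x p = - 2^-1 * (expR (log_psi p) * expR (log_chi p))) ->
  (forall p, U p -> frame_det x p = eps / 16 * (expR (log_psi p) ^+ 2 + expR (log_chi p) ^+ 2)) ->
  forall p, U p -> K p = - mixed x p / metric x p ^+ 2 /\
    kappa p = - frame_det x p / metric x p ^+ 3.
Proof.
move=> oU UW met det p Up; have Wp := UW _ Up.
have sp := smooth_log_psi; have sc := smooth_log_chi.
pose h q := 1 * log_psi q + 1 * log_chi q.
have sh : smooth W h by exact: smooth_comb.
have met' q : U q -> metric x q = - 2^-1 * expR (h q).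
  move=> Uq; have -> : h q = log_psi q + log_chi q by rewrite /h !mul1r.
  by rewrite expRD met.
have [e1 e2 e12] := exp_mixed (- 2^-1) sh Wp.
have d1 : dxi (metric x) p = dxi (fun q => - 2^-1 * expR (h q)) p.
  by rewrite !dxi_app; have E := derive_on (wxi R) oU met' Up; exact: E.
have d2 q : U q -> deta (metric x) q = deta (fun q => - 2^-1 * expR (h q)) q.
  by move=> Uq; rewrite !deta_app; have E := derive_on (weta R) oU met' Uq; exact: E.
have d12 : dxi (deta (metric x)) p = dxi (deta (fun q => - 2^-1 * expR (h q))) p.
  by rewrite !dxi_app; have E := derive_on (wxi R) oU d2 Up; exact: E.
have h12 : weight p * dxi (deta h) p = K p / 2.
  rewrite mixed_comb // !mul1r mulrDr mixed_log_psi // mixed_log_chi //; lra.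
have w0 : weight p != 0 by rewrite gt_eqF // expR_gt0.
have P := exp_log_prod p.
split.
  have hE : h p = log_psi p + log_chi p by rewrite /h !mul1r.
  rewrite /mixed d12 d1 d2 // e12 e1 e2 met' // hE expRD.
  have E0 : expR (log_psi p) * expR (log_chi p) != 0 by rewrite mulf_neq0 // gt_eqF // expR_gt0.
  have -> : K p = 2 * (weight p * dxi (deta h) p) by rewrite h12; field.
  have -> : weight p = (expR (log_psi p) * expR (log_chi p))^-1.
    by apply: (mulfI E0); rewrite P mulfV.
  move: (expR _ * expR _) E0 (dxi h p) (deta h p) (dxi (deta h) p) => E E0 u v k.
  by field.
rewrite det // met //.
have := exp_log_psi p; have := exp_log_chi p; rewrite expA // expB //.
have ps0 : expR (log_psi p) != 0 by rewrite gt_eqF // expR_gt0.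
have ch0 : expR (log_chi p) != 0 by rewrite gt_eqF // expR_gt0.
move: (expR (log_psi p)) (expR (log_chi p)) (weight p) ps0 ch0 w0 P => s c w s0 c0 w0 P eB eA.
have wE : w = (s * c)^-1 by apply: (mulfI (mulf_neq0 s0 c0)); rewrite P mulfV // mulf_neq0.
have kE : 2 * eps * kappa p = w / s ^+ 2 + w / c ^+ 2.
  have -> : w / s ^+ 2 = eps * (K p + kappa p) by rewrite -eA mulrC mulKf // expf_neq0.
  have -> : w / c ^+ 2 = eps * (kappa p - K p) by rewrite -eB mulrC mulKf // expf_neq0.
  by ring.
have -> : kappa p = eps / 2 * (2 * eps * kappa p).
  have -> : eps / 2 * (2 * eps * kappa p) = eps ^+ 2 * kappa p by field.
  by rewrite eps2 mul1r.
by rewrite kE wE; field; rewrite s0 c0.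
Qed.

End Liouville.

(** A ball is the union of the segments that join its centre to its points. *)
Lemma ball_connected (R : realType) (V : normedModType R) (c : V) (r : R) : 0 < r ->
  connected (ball c r).
Proof.
move=> r0.
have -> : ball c r = \bigcup_(p in ball c r) ((fun s : R => c + s *: (p - c)) @` `[0, 1]).
  apply/seteqP; split=> [p Bp|p [q Bq [s]]].
    exists p => //; exists 1; first by rewrite /= in_itv /= ler01 lexx.
    by rewrite scale1r addrC subrK.
  by rewrite /= in_itv /= => s01 <-; apply: ball_segment => //; exact: ballxx.
apply: bigcup_connected.
  exists c => p Bp; exists 0; first by rewrite /= in_itv /= lexx ler01.
  by rewrite scale0r addr0.
move=> p Bp; apply: connected_continuous_connected; first exact: segment_connected.
apply: continuous_subspaceT => s.
by apply: cvgD; [exact: cvg_cst|exact: scalel_continuous].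
Qed.

Theorem theorem7p9 (R : realType) (D : set 'rV[R]_2) (K kappa : 'rV[R]_2 -> R)
    (domD : is_domain D) (smoothK : smooth D K) (smoothkappa : smooth D kappa)
    (negKkappa : forall p, D p -> K p ^+ 2 - kappa p ^+ 2 < 0)
    (eqK : forall p, D p ->
       `|K p ^+ 2 - kappa p ^+ 2| `^ (4^-1) *
         hlaplacian (fun q => ln `|K q ^+ 2 - kappa q ^+ 2|) p
       = - 8 * K p)
    (eqkappa : forall p, D p ->
       `|K p ^+ 2 - kappa p ^+ 2| `^ (4^-1) *
         hlaplacian (fun q => ln `|(K q + kappa q) / (K q - kappa q)|) p
       = - 4 * kappa p)
    (t0 : 'rV[R]_2) (Dt0 : D t0) :
  (exists (U : set 'rV[R]_2) (x : 'rV[R]_2 -> 'rV[R]_4),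
     [/\ is_domain U, U t0 & U `<=` D] /\
     [/\ canonical_third_type_minimal_surface x U,
         has_gauss_curvature x U K & has_normal_curvature x U kappa]) /\
  (forall (U : set 'rV[R]_2) (x y : 'rV[R]_2 -> 'rV[R]_4),
     is_domain U -> U t0 -> U `<=` D ->
     canonical_third_type_minimal_surface x U ->
     has_gauss_curvature x U K -> has_normal_curvature x U kappa ->
     canonical_third_type_minimal_surface y U ->
     has_gauss_curvature y U K -> has_normal_curvature y U kappa ->
     exists (A : 'M[R]_4) (b : 'rV[R]_4),
       in_SO22 A /\ forall p, U p -> y p = x p *m A + b).
Proof.
split; last first.
  move=> U x y dU Ut0 _ cx Kx kx cy Ky ky.
  exact: canonical_unique dU Ut0 cx Kx kx cy Ky ky.
have [oD _] := domD.
(* [kappa] vanishes nowhere, because [K^2 < kappa^2] *)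
have k0 : kappa t0 != 0.
  apply/eqP => k0; have := negKkappa _ Dt0; rewrite k0 expr0n subr0 /= => h.
  by have := sqr_ge0 (K t0); lra.
pose eps := Num.sg (kappa t0).
have eps2 : eps ^+ 2 = 1 by rewrite sqr_sg k0.
have pos0 : 0 < eps * kappa t0 by rewrite /eps -normrEsg normr_gt0.
have nk : \forall p \near t0, 0 < eps * kappa p.
  have c : {for t0, continuous (fun p => eps * kappa p)}.
    apply: differentiable_continuous.
    exact: differentiableM (differentiable_cst _ _) (smooth_diff smoothkappa Dt0).
  exact: (c _ (open_nbhs_nbhs (conj (@open_gt _ 0) pos0))).
have nD : \forall p \near t0, D p by exact: open_nbhs_nbhs.
have /nbhs_ballP[r /= r0 rP] : nbhs t0 [set p | D p /\ 0 < eps * kappa p] by exact: filterI nD nk.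
have WD : ball t0 r `<=` D by move=> p /rP[].
have oW : open (ball t0 r) by exact: ball_open.
have posAB p : ball t0 r p -> 0 < eps * (K p + kappa p) /\ 0 < eps * (kappa p - K p).
  move=> /rP[Dp kp]; have N := negKkappa _ Dp.
  have e : (eps * (K p + kappa p)) * (eps * (kappa p - K p)) = kappa p ^+ 2 - K p ^+ 2.
    rewrite [LHS](_ : _ = eps ^+ 2 * (kappa p ^+ 2 - K p ^+ 2)); last by ring.
    by rewrite eps2 mul1r.
  have pr : 0 < (eps * (K p + kappa p)) * (eps * (kappa p - K p)) by rewrite e; lra.
  have sm : 0 < eps * (K p + kappa p) + eps * (kappa p - K p).
    by rewrite [X in 0 < X](_ : _ = 2 * (eps * kappa p)); [lra|ring].
  move: (eps * (K p + kappa p)) (eps * (kappa p - K p)) pr sm => a b pr sm.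
  have [a0|a0] := ltP 0 a; first by split=> //; move: pr; rewrite pmulr_rgt0.
  have b0 : 0 < b by lra.
  by move: pr; rewrite pmulr_lgt0 // => /lt_geF; rewrite a0.
have posA p Wp := (posAB p Wp).1; have posB p Wp := (posAB p Wp).2.
have sK := smooth_sub WD smoothK; have sk := smooth_sub WD smoothkappa.
have eqK' p (Wp : ball t0 r p) := eqK p (WD _ Wp).
have eqk' p (Wp : ball t0 r p) := eqkappa p (WD _ Wp).
have sp := smooth_log_psi oW sK sk posA posB.
have sc := smooth_log_chi oW sK sk posA posB.
have [||x [nf met det]] := @surface_from_factors R t0 r r0
   (fun p => expR (log_psi K kappa eps p)) (fun p => expR (log_chi K kappa eps p)) eps
   (smooth_exp oW sp) (smooth_exp oW sc) (fun p _ => expR_gt0 _) (fun p _ => expR_gt0 _) eps2.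
- move=> p Wp; apply: etrans (exp_wronskian oW sp Wp) _.
  exact: (liouville_psi oW sK sk eps2 posA posB eqK' eqk' Wp).
- move=> p Wp; apply: etrans (exp_wronskian oW sc Wp) _.
  exact: (liouville_chi oW sK sk eps2 posA posB eqK' eqk' Wp).
have r20 : 0 < r / 2 by rewrite divr_gt0.
have oU : open (ball t0 (r / 2)) by exact: ball_open.
have UW : ball t0 (r / 2) `<=` ball t0 r by apply: le_ball; lra.
have cur := curvatures_from_logs oW sK sk eps2 posA posB eqK' eqk' oU UW met det.
have dU : is_domain (ball t0 (r / 2)).
  by split=> //; exact: ball_connected.
exists (ball t0 (r / 2)), x; split.
  by split=> //; [exact: ballxx|move=> p /UW /WD].
have [sx nx _ _] := nf.
split; first exact: null_form_canonical.
  by apply/(gauss_curvatureE oU sx nx) => p /cur[].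
by apply/(normal_curvatureE oU nf) => p /cur[].
Qed.
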